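(* Let $N\ge1$, $a>-1$, $\varepsilon\in[0,1)$, $\gamma\in[0,2)$ and let $u$ be an entire solution to $$\begin{cases}\rho_\varepsilon^a\partial_tu-\operatorname{div}(\rho_\varepsilon^a\nabla u)=0&\text{in }\mathbb{R}^{N+1}_+\times\mathbb{R},\\ \rho_\varepsilon^a\partial_yu=0&\text{on }\partial\mathbb{R}^{N+1}_+\times\mathbb{R}.\end{cases}$$ Assume that there is a constant $C>0$ such that $$|u(z,t)|\le C\big(1+(|z|^2+|t|)^\gamma\big)^{1/2}\quad\text{for a.e. }(z,t)\in\mathbb{R}^{N+1}_+\times\mathbb{R}.$$ Then $u$ is a linear function depending only on $x$. Moreover, if $\gamma\in[0,1)$, then $u$ is constant.
   Context: Points are $(z,t)=(x,y,t)\in\mathbb{R}^N\times\mathbb{R}\times\mathbb{R}$, $z=(x,y)$; $\nabla,\operatorname{div}$ are with respect to $z$; $\mathbb{R}^{N+1}_+=\{z=(x,y)\in\mathbb{R}^{N+1}:y>0\}$. $\rho_\varepsilon^a(y)=(\varepsilon^2+y^2)^{a/2}$, with $\rho_0^a=|y|^a$. $B_r\subset\mathbb{R}^{N+1}$ is the ball of radius $r$ centered at $0$, $B_r^+=B_r\cap\{y>0\}$, $I_r=(-r^2,r^2)$, $Q_r=B_r\times I_r$, $Q_r^+=B_r^+\times I_r$. $L^2(I_r;H^1(B_r^+,\rho_\varepsilon^a))$ is the completion of $C^\infty(\overline{Q_r^+})$ with respect to $(\int_{Q_r^+}\rho_\varepsilon^a(u^2+|\nabla u|^2)\,dz\,dt)^{1/2}$,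 and $L^\infty(I_r;L^2(B_r^+,\rho_\varepsilon^a))$ has norm $\operatorname{ess\,sup}_{t\in I_r}(\int_{B_r^+}\rho_\varepsilon^au^2(z,t)\,dz)^{1/2}$. $u$ is an entire solution to the problem $\rho_\varepsilon^a\partial_tu-\operatorname{div}(\rho_\varepsilon^a\nabla u)=0$ in $\mathbb{R}^{N+1}_+\times\mathbb{R}$, $\rho_\varepsilon^a\partial_yu=0$ on $\partial\mathbb{R}^{N+1}_+\times\mathbb{R}$, if for every $r>0$ one has $u\in L^2(I_r;H^1(B_r^+,\rho_\varepsilon^a))\cap L^\infty(I_r;L^2(B_r^+,\rho_\varepsilon^a))$ and $$-\int_{Q_r^+}\rho_\varepsilon^au\,\partial_t\phi\,dz\,dt+\int_{Q_r^+}\rho_\varepsilon^a\nabla u\cdot\nabla\phi\,dz\,dt=0\quad\text{for all }\phi\in C_c^\infty(Q_r).$$ ''Linear function depending only on $x$'' means a polynomial of degree at most one in $x$, i.e. $u(x,y,t)=b\cdot x+c$ for some $b\in\mathbb{R}^N$, $c\in\mathbb{R}$ (a.e.). *)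

(* Defs.v *)
From HB Require Import structures.
From mathcomp Require Import all_boot all_order all_algebra.
From mathcomp Require Import all_classical all_reals all_analysis.
From mathcomp Require Import ess_sup_inf.

Set Implicit Arguments.
Unset Strict Implicit.
Unset Printing Implicit Defensive.
Import Order.TTheory GRing.Theory Num.Theory.
Import numFieldNormedType.Exports.

Local Open Scope classical_set_scope.
Local Open Scope ring_scope.

Definition rV_display : measure_display -> measure_display.
Proof. exact. Qed.

Section measurable_rV.
Context {d : measure_display} {T : sigmaRingType d}.
Variable n : nat.

Let coors : 'I_n -> 'rV[T]_n -> T := fun i x => x ord0 i.

Let rV_set0 : g_sigma_preimage coors set0.
Proof. exact: sigma_algebra0. Qed.

Let rV_setC A : g_sigma_preimage coors A -> g_sigma_preimage coors (~` A).
Proof. exact: sigma_algebraC. Qed.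

Let rV_bigcup (F : _^nat) : (forall i, g_sigma_preimage coors (F i)) ->
  g_sigma_preimage coors (\bigcup_i (F i)).
Proof. exact: sigma_algebra_bigcup. Qed.

HB.instance Definition _ := @isMeasurable.Build (rV_display d)
  'rV[T]_n (g_sigma_preimage coors) rV_set0 rV_setC rV_bigcup.

End measurable_rV.


Section measurable_rV_lemmas.
Context {d d' : measure_display} {T : sigmaRingType d} {T' : measurableType d'}.

Lemma measurable_rV_coord n (i : 'I_n) :
  measurable_fun [set: 'rV[T]_n] (fun x => x ord0 i).
Proof.
move=> _ Y mY; rewrite setTI; apply: sub_sigma_algebra => /=.
rewrite -bigcup_seq/=; exists i => /=; first by rewrite mem_index_enum.
by exists Y => //; rewrite setTI.
Qed.

Lemma measurable_fun_rVP n (f : T' -> 'rV[T]_n) :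
  (forall i, measurable_fun [set: T'] (fun x => f x ord0 i)) ->
  measurable_fun [set: T'] f.
Proof.
move=> mf _ Y mY; rewrite setTI.
pose S := [set B : set 'rV[T]_n | measurable (f @^-1` B)].
suff : S Y by [].
apply: mY; split; last first.
  move=> B; rewrite -bigcup_seq => -[i _ [C mC <-]].
  by rewrite /S/= setTI; have := mf i measurableT C mC; rewrite setTI.
split.
- by rewrite /S/= preimage_set0; exact: measurable0.
- by move=> B SB; rewrite /S/= setTD preimage_setC; exact: measurableC.
- by move=> F SF; rewrite /S/= preimage_bigcup; exact: bigcupT_measurable.
Qed.

End measurable_rV_lemmas.

Lemma product_measure1_sigma_finite d1 d2 (T1 : measurableType d1)
    (T2 : measurableType d2) (R : realType)
    (m1 : {sigma_finite_measure set T1 -> \bar R})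
    (m2 : {sigma_finite_measure set T2 -> \bar R}) :
  sigma_finite setT (m1 \x m2)%E.
Proof.
have /sigma_finiteP[F [TF ndF Foo]] := sigma_finiteT m1.
have /sigma_finiteP[G [TG ndG Goo]] := sigma_finiteT m2.
exists (fun n => F n `*` G n).
  rewrite -setXTT TF TG predeqE => -[x y]; split.
    move=> [/= [n _ Fnx] [k _ Gky]]; exists (maxn n k) => //; split.
    - by move: x Fnx; exact/subsetPset/ndF/leq_maxl.
    - by move: y Gky; exact/subsetPset/ndG/leq_maxr.
  by move=> [n _ []/= ? ?]; split; exists n.
move=> k; have [? ?] := Foo k; have [? ?] := Goo k.
split; first exact: measurableX.
by rewrite product_measure1E// lte_mul_pinfty// ge0_fin_numE.
Qed.

Section lebesgue_rV.
Context {R : realType}.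
Local Notation mR := (measurableTypeR R).

Definition rV_cons n (p : mR * 'rV[mR]_n) : 'rV[mR]_n.+1 :=
  \row_i oapp (fun j => p.2 ord0 j) p.1 (unlift ord0 i).

Definition rV_uncons n (v : 'rV[mR]_n.+1) : mR * 'rV[mR]_n :=
  (v ord0 ord0, \row_i v ord0 (lift ord0 i)).

Lemma rV_consK n : cancel (@rV_cons n) (@rV_uncons n).
Proof.
move=> [x v]; rewrite /rV_uncons mxE unlift_none; congr pair.
by apply/rowP => i; rewrite !mxE liftK.
Qed.

Lemma measurable_rV_cons n : measurable_fun setT (@rV_cons n).
Proof.
apply: measurable_fun_rVP => i.
under eq_fun do rewrite mxE.
case: unliftP => [j _|_] /=; last exact: measurable_fst.
exact: (measurableT_comp (measurable_rV_coord j) measurable_snd).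
Qed.

Lemma measurable_rV_uncons n : measurable_fun setT (@rV_uncons n).
Proof.
apply: measurable_fun_pair; first exact: measurable_rV_coord.
apply: measurable_fun_rVP => i; under eq_fun do rewrite mxE.
exact: measurable_rV_coord.
Qed.

Section cons_measure.
Context n (m : {sigma_finite_measure set 'rV[mR]_n -> \bar R}).
Local Open Scope ereal_scope.

Definition cons_measure : set 'rV[mR]_n.+1 -> \bar R :=
  pushforward (lebesgue_measure \x m) (@rV_cons n).

HB.instance Definition _ := Measure.copy cons_measure
  (measure_function_pushforward__canonical__measure_function_Measure
    (lebesgue_measure \x m) (@measurable_rV_cons n)).

Let cons_measure_sigma_finite : sigma_finite setT cons_measure.
Proof.
have [F FT Foo] := product_measure1_sigma_finite lebesgue_measure m.
exists (fun k => @rV_uncons n @^-1` F k).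
  by rewrite -preimage_bigcup -FT preimage_setT.
move=> k; have [mF Fk] := Foo k; split.
  by rewrite -[X in measurable X]setTI; exact: measurable_rV_uncons.
rewrite /cons_measure /pushforward -comp_preimage.
by rewrite (_ : _ \o _ = id) ?preimage_id//; apply/funext => p; exact: rV_consK.
Qed.

HB.instance Definition _ := Measure_isSigmaFinite.Build _ _ _ cons_measure
  cons_measure_sigma_finite.

End cons_measure.

Fixpoint lebesgue_rV n : {sigma_finite_measure set 'rV[mR]_n -> \bar R} :=
  if n is k.+1 then cons_measure (lebesgue_rV k)
  else @dirac _ 'rV[mR]_0 (0 : 'rV[R]_0) R.

Lemma lebesgue_rV_box n (A : 'I_n -> set R) :
  (forall i, measurable (A i)) ->
  lebesgue_rV n [set v | forall i, A i (v ord0 i)] =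
  (\prod_(i < n) lebesgue_measure (A i))%E.
Proof.
elim: n A => [|n IH] A mA.
  by rewrite big_ord0 /= diracE mem_set//= => -[].
have mB : measurable [set v : 'rV[mR]_n | forall i, A (lift ord0 i) (v ord0 i)].
  rewrite (_ : mkset _ = \bigcap_(i in [set: 'I_n])
    ((fun v : 'rV[mR]_n => v ord0 i) @^-1` A (lift ord0 i))).
    apply: fin_bigcap_measurable; first exact: finite_finset.
    move=> i _.
    rewrite -[X in measurable X]setTI.
    exact: (measurable_rV_coord i measurableT (mA _)).
  by apply/seteqP; split => v /= Av i; [move=> _|]; exact: Av.
have mA0 : measurable (A ord0 : set mR) := mA ord0.
rewrite big_ord_recl /= -IH// -product_measure1E//.
rewrite /cons_measure /pushforward; congr ((_ \x _)%E _).
apply/seteqP; split => -[x v] /=.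
  move=> h; split.
    by have := h ord0; rewrite mxE unlift_none.
  by move=> i; have := h (lift ord0 i); rewrite mxE liftK.
move=> [h0 h] i; rewrite mxE; case: unliftP => [j ->|->] //=.
Qed.

End lebesgue_rV.

Section spacetime_measure.
Context {R : realType} (N : nat).
Local Notation mR := (measurableTypeR R).

Definition lebesgue_z : set ('rV[mR]_N * mR) -> \bar R :=
  (lebesgue_rV N \x lebesgue_measure)%E.

HB.instance Definition _ := Measure.on lebesgue_z.
HB.instance Definition _ := Measure_isSigmaFinite.Build _ _ _ lebesgue_z
  (product_measure1_sigma_finite _ _).

Definition lebesgue_zt : set ('rV[mR]_N * mR * mR) -> \bar R :=
  (lebesgue_z \x lebesgue_measure)%E.

HB.instance Definition _ := Measure.on lebesgue_zt.
HB.instance Definition _ := Measure_isSigmaFinite.Build _ _ _ lebesgue_zt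
  (product_measure1_sigma_finite _ _).

End spacetime_measure.
Arguments lebesgue_z {R} N _.
Arguments lebesgue_zt {R} N _.

(* A point z = (x, y) has type ['rV[R]_N * R] and (z, t) has type
   ['rV[R]_N * R * R]. The library norm on these types is the sup norm, hence
   the explicit Euclidean products below. *)
Section weighted_heat_equation.
Context {R : realType} {N : nat}.
Local Notation Z := ('rV[R]_N * R)%type.
Local Notation ZT := ('rV[R]_N * R * R)%type.
Local Notation mR := (measurableTypeR R).
Local Notation mZT := ('rV[mR]_N * mR * mR)%type.

Definition dotx (v w : 'rV[R]_N) : R := \sum_(i < N) v ord0 i * w ord0 i.
Definition dotz (v w : Z) : R := dotx v.1 w.1 + v.2 * w.2.
Definition sqnormz (z : Z) : R := dotz z z.

Definition rho (eps a y : R) : R := (eps ^+ 2 + y ^+ 2) `^ (a / 2).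

Definition ball_z (r : R) : set Z := [set z | sqnormz z < r ^+ 2].
Definition ball_z_plus (r : R) : set Z := ball_z r `&` [set z | 0 < z.2].
Definition Itime (r : R) : set R := `] - r ^+ 2, r ^+ 2 [.
Definition Q (r : R) : set ZT := ball_z r `*` Itime r.
Definition Qplus (r : R) : set ZT := ball_z_plus r `*` Itime r.

Definition gradz (f : ZT -> R) (p : ZT) : Z :=
  (\row_(i < N) 'D_((delta_mx 0 i, 0), 0) f p, 'D_((0, 1), 0) f p).
Definition dt (f : ZT -> R) (p : ZT) : R := 'D_((0, 0), 1) f p.

Definition iter_derive (s : seq ZT) (f : ZT -> R) : ZT -> R :=
  foldr (fun v g p => 'D_v g p) f s.

(* C^oo: every iterated directional derivative is Frechet differentiable. *)
Definition smooth (f : ZT -> R) : Prop :=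
  forall (s : seq ZT) (p : ZT), differentiable (iter_derive s f) p.

Definition test_function (r : R) (phi : ZT -> R) : Prop :=
  let supp := closure [set p | phi p != 0] in
  [/\ smooth phi, compact supp & supp `<=` Q r].

Definition normL2H1 (eps a r : R) (u : ZT -> R) (V : ZT -> Z) : \bar R :=
  ((\int[lebesgue_zt N]_(p in Qplus r)
    (rho eps a p.1.2 * (u p ^+ 2 + sqnormz (V p)))%:E) `^ 2^-1)%E.

(* u is in the completion of C^oo(closure (Q_r^+)), with gradient V: (u, V) is
   the limit of (phi_k, gradz phi_k) in weighted L^2. Functions in
   C^oo(closure (Q_r^+)) are the restrictions of smooth functions on the whole
   space. V is determined by u almost everywhere in Q_r^+, because
   the weight is locally bounded above and away from zero in {y > 0}.
   Classes modulo null sets are represented by Borel measurable functions. *)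
Definition L2H1 (eps a r : R) (u : ZT -> R) (V : ZT -> Z) : Prop :=
  [/\ measurable_fun (Qplus r : set mZT) u,
      measurable_fun (Qplus r : set mZT) V &
      exists phi : nat -> ZT -> R,
        (forall k, smooth (phi k)) /\
        normL2H1 eps a r (fun p => phi k p - u p)
          (fun p => gradz (phi k) p - V p) @[k --> \oo] --> 0%E].

(* Extending by 0 outside I_r leaves the essential supremum over I_r unchanged,
   the function being nonnegative. *)
Definition normLinfL2 (eps a r : R) (u : ZT -> R) : \bar R :=
  ess_sup (@lebesgue_measure R)
    ((fun t => ((\int[lebesgue_z N]_(z in ball_z_plus r)
       (rho eps a z.2 * u (z, t) ^+ 2)%:E) `^ 2^-1)%E) \_ (Itime r)).

Definition LinfL2 (eps a r : R) (u : ZT -> R) : Prop :=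
  measurable_fun (Qplus r : set mZT) u /\ (normLinfL2 eps a r u < +oo)%E.

Definition weak_formulation (eps a r : R) (u : ZT -> R) (V : ZT -> Z) : Prop :=
  forall phi, test_function r phi ->
  (- (\int[lebesgue_zt N]_(p in Qplus r)
        (rho eps a p.1.2 * u p * dt phi p)%:E)
   + (\int[lebesgue_zt N]_(p in Qplus r)
        (rho eps a p.1.2 * dotz (V p) (gradz phi p))%:E) = 0)%E.

Definition entire_solution (eps a : R) (u : ZT -> R) : Prop :=
  forall r, 0 < r -> exists V : ZT -> Z,
    [/\ L2H1 eps a r u V, LinfL2 eps a r u & weak_formulation eps a r u V].

End weighted_heat_equation.

(* Main.v *)
(* Translations by tangential vectors h (in x and t) preserve the weighted
   equation. A Caccioppoli estimate, tested with cut-offs on parabolic cylinders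
   of size r, shows that a tangential difference of a solution has an L^2 energy
   smaller by a factor O(r^-2) than the solution itself on a cylinder of
   comparable size. As the energy grows polynomially, the differences of high
   order vanish; the sequences n |-> u(p + n h) are therefore polynomials, and
   the growth bound with gamma < 2 leaves the degree 0 in t and at most 1 in x
   (0 if gamma < 1). A solution invariant under all tangential translations is
   constant: its weak formulation reduces to the normal term, and shifting a test
   function across the boundary {y = 0} gives d_y u = 0. Applied to the
   differences of u this makes h |-> u(. + h) - u an additive map that is bounded
   on bounded sets, i.e. b . h, and u - b . x is again a solution invariant under
   tangential translations. *)
From HB Require Import structures.
Require Import Defs.
From mathcomp Require Import all_boot all_order all_algebra.
From mathcomp Require Import all_classical all_reals all_analysis.
From mathcomp Require Import measurable_realfun.
From mathcomp Require Import ring lra.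
Set Implicit Arguments.
Unset Strict Implicit.
Unset Printing Implicit Defensive.
Import Order.TTheory GRing.Theory Num.Theory.
Import numFieldNormedType.Exports.
Local Open Scope classical_set_scope.
Local Open Scope ring_scope.

(** The obstacle is that [u] has no time derivative in L^2 and cannot be tested against itself. Test
    functions are built from smooth approximants of [u], and time derivatives are replaced by finite
    differences: the mean value theorem in the shift parameter gives an exact identity at one
    intermediate shift, where Steklov averages would usually stand. In the energy estimate the
    difference is symmetric, from t - tau to t + tau, so that every term in [u] cancels except those
    carrying a difference of the cut-off. The approximant is chosen after tau, since its error is
    divided by tau. The weight is set to 0 for y <= 0: all integrals run over the whole space, and
    tangential translations act on them without boundary terms. Test functions need not vanish at y
    = 0, which encodes the Neumann condition and is what allows a shift across the boundary. A
    normal shift does not preserve the weight; it is studied with unweighted norms on slabs away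
    from y = 0. Each identity holds outside a null set depending on the shift, so the passage to
    constancy needs Fubini. *)

Lemma eq_ler d (T : porderType d) (x y : T) : x = y -> (x <= y)%O.
Proof. by move=> ->. Qed.

(** * Smooth functions *)

Section smooth_functions.
Context {R : realType} {N : nat}.
Local Notation ZT := ('rV[R]_N * R * R)%type.
Implicit Types (f g : ZT -> R) (p v h : ZT).

Lemma smooth_differentiable f p : smooth f -> differentiable f p.
Proof. by move/(_ [::] p). Qed.

Lemma smooth_derivable f p v : smooth f -> derivable f p v.
Proof. by move=> sf; apply: diff_derivable; exact: smooth_differentiable. Qed.

Lemma smooth_continuous f : smooth f -> continuous f.
Proof. by move=> sf p; exact/differentiable_continuous/smooth_differentiable. Qed.

Lemma smooth_derive f v : smooth f -> smooth (fun p => 'D_v f p).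
Proof.
move=> sf s; have := sf (rcons s v).
by rewrite /iter_derive -cats1 foldr_cat.
Qed.

(** A coinduction principle: a class of differentiable functions stable under directional
    derivatives contains all iterated derivatives of its members. *)
Lemma smooth_class (C : (ZT -> R) -> Prop) :
  (forall f, C f -> (forall p, differentiable f p) /\
     forall v, C (fun p => 'D_v f p)) ->
  forall f, C f -> smooth f.
Proof.
move=> HC f Cf s.
suff : C (iter_derive s f) by move=> /HC[].
by elim: s => //= v s /HC[_]; exact.
Qed.

(** The derivative of a product or of a composite involves the other operations, so sums, products
    and composites are closed up together. The outer function of a composite is given as a sequence
    [e] of functions of one variable, each the derivative of the preceding one, which encodes its
    smoothness. *)
Inductive smooth_closure : (ZT -> R) -> Prop :=
| sc_smooth f : smooth f -> smooth_closure f
| sc_add f g : smooth_closure f -> smooth_closure g ->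
    smooth_closure (fun p => f p + g p)
| sc_mul f g : smooth_closure f -> smooth_closure g ->
    smooth_closure (fun p => f p * g p)
| sc_comp (e : nat -> R -> R) n f :
    (forall k (s : R), is_derive s 1 (e k) (e k.+1 s)) -> smooth_closure f ->
    smooth_closure (fun p => e n (f p)).

Lemma derive_comp1 (e e' : R -> R) f p v : differentiable f p ->
  is_derive (f p : R) 1 e (e' (f p)) ->
  differentiable (fun p => e (f p)) p /\
  'D_v (fun p => e (f p)) p = e' (f p) * 'D_v f p.
Proof.
move=> df [de dE].
have de' : differentiable e (f p) by apply/derivable1_diffP.
have dc : differentiable (e \o f) p by exact: differentiable_comp.
split=> //; rewrite (_ : (fun _ => _) = e \o f)// deriveE//.
rewrite diff_comp//= (deriveE v df).
by rewrite deriv1E// derive1E dE /= /GRing.scale/= mulrC.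
Qed.

Lemma smooth_closureP f : smooth_closure f ->
  (forall p, differentiable f p) /\
  forall v, smooth_closure (fun p => 'D_v f p).
Proof.
elim => {f} [f sf|f g cf [df IHf] cg [dg IHg]|f g cf [df IHf] cg [dg IHg]
  |e n f eD cf [df IHf]].
- split=> [p|v]; first exact: smooth_differentiable.
  by apply: sc_smooth; exact: smooth_derive.
- split=> [p|v]; first exact: differentiableD.
  rewrite (_ : (fun p => _) = fun p => 'D_v f p + 'D_v g p).
    exact: sc_add.
  by apply/funext => p; rewrite deriveD//; exact: diff_derivable.
- split=> [p|v]; first exact: differentiableM.
  rewrite (_ : (fun p => _) = fun p => f p * 'D_v g p + g p * 'D_v f p).
    by apply: sc_add; apply: sc_mul.
  by apply/funext => p; rewrite deriveM//; exact: diff_derivable.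
- split=> [p|v]; first by have [] := derive_comp1 0 (df p) (eD n (f p)).
  rewrite (_ : (fun p => _) = fun p => e n.+1 (f p) * 'D_v f p).
    by apply: sc_mul => //; apply: sc_comp.
  by apply/funext => p; have [_ ->] := derive_comp1 v (df p) (eD n (f p)).
Qed.

Lemma smooth_closure_smooth f : smooth_closure f -> smooth f.
Proof. by apply: smooth_class; exact: smooth_closureP. Qed.

Lemma smoothD f g : smooth f -> smooth g -> smooth (fun p => f p + g p).
Proof.
by move=> sf sg; apply/smooth_closure_smooth/sc_add; exact: sc_smooth.
Qed.

Lemma smoothM f g : smooth f -> smooth g -> smooth (fun p => f p * g p).
Proof.
by move=> sf sg; apply/smooth_closure_smooth/sc_mul; exact: sc_smooth.
Qed.

Lemma smooth_comp (e : nat -> R -> R) n f :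
  (forall k (s : R), is_derive s 1 (e k) (e k.+1 s)) ->
  smooth f -> smooth (fun p => e n (f p)).
Proof.
by move=> eD sf; apply/smooth_closure_smooth/sc_comp => //; exact: sc_smooth.
Qed.

Lemma smooth_cst (c : R) : smooth (fun _ : ZT => c).
Proof.
apply: (@smooth_class (fun f => exists c, f = fun=> c)); last by exists c.
move=> _ [k ->]; split=> [p|v]; first exact: differentiable_cst.
by exists 0; apply/funext => p; exact: derive_cst.
Qed.

Lemma smoothZ (c : R) f : smooth f -> smooth (fun p => c * f p).
Proof. by apply: smoothM; exact: smooth_cst. Qed.

Lemma smoothB f g : smooth f -> smooth g -> smooth (fun p => f p - g p).
Proof.
move=> sf sg; rewrite (_ : (fun p => _) = fun p => f p + -1 * g p).
  by apply: smoothD => //; exact: smoothZ.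
by apply/funext => p; rewrite mulN1r.
Qed.

Lemma smooth_sum (I : Type) (r : seq I) (F : I -> ZT -> R) :
  (forall i, smooth (F i)) -> smooth (fun p => \sum_(i <- r) F i p).
Proof.
move=> sF; elim: r => [|i r IH].
  under eq_fun do rewrite big_nil; exact: smooth_cst.
by under eq_fun do rewrite big_cons; exact: smoothD.
Qed.

Lemma derive_shiftp f h p v :
  'D_v (fun q => f (q + h)) p = 'D_v f (p + h).
Proof. by rewrite /derive /=; under eq_fun do rewrite -addrA. Qed.

Lemma smooth_shift f h : smooth f -> smooth (fun p => f (p + h)).
Proof.
move=> sf; apply: (@smooth_class
  (fun g => exists2 f, smooth f & g = fun p => f (p + h))); last by exists f.
move=> _ [g sg ->]; split=> [p|v].
  apply: (@differentiable_comp _ _ _ _ (+%R^~ h) g).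
    by apply: differentiableD => //; exact: differentiable_cst.
  exact: smooth_differentiable.
exists (fun p => 'D_v g p); first exact: smooth_derive.
by apply/funext => p; exact: derive_shiftp.
Qed.

Lemma derive_additive f p v :
  (forall t p, f (t *: v + p) = t * f v + f p) -> 'D_v f p = f v.
Proof.
move=> fE; rewrite /derive; apply/cvg_lim => //.
apply: (@cvg_trans _ ((fun=> f v) @ (0:R)^')); last exact: cvg_cst.
apply: near_eq_cvg; near=> h.
rewrite /= fE addrK /GRing.scale/= mulrA mulVf ?mul1r//.
by near: h; exact: nbhs_dnbhs_neq.
Unshelve. all: by end_near. Qed.

Lemma smooth_additive f : (forall p, differentiable f p) ->
  (forall t v p, f (t *: v + p) = t * f v + f p) -> smooth f.
Proof.
move=> df fE; apply: (@smooth_class (fun g => g = f \/ exists c, g = fun=> c));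
  last by left.
move=> _ [->|[c ->]].
  split=> // v; right; exists (f v); apply/funext => p; apply: derive_additive => t q.
  exact: fE.
split=> [p|v]; first exact: differentiable_cst.
by right; exists 0; apply/funext => p; exact: derive_cst.
Qed.

Lemma differentiable_fst (U V : normedModType R) (p : U * V) :
  differentiable (fst : U * V -> U) p.
Proof. by apply: linear_differentiable; move=> q; exact: cvg_fst. Qed.

Lemma differentiable_snd (U V : normedModType R) (p : U * V) :
  differentiable (snd : U * V -> V) p.
Proof. by apply: linear_differentiable; move=> q; exact: cvg_snd. Qed.

Lemma smooth_t : smooth (fun p : ZT => p.2).
Proof. by apply: smooth_additive => // p; exact: differentiable_snd. Qed.

Lemma smooth_y : smooth (fun p : ZT => p.1.2).
Proof.
apply: smooth_additive => // p.
apply: (@differentiable_comp _ _ _ _ fst snd); first exact: differentiable_fst.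
exact: differentiable_snd.
Qed.

Lemma smooth_x (i : 'I_N) : smooth (fun p : ZT => p.1.1 ord0 i).
Proof.
apply: smooth_additive => [p|t v p]; last by rewrite /= !mxE.
apply: (@differentiable_comp _ _ _ _ (fun p : ZT => p.1.1) (fun M => M ord0 i)).
  apply: (@differentiable_comp _ _ _ _ fst fst); exact: differentiable_fst.
exact: differentiable_coord.
Qed.

Lemma derive_fun_shift f p h s : smooth f ->
  is_derive (s : R) 1 (fun s => f (p + s *: h)) ('D_h f (p + s *: h)).
Proof.
move=> sf.
have E : (fun t : R => t^-1 *: (f (p + (t *: (1 : R) + s) *: h) - f (p + s *: h)))
    = (fun t => t^-1 *: (f (t *: h + (p + s *: h)) - f (p + s *: h))).
  apply/funext => t; congr (_ *: (f _ - _)).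
  have -> : t *: (1 : R) = t by rewrite /GRing.scale/= mulr1.
  by rewrite scalerDl addrCA.
split; first by rewrite /derivable /= E; exact: smooth_derivable.
by rewrite /derive /= E.
Qed.

End smooth_functions.

(** * A flat function and its derivatives *)

Section flat_function.
Context {R : realType}.
Implicit Types (P : {poly R}) (s u : R).

Lemma expRN_poly_bounded P :
  exists2 C, 0 <= C & forall u, 0 <= u -> `|P.[u]| * expR (- u) <= C.
Proof.
(* The factor [u ^+ k] makes the induction on [P] close: in the step from [P] to [P * 'X + c] the
   factor ['X] is traded for one more power of [u]. *)
suff : forall k, exists2 C, 0 <= C &
    forall u, 0 <= u -> `|P.[u]| * u ^+ k * expR (- u) <= C.
  by move=> /(_ 0%N)[C C0 H]; exists C => // u u0; have := H u u0;
    rewrite expr0 mulr1.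
elim/poly_ind: P => [|P c IH] k.
  by exists 0 => // u _; rewrite horner0 normr0 !mul0r.
have [C C0 HC] := IH k.+1.
(* The constant term is controlled by u^k <= (k + 1)! exp u, read off the exponential series. *)
exists (C + `|c| * k.+1`!%:R).
  by rewrite addr_ge0// mulr_ge0.
move=> u u0; rewrite hornerMXaddC.
have eu : 0 <= expR (- u) by exact: expR_ge0.
have uk : 0 <= u ^+ k by exact: exprn_ge0.
apply: (@le_trans _ _ (`|P.[u]| * u ^+ k.+1 * expR (- u) +
    `|c| * (u ^+ k * expR (- u)))).
  rewrite (_ : _ + _ = (`|P.[u]| * u + `|c|) * u ^+ k * expR (- u)).
    rewrite !ler_wpM2r//.
    by rewrite (le_trans (ler_normD _ _))// normrM (ger0_norm u0).
  by rewrite exprS; ring.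
apply: lerD; first exact: HC.
apply: ler_wpM2l => //.
rewrite expRN ler_pdivrMr ?expR_gt0//.
case: k {HC uk} => [|k].
  rewrite expr0 mul1r; apply: le_trans (expR_ge1Dx u).
  by rewrite lerDl.
have := expR_ge1Dxn k u0.
have f0 : (0 : R) < k.+1`!%:R by rewrite ltr0n fact_gt0.
move=> H.
have {}H : u ^+ k.+1 / k.+1`!%:R <= expR u by apply: le_trans H; rewrite lerDr.
rewrite ler_pdivrMr// in H; rewrite mulrC.
apply: (le_trans H); rewrite ler_wpM2l ?expR_ge0// ler_nat.
by rewrite [leqRHS]factS leq_pmull.
Qed.

Definition poly_flat P s : R := if 0 < s then P.[s^-1] * expR (- s^-1) else 0.

Lemma poly_flat_derive P s :
  is_derive (s : R) 1 (poly_flat P) (poly_flat ((P - P^`()) * 'X^2) s).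
Proof.
have [s0|s0|->] := ltgtP s 0.
- rewrite [X in is_derive _ _ _ X]/poly_flat ltNge (ltW s0)/=.
  apply: (@near_eq_is_derive _ _ _ (cst 0)) => //.
  near=> t; rewrite /poly_flat ltNge.
  have -> // : t <= 0.
  by apply/ltW; near: t; exact: lt_nbhsl.
- have nE : \near s, P.[s^-1] * expR (- s^-1) = poly_flat P s.
    near=> t; rewrite /poly_flat.
    by have -> // : 0 < t by near: t; exact: lt_nbhsr.
  apply: near_eq_is_derive nE _.
  have s1 : s != 0 by rewrite gt_eqF.
    have dV : is_derive s 1 (fun t => t^-1) (- s ^- 2).
      have := @is_deriveV R id s 1 1 s1 (is_derive_id _ _).
      by rewrite /GRing.scale/= mulr1.
    have dP := is_derive1_comp (is_derive_poly P s^-1) dV.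
    have dN : is_derive s 1 (fun t => - t^-1) (- - s ^- 2) by exact: is_deriveN.
    have dE := @is_derive1_comp R expR (fun t => - t^-1) s _ _ (is_derive_expR (- s^-1)) dN.
    have [d1 d2] := is_deriveM dP dE.
    split; first exact: d1.
    apply: etrans d2 _.
    rewrite /poly_flat s0 /GRing.scale/= !hornerE /=; field.
    by rewrite s1.
- rewrite [X in is_derive _ _ _ X]/poly_flat ltxx.
  (* For h > 0 the difference quotient at 0 is h times the value of [P * 'X^2] at 1/h times exp
     (-1/h), hence at most C h in absolute value. *)
  have [C C0 HC] := expRN_poly_bounded (P * 'X^2).
  have K : (fun h : R => h^-1 *: (poly_flat P (h *: (1 : R) + 0) - poly_flat P 0))
      @ 0^' --> (0 : R).
    apply/cvgr0Pnorm_le => e e0; near=> h.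
    have hE : h *: (1 : R) + 0 = h by rewrite addr0 /GRing.scale/= mulr1.
    rewrite hE /poly_flat ltxx subr0 /GRing.scale/=.
    case: ifPn => h0; last by rewrite mulr0 normr0 ltW.
    have hi : 0 <= h^-1 by rewrite invr_ge0 ltW.
    have := HC _ hi.
    rewrite hornerM hornerXn normrM (ger0_norm (exprn_ge0 2 hi)) => {}HC.
    rewrite normrM (ger0_norm hi) normrM (ger0_norm (expR_ge0 _)).
    apply: (@le_trans _ _ (h * C)).
      rewrite (_ : h^-1 * _ = h * (`|P.[h^-1]| * h^-1 ^+ 2 * expR (- h^-1))).
        by rewrite ler_wpM2l// ltW.
      by field; rewrite gt_eqF.
    have : `|h| <= e / (C + 1).
      near: h; apply: dnbhs0_le; rewrite divr_gt0//; lra.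
    rewrite ger0_norm ?(ltW h0)// ler_pdivlMr ?ltr_wpDl// => H.
    by apply: le_trans H; rewrite ler_wpM2l ?(ltW h0)// lerDl.
  split; first by apply/cvg_ex; exists 0.
  by apply/cvg_lim.
Unshelve. all: end_near. Qed.
End flat_function.

(** * Cut-off functions *)

Section cutoff.
Context {R : realType} {N : nat}.
Local Notation Z := ('rV[R]_N * R)%type.
Local Notation ZT := ('rV[R]_N * R * R)%type.
Implicit Types (f g : ZT -> R) (p v : ZT) (z w : Z).

(** With these polynomials [bump n] is the n-th derivative of exp (-1/s), extended by 0 to s <= 0;
    the whole sequence is what [smooth_comp] takes as input. *)
Definition bump_poly n : {poly R} := iter n (fun P => (P - P^`()) * 'X^2) 1.
Definition bump n : R -> R := poly_flat (bump_poly n).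

Lemma bump_derive n (s : R) : is_derive s 1 (bump n) (bump n.+1 s).
Proof. exact: poly_flat_derive. Qed.

Lemma bump0E s : bump 0 s = if 0 < s then expR (- s^-1) else 0.
Proof. by rewrite /bump /poly_flat/= hornerC mul1r. Qed.

Lemma bump_ge0 s : 0 <= bump 0 s.
Proof. by rewrite bump0E; case: ifP => // _; exact: expR_ge0. Qed.

Lemma bump_le1 s : bump 0 s <= 1.
Proof.
rewrite bump0E; case: ifPn => // s0.
by rewrite -expR0 ler_expR oppr_le0 invr_ge0 ltW.
Qed.

Lemma bump_eq0 n s : s <= 0 -> bump n s = 0.
Proof. by move=> s0; rewrite /bump /poly_flat ltNge s0. Qed.

Lemma bump2_gt0 : 0 < bump 0 2.
Proof. by rewrite bump0E ltr0n expR_gt0. Qed.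

Lemma bump2_le s : 2 <= s -> bump 0 2 <= bump 0 s.
Proof.
move=> s2; have s0 : 0 < s by lra.
rewrite !bump0E s0 ltr0n ler_expR lerN2 lef_pV2 ?posrE//.
Qed.

Lemma bump1_le2 s : `|bump 1 s| <= 2.
Proof.
rewrite /bump /poly_flat/= -polyC1 derivC subr0 mul1r hornerXn.
case: ifPn => s0; last by rewrite normr0.
have u0 : 0 <= s^-1 by rewrite invr_ge0 ltW.
rewrite ger0_norm ?mulr_ge0 ?expR_ge0 ?exprn_ge0//.
rewrite expRN ler_pdivrMr ?expR_gt0//.
have := expR_ge1Dxn 1 u0; rewrite (_ : 2`! = 2)//; lra.
Qed.

Lemma sqr_norm_le (x y : R) : 0 <= y -> x ^+ 2 <= y ^+ 2 -> `|x| <= y.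
Proof.
by move=> y0 H; rewrite -(@ler_pXn2r _ 2)// ?nnegrE// real_normK ?num_real.
Qed.

Lemma norm_unit_le1 (s : R) : 0 < s < 1 -> `|s| <= 1.
Proof. by case/andP=> s0 s1; rewrite ger0_norm; lra. Qed.

(** The N + 1 coordinates of z are indexed by [option 'I_N], with [None] for y, so that x and y
    enter sums uniformly. *)
Definition comp (i : option 'I_N) z : R := if i is Some j then z.1 ord0 j else z.2.
Definition dir (i : option 'I_N) : ZT :=
  (if i is Some j then (delta_mx 0 j, 0) else (0, 1), 0).
Definition et : ZT := ((0, 0), 1).

Lemma sum_option (F : option 'I_N -> R) :
  \sum_i F i = \sum_(i < N) F (Some i) + F None.
Proof.
rewrite (bigD1 None)//= addrC; congr (_ + _).
rewrite (reindex_omap (op := GRing.add) (Some : 'I_N -> option 'I_N) id)/=; last by case.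
by apply: eq_bigl => i; rewrite eqxx.
Qed.

Lemma dotzE z w : dotz z w = \sum_i comp i z * comp i w.
Proof. by rewrite sum_option. Qed.

Lemma sqnormzE z : sqnormz z = \sum_i comp i z ^+ 2.
Proof. by rewrite /sqnormz dotzE; apply: eq_bigr => i _; rewrite expr2. Qed.

Lemma sqnormz_ge0 z : 0 <= sqnormz z.
Proof. by rewrite sqnormzE; apply: sumr_ge0 => i _; exact: sqr_ge0. Qed.

Lemma comp_sqr_le i z : comp i z ^+ 2 <= sqnormz z.
Proof.
rewrite sqnormzE (bigD1 i)//= lerDl.
by apply: sumr_ge0 => j _; exact: sqr_ge0.
Qed.

Lemma compD i z w : comp i (z + w) = comp i z + comp i w.
Proof. by case: i => //= i; rewrite mxE. Qed.

Lemma compN i z : comp i (- z) = - comp i z.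
Proof. by case: i => //= i; rewrite mxE. Qed.

Lemma comp_dir i j : comp i (dir j).1 = (i == j)%:R.
Proof.
by case: i j => [i|] [j|] //=; rewrite ?mxE ?eqxx //=.
Qed.

Lemma sqnormzD_le z w : sqnormz (z + w) <= 2 * sqnormz z + 2 * sqnormz w.
Proof.
rewrite !sqnormzE !mulr_sumr -big_split/=; apply: ler_sum => i _.
rewrite compD; have := sqr_ge0 (comp i z - comp i w); lra.
Qed.

Lemma sqnormzN z : sqnormz (- z) = sqnormz z.
Proof. by rewrite !sqnormzE; apply: eq_bigr => i _; rewrite compN sqrrN. Qed.

Lemma sqnormzZ c z : sqnormz (c *: z) = c ^+ 2 * sqnormz z.
Proof.
rewrite !sqnormzE mulr_sumr; apply: eq_bigr => i _.
by rewrite -exprMn; congr (_ ^+ 2); case: i => [i|]//=; rewrite !mxE.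
Qed.

Lemma comp_gradz i f p : comp i (gradz f p) = 'D_(dir i) f p.
Proof. by case: i => //= i; rewrite mxE. Qed.

Lemma smooth_comp_coord i : smooth (fun p : ZT => comp i p.1).
Proof. by case: i => [i|] /=; [exact: smooth_x|exact: smooth_y]. Qed.

Lemma derive_comp_coord i p v : 'D_v (fun p : ZT => comp i p.1) p = comp i v.1.
Proof. by apply: derive_additive => t q; case: i => [i|]//=; rewrite !mxE. Qed.

Lemma smooth_sqr f : smooth f -> smooth (fun p => f p ^+ 2).
Proof. by move=> sf; under eq_fun do rewrite expr2; exact: smoothM. Qed.

Lemma smooth_sqnormz : smooth (fun p : ZT => sqnormz p.1).
Proof.
under eq_fun do rewrite sqnormzE.
by apply: smooth_sum => i; apply/smooth_sqr/smooth_comp_coord.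
Qed.

Lemma derive_smoothD f g p v : smooth f -> smooth g ->
  'D_v (fun p => f p + g p) p = 'D_v f p + 'D_v g p.
Proof. by move=> sf sg; rewrite deriveD//; exact: smooth_derivable. Qed.

Lemma derive_smoothM f g p v : smooth f -> smooth g ->
  'D_v (fun p => f p * g p) p = f p * 'D_v g p + g p * 'D_v f p.
Proof. by move=> sf sg; rewrite deriveM//; exact: smooth_derivable. Qed.

Lemma derive_smoothZ (c : R) f p v : smooth f ->
  'D_v (fun p => c * f p) p = c * 'D_v f p.
Proof.
move=> sf; rewrite derive_smoothM//; last exact: smooth_cst.
by rewrite [X in _ + _ * X]derive_cst mulr0 addr0.
Qed.

Lemma derive_smoothB f g p v : smooth f -> smooth g ->
  'D_v (fun p => f p - g p) p = 'D_v f p - 'D_v g p.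
Proof. by move=> sf sg; rewrite deriveB//; exact: smooth_derivable. Qed.

Lemma derive_smooth_sqr f p v : smooth f ->
  'D_v (fun p => f p ^+ 2) p = 2 * f p * 'D_v f p.
Proof.
move=> sf; under eq_fun do rewrite expr2.
by rewrite derive_smoothM//; ring.
Qed.

Lemma derive_smooth_sum (I : Type) (r : seq I) (F : I -> ZT -> R) p v :
  (forall i, smooth (F i)) ->
  'D_v (fun p => \sum_(i <- r) F i p) p = \sum_(i <- r) 'D_v (F i) p.
Proof.
move=> sF; elim: r => [|i r IH].
  by under eq_fun do rewrite big_nil; rewrite big_nil; exact: derive_cst.
under eq_fun do rewrite big_cons; rewrite big_cons derive_smoothD// ?IH//.
exact: smooth_sum.
Qed.

Lemma derive_sqnormz p v :
  'D_v (fun p : ZT => sqnormz p.1) p = 2 * dotz p.1 v.1.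
Proof.
under eq_fun do rewrite sqnormzE.
rewrite derive_smooth_sum; last by move=> i; apply/smooth_sqr/smooth_comp_coord.
rewrite dotzE mulr_sumr; apply: eq_bigr => i _.
rewrite derive_smooth_sqr ?derive_comp_coord ?mulrA//; exact: smooth_comp_coord.
Qed.

Lemma derive_t p v : 'D_v (fun p : ZT => p.2) p = v.2.
Proof. exact: derive_additive. Qed.

(** A parabolically homogeneous gauge: it is below 2 on [Q r], and at most 4 only where |z| <= 2 r
    and |t| <= 2 r^2. The cut-off is therefore supported in the latter region. On [Q r] it is not
    equal to 1 but bounded below by [bump 0 2], the source of the factors [b ^- 2] in the later
    estimates. *)
Definition gauge (r : R) p : R := r ^- 2 * sqnormz p.1 + r ^- 4 * p.2 ^+ 2.
Definition cutoff (r : R) p : R := bump 0 (4 - gauge r p).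

Lemma smooth_gauge r : smooth (gauge r).
Proof.
apply: smoothD; first by apply/smoothZ/smooth_sqnormz.
by apply/smoothZ/smooth_sqr/smooth_t.
Qed.

Lemma smooth_cutoff r : smooth (cutoff r).
Proof.
apply: (smooth_comp 0 bump_derive).
by apply: smoothB; [exact: smooth_cst|exact: smooth_gauge].
Qed.

Lemma derive_cutoff r p v : 'D_v (cutoff r) p =
  - bump 1 (4 - gauge r p) * (r ^- 2 * (2 * dotz p.1 v.1) + r ^- 4 * (2 * p.2 * v.2)).
Proof.
have sg : smooth (fun p => 4 - gauge r p).
  by apply: smoothB; [exact: smooth_cst|exact: smooth_gauge].
have [_ ->] := derive_comp1 v (smooth_differentiable p sg) (bump_derive 0 _).
rewrite derive_smoothB; [|exact: smooth_cst|exact: smooth_gauge].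
rewrite derive_cst sub0r derive_smoothD; last 2 first.
  by apply/smoothZ/smooth_sqnormz.
  by apply/smoothZ/smooth_sqr/smooth_t.
rewrite !derive_smoothZ; [|by apply/smooth_sqr/smooth_t|exact: smooth_sqnormz].
rewrite derive_smooth_sqr; last exact: smooth_t.
by rewrite derive_t derive_sqnormz mulrN mulNr.
Qed.

Lemma cutoff_ge0 r p : 0 <= cutoff r p. Proof. exact: bump_ge0. Qed.
Lemma cutoff_le1 r p : cutoff r p <= 1. Proof. exact: bump_le1. Qed.

Lemma gauge_le4 r p : 0 < r -> gauge r p <= 4 ->
  sqnormz p.1 <= 4 * r ^+ 2 /\ `|p.2| <= 2 * r ^+ 2.
Proof.
move=> r0; rewrite /gauge => H.
have r2 : 0 < r ^+ 2 by rewrite exprn_gt0.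
have r4 : 0 < r ^+ 4 by rewrite exprn_gt0.
have A0 : 0 <= r ^- 2 * sqnormz p.1 by rewrite mulr_ge0 ?sqnormz_ge0 ?invr_ge0 ?ltW.
have B0 : 0 <= r ^- 4 * p.2 ^+ 2 by rewrite mulr_ge0 ?sqr_ge0 ?invr_ge0 ?ltW.
split.
  have : r ^- 2 * sqnormz p.1 <= 4 by lra.
  by rewrite mulrC ler_pdivrMr.
have : r ^- 4 * p.2 ^+ 2 <= 4 by lra.
rewrite mulrC ler_pdivrMr// => K.
apply: sqr_norm_le; first by rewrite mulr_ge0// ltW.
have -> : (2 * r ^+ 2) ^+ 2 = 4 * r ^+ 4 by ring.
exact: K.
Qed.

Lemma cutoff_supp r p : 0 < r -> cutoff r p != 0 ->
  sqnormz p.1 <= 4 * r ^+ 2 /\ `|p.2| <= 2 * r ^+ 2.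
Proof.
move=> r0 c0; apply: gauge_le4 => //; rewrite leNgt; apply/negP => H.
by move/eqP: c0; apply; apply: bump_eq0; lra.
Qed.

Lemma cutoff_lb r p : 0 < r -> sqnormz p.1 < r ^+ 2 -> `|p.2| < r ^+ 2 ->
  bump 0 2 <= cutoff r p.
Proof.
move=> r0 H1 H2; apply: bump2_le; rewrite /gauge.
have r2 : 0 < r ^+ 2 by rewrite exprn_gt0.
have r4 : 0 < r ^+ 4 by rewrite exprn_gt0.
have : r ^- 2 * sqnormz p.1 <= 1 by rewrite mulrC ler_pdivrMr// mul1r ltW.
have : r ^- 4 * p.2 ^+ 2 <= 1.
  rewrite mulrC ler_pdivrMr// mul1r -[p.2 ^+ 2]ger0_norm ?sqr_ge0// normrX.
  by rewrite (exprM r 2 2) lerXn2r ?nnegrE// ltW.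
lra.
Qed.

Lemma derive_cutoff_dir r p i : 0 < r -> `|'D_(dir i) (cutoff r) p| <= 8 / r.
Proof.
move=> r0; rewrite derive_cutoff.
have [H|H] := leP (gauge r p) 4; last first.
  by rewrite bump_eq0 ?oppr0 ?mul0r ?normr0 ?divr_ge0 ?ltW//; lra.
have [H1 _] := gauge_le4 r0 H.
have -> : dotz p.1 (dir i).1 = comp i p.1.
  rewrite dotzE (bigD1 i)//= comp_dir eqxx mulr1 big1 ?addr0// => j ji.
  by rewrite comp_dir (negbTE ji) mulr0.
rewrite mulr0 mulr0 addr0 normrM normrN.
have c1 : `|comp i p.1| <= 2 * r.
  apply: sqr_norm_le; first by rewrite mulr_ge0// ltW.
  by rewrite exprMn (le_trans (comp_sqr_le _ _))//; lra.
rewrite normrM ger0_norm ?invr_ge0 ?exprn_ge0 ?(ltW r0)// normrM ger0_norm//.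
rewrite (_ : 8 / r = 2 * (r ^- 2 * (2 * (2 * r)))); last by field; rewrite gt_eqF.
apply: ler_pM => //; first by rewrite !mulr_ge0// invr_ge0 exprn_ge0// ltW.
  exact: bump1_le2.
by rewrite ler_wpM2l ?invr_ge0 ?exprn_ge0 ?(ltW r0)// ler_wpM2l.
Qed.

Lemma derive_cutoff_t r p : 0 < r -> `|'D_et (cutoff r) p| <= 8 / r ^+ 2.
Proof.
move=> r0; rewrite derive_cutoff.
have r2 : 0 < r ^+ 2 by rewrite exprn_gt0.
have [H|H] := leP (gauge r p) 4; last first.
  by rewrite bump_eq0 ?oppr0 ?mul0r ?normr0 ?divr_ge0 ?ltW//; lra.
have [_ H1] := gauge_le4 r0 H.
have -> : dotz p.1 et.1 = 0.
  by rewrite dotzE big1// => -[j|] _ /=; rewrite ?mxE mulr0.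
rewrite mulr0 mulr0 add0r mulr1 normrM normrN.
rewrite normrM ger0_norm ?invr_ge0 ?exprn_ge0 ?(ltW r0)// normrM ger0_norm//.
rewrite (_ : 8 / r ^+ 2 = 2 * (r ^- 4 * (2 * (2 * r ^+ 2)))); last first.
  by field; rewrite gt_eqF.
apply: ler_pM => //; first by rewrite !mulr_ge0// invr_ge0 exprn_ge0// ltW.
  exact: bump1_le2.
by rewrite ler_wpM2l ?invr_ge0 ?exprn_ge0 ?(ltW r0)// ler_wpM2l.
Qed.

End cutoff.

(** * Borel sets and translation invariance *)

Section borel.
Context {R : realType} {N : nat}.
Local Notation ZT := ('rV[R]_N * R * R)%type.
Local Notation mR := (measurableTypeR R).
Local Notation mZT := ('rV[mR]_N * mR * mR)%type.

Lemma measurable_comp i : measurable_fun [set: mZT] (fun p : mZT => comp i p.1 : mR).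
Proof.
case: i => [i|] /=.
  apply: (measurableT_comp (measurable_rV_coord i)).
  exact: (measurableT_comp measurable_fst measurable_fst).
exact: (measurableT_comp measurable_snd measurable_fst).
Qed.

Lemma measurable_t : measurable_fun [set: mZT] (fun p : mZT => p.2).
Proof. exact: measurable_snd. Qed.

Lemma measurable_cube (c : ZT) (e : R) : measurable
  ([set p : mZT | (forall i, `|c.1.1 ord0 i - p.1.1 ord0 i| < e) /\
     `|c.1.2 - p.1.2| < e /\ `|c.2 - p.2| < e] : set mZT).
Proof.
have mt (g : mZT -> mR) (b : R) : measurable_fun [set: mZT] g ->
    measurable ([set p | `|b - g p| < e] : set mZT).
  move=> mg; rewrite (_ : mkset _ = g @^-1` `]b - e, b + e[).
    by rewrite -[X in measurable X]setTI; exact: mg.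
  by apply/seteqP; split => p /=; rewrite in_itv/= ltr_norml => /andP[? ?];
    apply/andP; split; lra.
rewrite (_ : mkset _ =
  (\bigcap_(i in [set: 'I_N]) [set p : mZT | `|c.1.1 ord0 i - p.1.1 ord0 i| < e]) `&`
  ([set p : mZT | `|c.1.2 - p.1.2| < e] `&` [set p : mZT | `|c.2 - p.2| < e])).
  apply: measurableI.
    apply: fin_bigcap_measurable; first exact: finite_finset.
    by move=> i _; apply: (mt (fun p => p.1.1 ord0 i)); exact: (measurable_comp (Some i)).
  apply: measurableI; first by apply: (mt (fun p => p.1.2)); exact: (measurable_comp None).
  by apply: (mt (fun p => p.2)); exact: measurable_t.
by apply/seteqP; split => p /= [H1 H2]; split => // i; [move=> _|]; exact: H1.
Qed.

Lemma rat_approx (x e : R) : 0 < e -> exists q : rat, `|ratr q - x| < e.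
Proof.
move=> e0; have [||y [By [q _ qy]]] := @dense_rat R (ball x e).
- by exists x; exact: ballxx.
- exact: ball_open.
by exists q; rewrite distrC qy.
Qed.

(** The measurable structure is generated by the coordinates, while openness refers to the sup-norm
    topology; the two are linked by writing an open set as the countable union of the rational cubes
    inside it. *)
Lemma open_measurable_ZT (O : set ZT) : open O -> measurable (O : set mZT).
Proof.
move=> oO.
pose cube (c : 'rV[rat]_N * rat * rat * nat) : set mZT :=
  [set p : mZT | (forall i, `|ratr (c.1.1.1 ord0 i) - p.1.1 ord0 i| < c.2.+1%:R^-1) /\
     `|ratr c.1.1.2 - p.1.2| < c.2.+1%:R^-1 /\ `|ratr c.1.2 - p.2| < c.2.+1%:R^-1].
(* Cubes are enumerated through [unpickle]; codes of nothing, and of cubes not inside [O],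
   contribute the empty set. *)
pose F n : set mZT := if unpickle n is Some c then
  (if `[< cube c `<=` (O : set mZT) >] then cube c else set0) else set0.
rewrite (_ : (O : set mZT) = \bigcup_n F n).
  apply: bigcupT_measurable => n; rewrite /F; case: unpickle => // c.
  case: ifP => // _.
  have := @measurable_cube (\row_i ratr (c.1.1.1 ord0 i), ratr c.1.1.2, ratr c.1.2)
    c.2.+1%:R^-1.
  congr measurable; apply/seteqP; split => p /= [H1 H2]; split => // i.
    by have := H1 i; rewrite mxE.
  by have := H1 i; rewrite mxE.
apply/seteqP; split => p; last first.
  move=> [n _]; rewrite /F; case: unpickle => // c.
  by case: asboolP => // H; exact: H.
move=> Op; have /nbhs_ballP[e /= e0 He] : nbhs p O by apply: open_nbhs_nbhs.
(* Half the radius of the ball, because [p] and any other point of the cube are compared through the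
   centre of the cube. *)
have [k k2] : exists k : nat, k.+1%:R^-1 < e / 2.
  have e2 : 0 < e / 2 by rewrite divr_gt0.
  exists (Num.truncn (e / 2)^-1).
  by rewrite invf_plt ?posrE// truncnS_gt.
have k0 : 0 < k.+1%:R^-1 :> R by rewrite invr_gt0.
have /choice[qx Hqx] : forall i, exists q : rat, `|ratr q - p.1.1 ord0 i| < k.+1%:R^-1.
  by move=> i; exact: rat_approx.
have [qy Hqy] := rat_approx p.1.2 k0.
have [qt Hqt] := rat_approx p.2 k0.
pose c : 'rV[rat]_N * rat * rat * nat := (\row_i qx i, qy, qt, k).
have cp : cube c p by split => // i; rewrite mxE.
exists (pickle c); first exact: I.
rewrite /F pickleK.
case: asboolP => // -[] q [/= H1 [H2 H3]]; apply: He.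
have T (x y z : R) : `|z - x| < k.+1%:R^-1 -> `|z - y| < k.+1%:R^-1 -> `|x - y| < e.
  move=> h1 h2; rewrite (_ : x - y = (z - y) - (z - x)); last by ring.
  rewrite (le_lt_trans (ler_normB _ _))// [ltRHS]splitr.
  by apply: ltrD; apply: lt_trans k2.
split; [split|] => /=; rewrite /ball/=.
- by split => // i j; rewrite ord1; apply: T; [exact: Hqx|have := H1 j; rewrite mxE].
- exact: (T _ _ _ Hqy).
- exact: (T _ _ _ Hqt).
Qed.

Lemma continuous_measurable (f : ZT -> R) : continuous f ->
  measurable_fun [set: mZT] (f : mZT -> mR).
Proof.
move=> cf; apply: (measurability _ (measurable_realfun.RGenOInfty.measurableE R)) => //.
move=> /= _ [_ [a ->]] <-; rewrite setTI; apply: open_measurable_ZT.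
by apply: open_comp; [move=> p _; exact: cf|exact: interval_open].
Qed.

End borel.

Section translation.
Context {R : realType}.
Local Notation mR := (measurableTypeR R).
Local Open Scope ereal_scope.

Lemma lebesgue_measure_shift (c : R) (A : set mR) : measurable A ->
  lebesgue_measure ((fun x : mR => (x + c)%R : mR) @^-1` A) = lebesgue_measure A.
Proof.
move=> mA.
have mc : measurable_fun [set: mR] (fun x : mR => (x + c)%R : mR).
  by apply: measurable_funD.
pose m := measure_function_pushforward__canonical__measure_function_Measure
  lebesgue_measure mc.
apply/esym/(@lebesgue_measure_unique R m) => // _ [[a b]] _ <- /=.
rewrite /pushforward (_ : _ @^-1` _ = `](a - c)%R, (b - c)%R]%classic).
  rewrite !lebesgue_measure_itv/= !lte_fin ltrD2r -!EFinD.
  by rewrite opprB addrA subrK.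
by apply/seteqP; split => x /=; rewrite !in_itv/= ltrBlDr lerBrDr.
Qed.

(** The pushforward of the product measure agrees with it on rectangles, and a measure is determined
    by these values. Translation invariance in several variables follows from that on the line by
    applying this to one factor after another. *)
Lemma product_measure_preserving d1 d2 (T1 : measurableType d1)
    (T2 : measurableType d2) (m1 : {sigma_finite_measure set T1 -> \bar R})
    (m2 : {sigma_finite_measure set T2 -> \bar R}) (f1 : T1 -> T1) (f2 : T2 -> T2) :
  measurable_fun setT f1 -> measurable_fun setT f2 ->
  (forall A, measurable A -> m1 (f1 @^-1` A) = m1 A) ->
  (forall A, measurable A -> m2 (f2 @^-1` A) = m2 A) ->
  forall A, measurable A ->
  (m1 \x m2) ((fun p => (f1 p.1, f2 p.2)) @^-1` A) = (m1 \x m2) A.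
Proof.
move=> mf1 mf2 H1 H2 A mA.
have mf : measurable_fun setT (fun p : T1 * T2 => (f1 p.1, f2 p.2)).
  by apply: measurable_fun_pair; [exact: (measurableT_comp mf1 measurable_fst)|
    exact: (measurableT_comp mf2 measurable_snd)].
pose m := measure_function_pushforward__canonical__measure_function_Measure
  (m1 \x m2) mf.
apply/esym/(@product_measure_unique _ _ _ _ _ m1 m2 m) => // B C mB mC /=.
rewrite /pushforward.
rewrite (_ : _ @^-1` _ = (f1 @^-1` B) `*` (f2 @^-1` C)); last by [].
have mfB : measurable (f1 @^-1` B) by rewrite -[X in measurable X]setTI; exact: mf1.
have mfC : measurable (f2 @^-1` C) by rewrite -[X in measurable X]setTI; exact: mf2.
rewrite [LHS](product_measure1E m1 m2 mfB mfC).
by congr (_ * _); [exact: H1|exact: H2].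
Qed.

Lemma measurable_shift_rV n (h : 'rV[R]_n) :
  measurable_fun [set: 'rV[mR]_n] (fun x : 'rV[mR]_n => (x + h)%R : 'rV[mR]_n).
Proof.
apply: measurable_fun_rVP => i.
rewrite (_ : (fun _ => _) = fun x : 'rV[mR]_n => (x ord0 i + h ord0 i)%R : mR).
  by apply: measurable_funD => //; exact: measurable_rV_coord.
by apply/funext => x; rewrite mxE.
Qed.

Lemma lebesgue_rV_shift n (h : 'rV[R]_n) (A : set 'rV[mR]_n) : measurable A ->
  lebesgue_rV n ((fun x : 'rV[mR]_n => (x + h)%R : 'rV[mR]_n) @^-1` A) =
  lebesgue_rV n A.
Proof.
elim: n h A => [|n IH] h A mA.
  congr (lebesgue_rV 0 _); apply/seteqP; split => x /=;
  by rewrite (_ : (x + h)%R = x)//; apply/rowP => -[].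
rewrite /= /cons_measure /pushforward.
have mB : measurable (@rV_cons R n @^-1` A).
  by rewrite -[X in measurable X]setTI; exact: measurable_rV_cons.
pose h' : 'rV[R]_n := (\row_i h ord0 (lift ord0 i))%R.
rewrite -(@product_measure_preserving _ _ _ _ lebesgue_measure (lebesgue_rV n)
  (fun x : mR => (x + h ord0 ord0)%R : mR) (fun x : 'rV[mR]_n => (x + h')%R) _ _ _ _ _ mB).
- congr ((_ \x _) _); apply/seteqP; split => -[x v] /=; congr A;
  by apply/rowP => i; rewrite !mxE; case: unliftP => [j ->|->] /=; rewrite ?mxE.
- by apply: measurable_funD.
- exact: measurable_shift_rV.
- by move=> B mB'; exact: lebesgue_measure_shift.
- by move=> B mB'; exact: IH.
Qed.

End translation.

Section translation_zt.
Context {R : realType} {N : nat}.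
Local Notation ZT := ('rV[R]_N * R * R)%type.
Local Notation mR := (measurableTypeR R).
Local Notation mZT := ('rV[mR]_N * mR * mR)%type.

Lemma measurable_shift (h : ZT) :
  measurable_fun [set: mZT] (fun p : mZT => (p : ZT) + h : mZT).
Proof.
apply: measurable_fun_pair => /=.
  apply: measurable_fun_pair => /=.
    apply: (measurableT_comp (measurable_shift_rV h.1.1)).
    exact: (measurableT_comp measurable_fst measurable_fst).
  by apply: measurable_funD => //; exact: (measurableT_comp measurable_snd measurable_fst).
by apply: measurable_funD.
Qed.

Lemma lebesgue_zt_shift (h : ZT) (A : set mZT) : measurable A ->
  lebesgue_zt N ((fun p : mZT => (p : ZT) + h : mZT) @^-1` A) = lebesgue_zt N A.
Proof.
apply: (@product_measure_preserving _ _ _ _ _ (lebesgue_z N) lebesgue_measure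
  (fun z : 'rV[mR]_N * mR => (z.1 + h.1.1, z.2 + h.1.2)) (fun x : mR => x + h.2 : mR)).
- apply: measurable_fun_pair => /=.
    by apply: (measurableT_comp (measurable_shift_rV h.1.1)).
  by apply: measurable_funD.
- by apply: measurable_funD.
- apply: (@product_measure_preserving _ _ _ _ _ (lebesgue_rV N) lebesgue_measure
    (fun x => x + h.1.1) (fun x : mR => x + h.1.2 : mR)).
  + exact: measurable_shift_rV.
  + by apply: measurable_funD.
  + exact: lebesgue_rV_shift.
  + exact: lebesgue_measure_shift.
- exact: lebesgue_measure_shift.
Qed.

End translation_zt.

(** * Integrability of the weight *)

Section weight_integral.
Context {R : realType}.
Local Notation mR := (measurableTypeR R).
Local Notation leb := (@lebesgue_measure R).
Implicit Types (eps a r y : R).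

Lemma measurable_powRn a : measurable_fun [set: mR] (fun y : mR => (y `^ a)%:E).
Proof. by apply/measurable_EFinP; exact: measurable_powR. Qed.

(** Monotone convergence along the intervals [1/(i+2), 1], where the fundamental theorem of calculus
    applies to the primitive y^(1+a) / (1+a). For a > -1 the lower end point contributes a
    nonpositive term, which is dropped. *)
Lemma integral_powR01 a : -1 < a ->
  (\int[leb]_(y in `]0%R, 1%R]) (y `^ a)%:E <= ((1 + a)^-1)%:E)%E.
Proof.
move=> a1.
have a0 : 0 < 1 + a by lra.
pose F (i : nat) : set mR := `[i.+2%:R^-1, 1]%classic.
have U : \bigcup_i F i = (`]0, 1]%classic : set mR).
  apply/seteqP; split => y /=.
    move=> [i _]; rewrite /F /= !in_itv/= => /andP[iy ->]; rewrite andbT.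
    by apply: lt_le_trans iy; rewrite invr_gt0.
  rewrite in_itv/= => /andP[y0 y1].
  exists (Num.truncn y^-1) => //; rewrite /F /= in_itv/= y1 andbT.
  rewrite invf_ple ?posrE//; apply/ltW/(lt_trans (truncnS_gt _)).
  by rewrite ltr_nat.
have ndF : nondecreasing_seq F.
  move=> i j ij; apply/subsetPset => y; rewrite /F /= !in_itv/= => /andP[iy ->].
  by rewrite andbT (le_trans _ iy)// lef_pV2 ?posrE// ler_nat.
have H := @ge0_nondecreasing_set_cvg_integral _ mR R F
  (fun y => (y `^ a)%:E) leb ndF.
have {}H : (\int[leb]_(y in F i) (y `^ a)%:E @[i --> \oo] -->
    \int[leb]_(y in \bigcup_i F i) (y `^ a)%:E)%E.
  apply: H => //; first by move=> i; exact: measurable_itv.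
    by move=> i; apply: measurable_funTS; exact: measurable_powRn.
  by move=> i y _; rewrite lee_fin powR_ge0.
rewrite -U; apply: cvge_le H.
apply: nearW => i.
have i0 : 0 < i.+2%:R^-1 :> R by rewrite invr_gt0.
have i1 : i.+2%:R^-1 < 1 :> R by rewrite invf_lt1// ltr1n.
have gt0 y : i.+2%:R^-1 <= y -> 0 < y by exact: lt_le_trans.
pose G y := (1 + a)^-1 * y `^ (1 + a).
have dG y : 0 < y -> is_derive y 1 G (y `^ a).
  move=> y0; have dp := is_derive1_powR (1 + a) y0.
  have [d1 d2] := is_deriveZ (1 + a)^-1 dp.
  split; first exact: d1.
  apply: etrans d2 _; rewrite /GRing.scale/= mulrA mulVf ?gt_eqF// mul1r.
  by congr (_ `^ _); ring.
have cont (f : R -> R) : (forall y, 0 < y -> derivable f y 1) ->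
    forall y, 0 < y -> {for y, continuous f}.
  by move=> df y /df /derivable1_diffP/differentiable_continuous.
rewrite (@continuous_FTC2 R (fun y => y `^ a) G)//.
- rewrite -EFinB lee_fin /G powR1 mulr1 gerBl mulr_ge0 ?powR_ge0// invr_ge0.
  exact: ltW.
- apply: derivable_within_continuous => y; rewrite in_itv/= => /andP[/gt0 y0 _].
  by apply: derivable_powR; rewrite in_itv/= y0.
- have cG : forall y, 0 < y -> {for y, continuous G}.
    by apply: cont => y /dG[].
  split.
  + by move=> y; rewrite in_itv/= => /andP[/ltW/gt0/dG[]].
  + by apply: cvg_at_right_filter; exact: cG.
  + by apply: cvg_at_left_filter; exact: cG.
- move=> y; rewrite in_itv/= => /andP[/ltW/gt0 y0 _].
  by rewrite derive1E; have [_ ->] := dG _ y0.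
Qed.

Lemma rho_gt0 eps a y : 0 < y -> 0 < rho eps a y.
Proof. by move=> y0; apply: powR_gt0; rewrite ltr_wpDl ?sqr_ge0// exprn_gt0. Qed.

Lemma measurable_rho eps a : measurable_fun [set: mR] (rho eps a : mR -> mR).
Proof.
apply: (measurableT_comp (measurable_powR _)).
by apply: measurable_funD => //; exact: measurable_funX.
Qed.

(** Only polynomial growth in [r] matters. For a >= 0 the base eps^2 + y^2 is at most 2 r^2, and its
    exponent a/2 is rounded up to an integer [k]. For a < 0, dropping eps^2 gives rho <= y^a up to y
    = 1, and beyond it rho <= 1. *)
Lemma integral_rho_le eps a : 0 <= eps < 1 -> -1 < a ->
  exists C : R, exists m : nat, 0 <= C /\ forall r, 1 <= r ->
  (\int[leb]_(y in `]0%R, r[) (rho eps a y)%:E <= (C * r ^+ m)%:E)%E.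
Proof.
move=> /andP[e0 e1] a1.
have me : measurable_fun [set: mR] (fun y : mR => (rho eps a y)%:E).
  by apply/measurable_EFinP; exact: measurable_rho.
have [a0|a0] := leP 0 a.
  pose k := (Num.truncn (a / 2)).+1.
  exists (2 ^+ k), (k.*2.+1); split; first by rewrite exprn_ge0.
  move=> r r1.
  have r0 : 0 < r by lra.
  apply: (@le_trans _ _ (\int[leb]_(y in `]0%R, r[) ((2 * r ^+ 2) ^+ k)%:E)%E).
    apply: ge0_le_integral => //.
    - by move=> y _; rewrite lee_fin powR_ge0.
    - by apply: measurable_funTS.
    move=> y /=; rewrite in_itv/= => /andP[y0 yr]; rewrite lee_fin.
    have r2 : 1 <= r ^+ 2 by rewrite expr_ge1// ltW.
    rewrite -powR_mulrn; last by lra.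
    apply: (@le_trans _ _ ((2 * r ^+ 2) `^ (a / 2))).
      apply: ge0_ler_powR; rewrite ?nnegrE ?divr_ge0 ?addr_ge0 ?sqr_ge0//; first by lra.
      have : y ^+ 2 <= r ^+ 2 by rewrite lerXn2r ?nnegrE ?ltW.
      have : eps ^+ 2 <= 1 by rewrite expr_le1// ltW.
      lra.
    apply: ler_powR; first by lra.
    by apply: ltW; rewrite /k; exact: truncnS_gt.
  rewrite integral_cst//= lebesgue_measure_itv/= lte_fin r0 -EFinB -EFinM lee_fin.
  rewrite subr0 exprMn -exprM mul2n exprSr mulrA//.
exists ((1 + a)^-1 + 1), 1%N; split; first by rewrite addr_ge0// invr_ge0; lra.
move=> r r1; have r0 : 0 < r by lra.
pose f1 : mR -> \bar R := (fun y => (y `^ a)%:E) \_ `]0, 1].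
have mf1 : measurable_fun [set: mR] f1.
  apply/(measurable_restrictT _ _).1; first exact: measurable_itv.
  by apply: measurable_funTS; exact: measurable_powRn.
have f10 y : (0 <= f1 y)%E.
  by apply: erestrict_ge0 => x _; rewrite lee_fin powR_ge0.
apply: (@le_trans _ _ (\int[leb]_(y in `]0%R, r[) (f1 y + 1%:E))%E).
  apply: ge0_le_integral => //.
  - by move=> y _; rewrite lee_fin powR_ge0.
  - by apply: measurable_funTS.
  - by apply: measurable_funTS; apply: emeasurable_funD.
  move=> y /=; rewrite in_itv/= => /andP[y0 yr].
  have E : rho eps a y = (eps ^+ 2 + y ^+ 2) `^ (- - (a / 2)) by rewrite opprK.
  have s0 : 0 <= - (a / 2) by lra.
  have y2 : 0 < y ^+ 2 by rewrite exprn_gt0.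
  have ey0 : 0 < eps ^+ 2 + y ^+ 2 by rewrite ltr_wpDl ?sqr_ge0.
  have [y1|y1] := leP y 1.
    apply: (@le_trans _ _ (f1 y)); last by rewrite leeDl// lee_fin.
    rewrite /f1 patchE mem_set/=; last by rewrite in_itv/= y0.
    rewrite lee_fin E.
    have -> : y `^ a = (y ^+ 2) `^ (- - (a / 2)).
      by rewrite opprK -(powR_mulrn 2 (ltW y0)) -powRrM; congr (_ `^ _); field.
    rewrite powRN [leRHS]powRN lef_pV2 ?posrE ?powR_gt0//.
    by apply: ge0_ler_powR; rewrite ?nnegrE ?(ltW ey0) ?(ltW y2)// lerDr sqr_ge0.
  apply: (@le_trans _ _ 1%:E); last by rewrite leeDr.
  rewrite lee_fin E powRN invf_le1 ?powR_gt0//.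
  have : 1 `^ (- (a / 2)) <= (eps ^+ 2 + y ^+ 2) `^ (- (a / 2)).
    apply: ge0_ler_powR; rewrite ?nnegrE ?(ltW ey0)//.
    have : 1 <= y ^+ 2 by rewrite expr_ge1// ltW.
    by have := sqr_ge0 eps; lra.
  by rewrite powR1.
rewrite ge0_integralD//; last by apply: measurable_funTS.
rewrite mulrDl EFinD; apply: leeD.
  apply: (@le_trans _ _ (\int[leb]_(y in [set: mR]) f1 y)%E).
    by apply: ge0_subset_integral.
  rewrite /f1 -integral_mkcond; apply: (le_trans (integral_powR01 a1)).
  by rewrite lee_fin ler_peMr// ?invr_ge0; lra.
rewrite integral_cst//= lebesgue_measure_itv/= lte_fin r0 -EFinB -EFinM lee_fin.
by rewrite subr0.
Qed.

End weight_integral.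

Lemma ge0_integral_prodM d1 d2 (T1 : measurableType d1) (T2 : measurableType d2)
    (R : realType) (m1 : {sigma_finite_measure set T1 -> \bar R})
    (m2 : {sigma_finite_measure set T2 -> \bar R}) (f : T1 -> \bar R) (g : T2 -> \bar R) :
  measurable_fun setT f -> measurable_fun setT g ->
  (forall x, 0 <= f x)%E -> (forall y, 0 <= g y)%E ->
  (\int[m1 \x m2]_p (f p.1 * g p.2) = \int[m1]_x f x * \int[m2]_y g y)%E.
Proof.
move=> mf mg f0 g0.
rewrite (@fubini_tonelli1 _ _ _ _ _ m1 m2); last 2 first.
- apply: emeasurable_funM.
    exact: (measurableT_comp mf measurable_fst).
  exact: (measurableT_comp mg measurable_snd).
- by move=> p; exact: mule_ge0.
under eq_integral.
  move=> x _; rewrite /fubini_F/= ge0_integralZl//; over.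
rewrite -ge0_integralZr//.
exact: integral_ge0.
Qed.

(** * Functions supported in cylinders *)

Section compact_support.
Context {R : realType} {N : nat}.
Local Notation ZT := ('rV[R]_N * R * R)%type.
Implicit Types (A B r : R) (f g : ZT -> R) (p v h : ZT).

(** [A] bounds the squared radius and [B] the time. Supports are tracked by these two numbers rather
    than by compactness, because the supports of shifts and derivatives are then explicit and only
    have to be compared with [r ^+ 2]. *)
Definition cyl A B : set ZT := [set p | sqnormz p.1 <= A /\ `|p.2| <= B].
Definition supp_in A B f := forall p, f p != 0 -> cyl A B p.

Lemma closed_cyl A B : closed (cyl A B).
Proof.
have -> : cyl A B = (fun p : ZT => sqnormz p.1) @^-1` [set x | x <= A] `&`
    (fun p : ZT => p.2) @^-1` [set x | `|x| <= B].
  by apply/seteqP; split => p [].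
apply: closedI.
  apply: preimage_closed; first by move=> p _; exact/smooth_continuous/smooth_sqnormz.
  exact: closed_le.
apply: preimage_closed; first by move=> p _; exact/smooth_continuous/smooth_t.
rewrite (_ : mkset _ = `[- B, B]%classic); first exact: interval_closed.
by apply/seteqP; split => x /=; rewrite in_itv/= ler_norml.
Qed.

Lemma compact_cyl A B : compact (cyl A B).
Proof.
pose M := Num.max A 1.
have M0 : 1 <= M by rewrite le_max lexx orbT.
apply: (@subclosed_compact _ _ ([set v : 'rV[R]_N | forall i, (`[- M, M]%classic : set R) (v ord0 i)]
  `*` `[- M, M]%classic `*` `[- B, B]%classic)).
- exact: closed_cyl.
- apply: compact_setX; last exact: segment_compact.
  apply: compact_setX; last exact: segment_compact.
  have := @rV_compact R N (fun=> `[- M, M]%classic).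
  by apply => i; exact: segment_compact.
- move=> p [H1 H2].
  have c i : - M <= comp i p.1 <= M.
    rewrite -ler_norml; apply: sqr_norm_le; first by lra.
    apply: (le_trans (comp_sqr_le i p.1)); apply: (le_trans H1).
    have AM : A <= M by rewrite le_max lexx.
    by apply: (le_trans AM); rewrite expr2 ler_peMr//; lra.
  split; [split|] => /=.
  + by move=> i; rewrite in_itv/=; exact: (c (Some i)).
  + by rewrite in_itv/=; exact: (c None).
  + by rewrite in_itv/= -ler_norml.
Qed.

Lemma cyl_bounded A B f : continuous f ->
  exists2 c, 0 <= c & forall p, cyl A B p -> `|f p| <= c.
Proof.
move=> cf.
have [M [_ HM]] : bounded_set (f @` cyl A B).
  apply: compact_bounded; apply: continuous_compact; last exact: compact_cyl.
  exact: continuous_subspaceT.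
exists (Num.max (M + 1) 0); first by rewrite le_max lexx orbT.
move=> p Kp; apply: (@HM (Num.max (M + 1) 0)); last by exists p.
by rewrite lt_max; apply/orP; left; rewrite ltrDl.
Qed.

Lemma supp_in_derive A B f v : supp_in A B f -> supp_in A B (fun p => 'D_v f p).
Proof.
move=> sf p; apply: contraNP => np; apply/eqP.
have oK : open (~` cyl A B) by rewrite openC; exact: closed_cyl.
rewrite (@near_eq_derive _ _ _ _ (cst 0)).
  exact: derive_cst.
have : nbhs p (~` cyl A B) by exact: open_nbhs_nbhs.
apply: filterS => q /= nq; apply/eqP; apply: contrapT => /negP fq.
exact/nq/sf.
Qed.

Lemma supp_inMl A B f g : supp_in A B f -> supp_in A B (fun p => f p * g p).
Proof. by move=> sf p; rewrite mulf_eq0 negb_or => /andP[/sf]. Qed.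

Lemma supp_in_shift A B f h : supp_in A B f ->
  supp_in (2 * A + 2 * sqnormz h.1) (B + `|h.2|) (fun p => f (p + h)).
Proof.
move=> sf p /sf[H1 H2]; split.
  have -> : p.1 = (p + h).1 - h.1 by rewrite addrK.
  by apply: (le_trans (sqnormzD_le _ _)); rewrite sqnormzN lerD2r ler_wpM2l.
have -> : p.2 = (p + h).2 - h.2 by rewrite addrK.
by apply: (le_trans (ler_normB _ _)); rewrite lerD2r.
Qed.

Lemma test_functionI A B r f : smooth f -> supp_in A B f ->
  A < r ^+ 2 -> B < r ^+ 2 -> test_function r f.
Proof.
move=> sf suppf Ar Br; split => //.
  apply: (@subclosed_compact _ _ (cyl A B)); [exact: closed_closure|exact: compact_cyl|].
  by rewrite [X in _ `<=` X]((closure_id _).1 (@closed_cyl A B)); apply: closureS => p /suppf.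
apply: (@subset_trans _ (cyl A B)).
  by rewrite [X in _ `<=` X]((closure_id _).1 (@closed_cyl A B)); apply: closureS => p /suppf.
move=> p [H1 H2]; split => /=; first exact: le_lt_trans Ar.
by rewrite /Itime/= in_itv/= -ltr_norml; exact: le_lt_trans Br.
Qed.

Lemma supp_in_bounded A B f : continuous f -> supp_in A B f ->
  exists2 c, 0 <= c & forall p, `|f p| <= c.
Proof.
move=> cf sf; have [c c0 Hc] := cyl_bounded A B cf; exists c => // p.
by have [->|/sf/Hc//] := eqVneq (f p) 0; rewrite normr0.
Qed.

Lemma supp_in_cutoff r : 0 < r -> supp_in (4 * r ^+ 2) (2 * r ^+ 2) (@cutoff R N r).
Proof. by move=> r0 p /(cutoff_supp r0). Qed.

End compact_support.

Section weighted_space.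
Context {R : realType} {N : nat} (eps a : R).
Local Notation ZT := ('rV[R]_N * R * R)%type.
Local Notation mR := (measurableTypeR R).
Local Notation mZT := ('rV[mR]_N * mR * mR)%type.
Implicit Types (p h : ZT).

(* The weight is cut off at y = 0, so that integrals over the half-space become
   integrals over the whole space. *)
Definition wt p : R := if 0 < p.1.2 then rho eps a p.1.2 else 0.

Lemma wt_ge0 p : 0 <= wt p.
Proof. by rewrite /wt; case: ifP => // _; exact: powR_ge0. Qed.

Lemma wt_gt0 p : 0 < p.1.2 -> 0 < wt p.
Proof. by move=> p0; rewrite /wt p0 rho_gt0. Qed.

Lemma measurable_y_gt0 : measurable ([set p | 0 < p.1.2] : set mZT).
Proof.
rewrite (_ : mkset _ = (fun p : mZT => p.1.2) @^-1` `]0, +oo[); last first.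
  by apply/seteqP; split => p /=; rewrite in_itv/= andbT.
rewrite -[X in measurable X]setTI.
exact: (measurable_comp None measurableT (measurable_itv _)).
Qed.

Lemma measurable_wt : measurable_fun [set: mZT] (wt : mZT -> mR).
Proof.
apply: measurable_fun_ifT => //.
  apply: (measurable_fun_bool true).
  rewrite setTI (_ : _ @^-1` _ = [set p : mZT | 0 < p.1.2])//.
  exact: measurable_y_gt0.
by apply: (measurableT_comp (measurable_rho eps a)); exact: (measurable_comp None).
Qed.

Lemma wt_shift p h : h.1.2 = 0 -> wt (p + h) = wt p.
Proof. by move=> h0; rewrite /wt /= h0 addr0. Qed.

End weighted_space.

(** * Integrals over space-time *)

Section lebesgue_zt_integral.
Context {R : realType} {N : nat}.
Local Notation ZT := ('rV[R]_N * R * R)%type.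
Local Notation mR := (measurableTypeR R).
Local Notation mZT := ('rV[mR]_N * mR * mR)%type.
Local Notation leb := (@lebesgue_zt R N).
Implicit Types (f g : ZT -> R) (p h : ZT).

Definition mfun f : Prop := measurable_fun [set: mZT] (f : mZT -> mR).
Definition intgb f : Prop := leb.-integrable [set: mZT] (EFin \o f).
Definition J f : R := \int[leb]_p f p.

Lemma mfun_EFin f : mfun f -> measurable_fun [set: mZT] (EFin \o f).
Proof. by move=> mf; apply/measurable_EFinP. Qed.

Lemma intgb_mfun f : intgb f -> mfun f.
Proof. by move=> /integrableP[/measurable_EFinP]. Qed.

Lemma mfunD f g : mfun f -> mfun g -> mfun (fun p => f p + g p).
Proof. by move=> mf mg; exact: measurable_funD. Qed.

Lemma mfunM f g : mfun f -> mfun g -> mfun (fun p => f p * g p).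
Proof. by move=> mf mg; exact: measurable_funM. Qed.

Lemma mfun_cst (c : R) : mfun (fun=> c).
Proof. exact: measurable_cst. Qed.

Lemma mfunZ (c : R) f : mfun f -> mfun (fun p => c * f p).
Proof. by apply: mfunM; exact: mfun_cst. Qed.

Lemma mfunN f : mfun f -> mfun (fun p => - f p).
Proof. by move=> /(mfunZ (-1)); under eq_fun do rewrite mulN1r. Qed.

Lemma mfunB f g : mfun f -> mfun g -> mfun (fun p => f p - g p).
Proof. by move=> mf mg; apply: mfunD => //; exact: mfunN. Qed.

Lemma mfun_shift f h : mfun f -> mfun (fun p => f (p + h)).
Proof. by move=> mf; apply: (measurableT_comp mf); exact: measurable_shift. Qed.

Lemma mfun_smooth f : smooth f -> mfun f.
Proof. by move=> sf; apply: continuous_measurable; exact: smooth_continuous. Qed.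

Lemma mfun_indic (D : set mZT) : measurable D -> mfun (\1_D : mZT -> R).
Proof. by move=> mD; exact: measurable_indic. Qed.

Lemma ge0_integral_shift (f : mZT -> \bar R) h : measurable_fun [set: mZT] f ->
  (forall p, 0 <= f p)%E ->
  (\int[leb]_p f ((p : ZT) + h : mZT)%R = \int[leb]_p f p)%E.
Proof.
move=> mf f0.
have mh := @measurable_shift R N h.
have f0' : {in [set: mZT], forall p, (0 <= f p)%E} by move=> p _; exact: f0.
have := ge0_integral_pushforward mh leb measurableT mf f0'.
rewrite preimage_setT => <-.
apply: eq_measure_integral => A mA _.
exact: lebesgue_zt_shift.
Qed.

Lemma integral_shift (f : mZT -> \bar R) h : measurable_fun [set: mZT] f ->
  (\int[leb]_p f ((p : ZT) + h : mZT)%R = \int[leb]_p f p)%E.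
Proof.
move=> mf; rewrite integralE [RHS]integralE; congr (_ - _)%E.
  rewrite -(ge0_integral_shift (f := funepos f) h (measurable_funepos mf))//.
  by apply: eq_integral => p _; rewrite !funeposE.
rewrite -(ge0_integral_shift (f := funeneg f) h (measurable_funeneg mf))//.
by apply: eq_integral => p _; rewrite !funenegE.
Qed.

Lemma J_shift f h : mfun f -> J (fun p => f (p + h)) = J f.
Proof.
move=> mf; rewrite /J /Rintegral; congr fine.
exact: (@integral_shift (EFin \o f) h (mfun_EFin mf)).
Qed.

Lemma intgb_shift f h : intgb f -> intgb (fun p => f (p + h)).
Proof.
move=> /[dup] /intgb_mfun mf /integrableP[_ fi]; apply/integrableP; split.
  by apply: mfun_EFin; exact: mfun_shift.
rewrite (ge0_integral_shift (f := fun p : mZT => `|(f p)%:E|%E))//.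
by apply: measurableT_comp => //; exact: mfun_EFin.
Qed.

Lemma intgbD f g : intgb f -> intgb g -> intgb (fun p => f p + g p).
Proof.
move=> fi gi; rewrite /intgb (_ : EFin \o _ = ((EFin \o f) \+ (EFin \o g))%E)//.
exact: integrableD.
Qed.

Lemma intgbZ (c : R) f : intgb f -> intgb (fun p => c * f p).
Proof.
move=> fi; rewrite /intgb (_ : EFin \o _ = (fun p => c%:E * (EFin \o f) p)%E)//.
exact: integrableZl.
Qed.

Lemma intgb_dom f g : mfun f -> (forall p, `|f p| <= g p) -> intgb g -> intgb f.
Proof.
move=> mf fg; apply: le_integrable => //; first exact: mfun_EFin.
move=> p _ /=; rewrite lee_fin; apply: le_trans (fg p) _; exact: ler_norm.
Qed.

Lemma JD f g : intgb f -> intgb g -> J (fun p => f p + g p) = J f + J g.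
Proof. by move=> fi gi; rewrite /J RintegralD. Qed.

Lemma JB f g : intgb f -> intgb g -> J (fun p => f p - g p) = J f - J g.
Proof. by move=> fi gi; rewrite /J RintegralB. Qed.

Lemma JZ (c : R) f : intgb f -> J (fun p => c * f p) = c * J f.
Proof. by move=> fi; rewrite /J RintegralZl. Qed.

Lemma le_J f g : intgb f -> intgb g -> (forall p, f p <= g p) -> J f <= J g.
Proof. by move=> fi gi fg; apply: le_Rintegral. Qed.

Lemma J_ge0 f : (forall p, 0 <= f p) -> 0 <= J f.
Proof. by move=> f0; apply: Rintegral_ge0. Qed.

Lemma eq_J f g : (forall p, f p = g p) -> J f = J g.
Proof. by move=> fg; congr J; apply/funext. Qed.

Lemma aeS (P Q : ZT -> Prop) : {ae leb, forall p : ZT, P p} ->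
  (forall p, P p -> Q p) -> {ae leb, forall p : ZT, Q p}.
Proof. by move=> HP PQ; apply: negligibleS HP => p /=; apply: contra_not; exact: PQ. Qed.

Lemma aeI (P Q : ZT -> Prop) : {ae leb, forall p : ZT, P p} ->
  {ae leb, forall p : ZT, Q p} -> {ae leb, forall p : ZT, P p /\ Q p}.
Proof.
move=> HP HQ; apply: (negligibleS _ (negligibleU HP HQ)) => p /= /not_andP[]; by [left|right].
Qed.

Lemma ae_forall (P : nat -> ZT -> Prop) : (forall n, {ae leb, forall p : ZT, P n p}) ->
  {ae leb, forall p : ZT, forall n, P n p}.
Proof.
move=> HP; have := negligible_bigcup HP.
by apply: negligibleS => p /= /existsNP[n nP]; exists n.
Qed.

Lemma aeW (P : ZT -> Prop) : (forall p, P p) -> {ae leb, forall p : ZT, P p}.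
Proof.
by move=> HP; apply: (negligibleS _ (negligible_set0 leb)) => p /=.
Qed.

Lemma ae_eq_J f g : mfun f -> mfun g -> {ae leb, forall p : ZT, f p = g p} -> J f = J g.
Proof.
move=> mf mg fg; rewrite /J /Rintegral; congr fine.
apply: ae_eq_integral => //; [exact: mfun_EFin|exact: mfun_EFin|].
by apply: (aeS fg) => p /= fgp _; rewrite fgp.
Qed.

Lemma EFin_J f : intgb f -> ((J f)%:E = \int[leb]_p (f p)%:E)%E.
Proof. by move=> fi; rewrite /J /Rintegral fineK//; exact: integrable_fin_num. Qed.

Lemma J_eq0 f : intgb f -> (forall p, 0 <= f p) -> J f = 0 ->
  {ae leb, forall p : ZT, f p = 0}.
Proof.
move=> fi f0 Jf.
have : (\int[leb]_(p in [set: mZT]) `|(EFin \o f) p| = 0)%E.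
  under eq_integral do rewrite /= ger0_norm//.
  by rewrite -EFin_J// Jf.
move/(ae_eq_integral_abs leb measurableT (mfun_EFin (intgb_mfun fi))).1 => H.
by apply: (aeS H) => p /= /(_ I) [].
Qed.

Lemma ae_shift (P : ZT -> Prop) h : {ae leb, forall p : ZT, P p} ->
  {ae leb, forall p : ZT, P (p + h)}.
Proof.
move=> [A [mA A0 PA]].
exists ((fun p : mZT => (p : ZT) + h : mZT) @^-1` A); split.
- by rewrite -[X in measurable X]setTI; exact: measurable_shift.
- by rewrite lebesgue_zt_shift.
- by move=> p /= np; apply: PA.
Qed.

(* Mean value theorem for [s |-> J (theta * psi (. + s h))], differentiated
   under the integral sign. *)
Lemma J_mean_value (theta psi : ZT -> R) h (c : R) : intgb theta -> smooth psi ->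
  (forall p (s : R), -1 < s < 2 -> theta p != 0 -> `|psi (p + s *: h)| <= c) ->
  (forall p (s : R), -1 < s < 2 -> theta p != 0 -> `|'D_h psi (p + s *: h)| <= c) ->
  exists2 s, 0 < s < 1 &
    J (fun p => theta p * (psi (p + h) - psi p)) =
    J (fun p => theta p * 'D_h psi (p + s *: h)).
Proof.
move=> ti spsi psic Dpsic.
have mt := intgb_mfun ti.
have c0 : intgb (fun p => `|theta p| * `|c|).
  have /integrable_norm H := ti.
  by under eq_fun do rewrite mulrC; apply: intgbZ; exact: H.
have bnd (k : ZT -> R) (s : R) : smooth k -> -1 < s < 2 ->
    (forall p (s : R), -1 < s < 2 -> theta p != 0 -> `|k (p + s *: h)| <= c) ->
    intgb (fun p => theta p * k (p + s *: h)).
  move=> sk s12 kc; apply: intgb_dom c0.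
    by apply: mfunM => //; apply: mfun_shift; exact: mfun_smooth.
  move=> p; rewrite normrM; have [->|t0] := eqVneq (theta p) 0.
    by rewrite normr0 !mul0r.
  by rewrite ler_wpM2l// (le_trans (kc _ _ s12 t0))// ler_norm.
pose f (s : R) (p : mZT) := theta p * psi ((p : ZT) + s *: h).
have df (s : R) p : is_derive s 1 (f ^~ p) (theta p * 'D_h psi (p + s *: h)).
  have [d1 d2] := is_deriveZ (theta p) (derive_fun_shift p h s spsi).
  by split; [exact: d1|exact: d2].
have d1f (s : R) p : partial1of2 f s p = theta p * 'D_h psi (p + s *: h).
  by rewrite partial1of2E; have [_ ->] := df s p.
(* An open interval around [0, 1], so that the end points are covered too; the dominating function
   does not depend on [s] in it. *)
have IF (s : R) : s \in `]-1, 2[ ->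
    is_derive s 1 (fun s => J (f s)) (J (fun p => theta p * 'D_h psi (p + s *: h))).
  rewrite in_itv/= => s12.
  have int1 x : `]-1, 2[%classic x -> leb.-integrable [set: mZT] (EFin \o f x).
    by rewrite /= in_itv/= => x12; exact: bnd.
  have der1 x p : `]-1, 2[%classic x -> [set: mZT] p -> derivable (f ^~ p) x 1.
    by move=> _ _; have [] := df x p.
  have G0 (p : mZT) : 0 <= `|theta p| * `|c| by rewrite mulr_ge0.
  have Gub x p : `]-1, 2[%classic x -> [set: mZT] p ->
      `|partial1of2 f x p| <= `|theta p| * `|c|.
    rewrite /= in_itv/= => x12 _; rewrite d1f normrM.
    have [->|t0] := eqVneq (theta p) 0; first by rewrite normr0 !mul0r.
    by rewrite ler_wpM2l// (le_trans (Dpsic _ _ x12 t0))// ler_norm.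
  have s12' : `]-1, 2[%classic s by rewrite /= in_itv.
  split.
    exact: (@derivable_under_integral R _ mZT leb f setT measurableT s _ _ s12'
      int1 der1 _ G0 c0 Gub).
  rewrite -derive1E (@differentiation_under_integral R _ mZT leb f setT measurableT
    s _ _ s12' int1 der1 _ G0 c0 Gub).
  by apply: eq_J => p; rewrite d1f.
pose F (s : R) : R := J (f s).
pose dF (s : R) : R := J (fun p => theta p * 'D_h psi (p + s *: h)).
have H1 (s : R) : s \in `]0, 1[ -> is_derive s 1 F (dF s).
  rewrite in_itv/= => /andP[s0 s1]; apply: IF.
  by rewrite in_itv/=; apply/andP; split; lra.
have H2 : {within `[(0 : R), 1], continuous F}.
  apply: derivable_within_continuous => s; rewrite in_itv/= => /andP[s0 s1].
  by have [] // := IF s; rewrite in_itv/=; apply/andP; split; lra.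
have [s s01 HE] := MVT (@ltr01 R) H1 H2.
exists s; first by move: s01; rewrite in_itv.
move: HE; rewrite subr0 mulr1 /dF => <-; rewrite /F /f -JB; last 2 first.
- by apply: bnd => //; apply/andP; split; lra.
- by apply: bnd => //; apply/andP; split; lra.
by apply: eq_J => p; rewrite /f scale1r scale0r addr0 mulrBr.
Qed.

End lebesgue_zt_integral.

(** * Weighted L^2 *)

Section weighted_L2.
Context {R : realType} {N : nat} (eps a : R).
Local Notation ZT := ('rV[R]_N * R * R)%type.
Local Notation leb := (@lebesgue_zt R N).
Local Notation w := (@wt R N eps a).
Implicit Types (F G H g : ZT -> R) (p h : ZT) (c : R).

Definition L2 F : Prop := mfun F /\ intgb (fun p => w p * F p ^+ 2).
Definition ip F G : R := J (fun p => w p * (F p * G p)).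
(* The square of the weighted L^2 norm. *)
Definition nrm F : R := ip F F.

Lemma mfun_wt : mfun w. Proof. exact: measurable_wt. Qed.

Lemma L2_mfun F : L2 F -> mfun F. Proof. by case. Qed.

Lemma L2_intgb F G : L2 F -> L2 G -> intgb (fun p => w p * (F p * G p)).
Proof.
move=> [mF iF] [mG iG].
apply: (@intgb_dom _ _ _ (fun p => w p * F p ^+ 2 + w p * G p ^+ 2)).
- by apply: mfunM; [exact: mfun_wt|exact: mfunM].
- move=> p; rewrite normrM ger0_norm ?wt_ge0// -mulrDr ler_wpM2l ?wt_ge0//.
  rewrite ler_norml; have := sqr_ge0 (F p - G p); have := sqr_ge0 (F p + G p).
  have := sqr_ge0 (F p); have := sqr_ge0 (G p).
  by move=> *; apply/andP; split; nra.
- exact: intgbD.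
Qed.

Lemma L2_dom F G c : mfun F -> (forall p, 0 < p.1.2 -> `|F p| <= c * `|G p|) ->
  L2 G -> L2 F.
Proof.
move=> mF FG [mG iG]; split => //.
apply: (intgb_dom _ _ (intgbZ (c ^+ 2) iG)).
  by apply: mfunM; [exact: mfun_wt|exact: (mfunM mF mF)].
move=> p; rewrite normrM (ger0_norm (wt_ge0 _ _ _)) mulrCA.
have [p0|p0] := ltP 0 p.1.2; last by rewrite /wt ltNge p0 /= !mul0r.
rewrite ler_wpM2l ?wt_ge0// ger0_norm ?sqr_ge0// -exprMn.
rewrite -[X in X <= _]real_normK ?num_real// -[leRHS]real_normK ?num_real//.
rewrite lerXn2r ?nnegrE// (le_trans (FG p p0))// normrM ler_wpM2r//.
exact: ler_norm.
Qed.

Lemma L2D F G : L2 F -> L2 G -> L2 (fun p => F p + G p).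
Proof.
move=> LF LG; split; first by apply: mfunD; exact: L2_mfun.
have := intgbD (intgbD LF.2 (intgbZ 2 (L2_intgb LF LG))) LG.2.
by congr intgb; apply/funext => p; ring.
Qed.

Lemma L2Z c F : L2 F -> L2 (fun p => c * F p).
Proof.
move=> LF; apply: (@L2_dom _ F `|c|) => //.
  by apply: mfunZ; exact: L2_mfun.
by move=> p _; rewrite normrM.
Qed.

Lemma L2N F : L2 F -> L2 (fun p => - F p).
Proof. by move=> /(L2Z (-1)); under eq_fun do rewrite mulN1r. Qed.

Lemma L2B F G : L2 F -> L2 G -> L2 (fun p => F p - G p).
Proof. by move=> LF LG; apply: L2D => //; exact: L2N. Qed.

Lemma L2_bM g F c : mfun g -> (forall p, 0 < p.1.2 -> `|g p| <= c) -> L2 F ->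
  L2 (fun p => g p * F p).
Proof.
move=> mg gc LF; apply: (@L2_dom _ F c) => //.
  by apply: mfunM => //; exact: L2_mfun.
by move=> p p0; rewrite normrM ler_wpM2r// gc.
Qed.

Lemma L2_shift F h : h.1.2 = 0 -> L2 F -> L2 (fun p => F (p + h)).
Proof.
move=> h0 [mF iF]; split; first exact: mfun_shift.
by have := intgb_shift h iF; congr intgb; apply/funext => p; rewrite wt_shift.
Qed.

Lemma ipC F G : ip F G = ip G F.
Proof. by apply: eq_J => p; rewrite [F p * _]mulrC. Qed.

Lemma ipDl F G H : L2 F -> L2 G -> L2 H ->
  ip (fun p => F p + G p) H = ip F H + ip G H.
Proof.
move=> LF LG LH; rewrite -JD; [|exact: L2_intgb|exact: L2_intgb].
by apply: eq_J => p; ring.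
Qed.

Lemma ipBl F G H : L2 F -> L2 G -> L2 H ->
  ip (fun p => F p - G p) H = ip F H - ip G H.
Proof.
move=> LF LG LH; rewrite -JB; [|exact: L2_intgb|exact: L2_intgb].
by apply: eq_J => p; ring.
Qed.

Lemma ipZl c F H : L2 F -> L2 H -> ip (fun p => c * F p) H = c * ip F H.
Proof.
move=> LF LH; rewrite -JZ; last exact: L2_intgb.
by apply: eq_J => p; ring.
Qed.

Lemma ipDr F G H : L2 F -> L2 G -> L2 H ->
  ip H (fun p => F p + G p) = ip H F + ip H G.
Proof. by move=> *; rewrite ipC ipDl// ![ip H _]ipC. Qed.

Lemma ipBr F G H : L2 F -> L2 G -> L2 H ->
  ip H (fun p => F p - G p) = ip H F - ip H G.
Proof. by move=> *; rewrite ipC ipBl// ![ip H _]ipC. Qed.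

Lemma ipZr c F H : L2 F -> L2 H -> ip H (fun p => c * F p) = c * ip H F.
Proof. by move=> *; rewrite ipC ipZl// ipC. Qed.

Lemma ip_shift F G h : h.1.2 = 0 -> L2 F -> L2 G ->
  ip (fun p => F (p + h)) (fun p => G (p + h)) = ip F G.
Proof.
move=> h0 LF LG; rewrite [RHS]/ip -(J_shift h (intgb_mfun (L2_intgb LF LG))).
by apply: eq_J => p; rewrite wt_shift.
Qed.

(** Tangential translations preserve both the measure and the weight, so the adjoint of a shift is
    the inverse shift. This is the only integration by parts available for [u] itself. *)
Lemma ip_shiftr F G h : h.1.2 = 0 -> L2 F -> L2 G ->
  ip F (fun p => G (p + h)) = ip (fun p => F (p - h)) G.
Proof.
move=> h0 LF LG; have h0' : (- h).1.2 = 0 by rewrite /= h0 oppr0.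
rewrite -(ip_shift (h := - h) h0')//; last exact: L2_shift.
by apply: eq_J => p; rewrite subrK.
Qed.

Lemma eq_ip F G F' G' : (forall p, 0 < p.1.2 -> F p * G p = F' p * G' p) ->
  ip F G = ip F' G'.
Proof.
move=> E; apply: eq_J => p; have [p0|p0] := ltP 0 p.1.2; first by rewrite E.
by rewrite /wt ltNge p0 /= !mul0r.
Qed.

Lemma nrm_ge0 F : 0 <= nrm F.
Proof. by apply: J_ge0 => p; rewrite mulr_ge0 ?wt_ge0// -expr2 sqr_ge0. Qed.

Lemma le_nrm F G : L2 F -> L2 G ->
  (forall p, 0 < p.1.2 -> `|F p| <= `|G p|) -> nrm F <= nrm G.
Proof.
move=> LF LG FG; apply: le_J; [exact: L2_intgb|exact: L2_intgb|] => p.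
have [p0|p0] := ltP 0 p.1.2; last by rewrite /wt ltNge p0 /= !mul0r.
rewrite ler_wpM2l ?wt_ge0// -!expr2.
by rewrite -[X in X <= _]real_normK ?num_real// -[leRHS]real_normK ?num_real//
  lerXn2r ?nnegrE// FG.
Qed.

Lemma nrmZ c F : L2 F -> nrm (fun p => c * F p) = c ^+ 2 * nrm F.
Proof. by move=> LF; rewrite /nrm ipZl// ?ipZr//; [ring|exact: L2Z]. Qed.

Lemma nrm_shift F h : h.1.2 = 0 -> L2 F -> nrm (fun p => F (p + h)) = nrm F.
Proof. by move=> h0 LF; exact: ip_shift. Qed.

(** Young's inequality stands in for Cauchy-Schwarz, so that only squared norms occur; the free
    constant [c] serves to absorb terms and to tune errors. *)
Lemma ip_young c F G : 0 < c -> L2 F -> L2 G ->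
  `|ip F G| <= c * nrm F + c^-1 * nrm G.
Proof.
move=> c0 LF LG.
have iFG := L2_intgb LF LG.
have E : c * nrm F + c^-1 * nrm G =
    J (fun p => c * (w p * (F p * F p)) + c^-1 * (w p * (G p * G p))).
  rewrite JD; [|by apply: intgbZ; exact: L2_intgb|by apply: intgbZ; exact: L2_intgb].
  by rewrite !JZ//; exact: L2_intgb.
have iE : intgb (fun p => c * (w p * (F p * F p)) + c^-1 * (w p * (G p * G p))).
  by apply: intgbD; apply: intgbZ; exact: L2_intgb.
have K (x y : R) : - (c * (x * x) + c^-1 * (y * y)) <= x * y <=
    c * (x * x) + c^-1 * (y * y).
  have -> : c * (x * x) + c^-1 * (y * y) =
    c^-1 * ((c * x) ^+ 2 + y ^+ 2) by field; rewrite gt_eqF.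
  have -> : x * y = c^-1 * (c * x * y) by field; rewrite gt_eqF.
  have c1 : 0 < c^-1 by rewrite invr_gt0.
  by rewrite -mulrN !ler_pM2l//; apply/andP; split; nra.
rewrite E ler_norml; apply/andP; split.
  rewrite -[X in X <= _]mulN1r -JZ//; apply: le_J => //; first exact: intgbZ.
  move=> p; have /andP[H _] := K (F p) (G p).
  rewrite mulN1r [leLHS](_ : _ = w p * - (c * (F p * F p) + c^-1 * (G p * G p))).
    by rewrite ler_wpM2l ?wt_ge0.
  by ring.
apply: le_J => // p; have /andP[_ H] := K (F p) (G p).
rewrite [leRHS](_ : _ = w p * (c * (F p * F p) + c^-1 * (G p * G p))).
  by rewrite ler_wpM2l ?wt_ge0.
by ring.
Qed.

Lemma nrmD_le F G : L2 F -> L2 G ->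
  nrm (fun p => F p + G p) <= 2 * nrm F + 2 * nrm G.
Proof.
move=> LF LG; have LFG := L2D LF LG.
have -> : nrm (fun p => F p + G p) = nrm F + 2 * ip F G + nrm G.
  by rewrite /nrm ipDl// !ipDr// (ipC G F); ring.
have LB := L2B LF LG.
have := nrm_ge0 (fun p => F p - G p).
have -> : nrm (fun p => F p - G p) = nrm F - 2 * ip F G + nrm G.
  by rewrite /nrm ipBl// !ipBr// (ipC G F); ring.
lra.
Qed.

Lemma nrmB_le F G : L2 F -> L2 G ->
  nrm (fun p => F p - G p) <= 2 * nrm F + 2 * nrm G.
Proof.
move=> LF LG; apply: (le_trans (nrmD_le LF (L2N LG))).
by rewrite lerD2l ler_wpM2l// /nrm (@eq_ip _ _ G G)// => p _; rewrite mulrNN.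
Qed.

Lemma nrm0_ae F : L2 F -> nrm F = 0 -> {ae leb, forall p : ZT, 0 < p.1.2 -> F p = 0}.
Proof.
move=> LF F0.
have iF := L2_intgb LF LF.
have := J_eq0 iF _ F0.
have ge0 p : 0 <= w p * (F p * F p) by rewrite mulr_ge0 ?wt_ge0// -expr2 sqr_ge0.
move=> /(_ ge0) /aeS; apply => p H p0; move/eqP: H.
by rewrite mulf_eq0 gt_eqF ?wt_gt0//= -expr2 sqrf_eq0 => /eqP.
Qed.

Lemma ae_eq_ip F F' G : mfun F -> mfun F' -> mfun G ->
  {ae leb, forall p : ZT, 0 < p.1.2 -> F p = F' p} -> ip F G = ip F' G.
Proof.
move=> mF mF' mG E; apply: ae_eq_J.
- by apply: mfunM; [exact: mfun_wt|exact: mfunM].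
- by apply: mfunM; [exact: mfun_wt|exact: mfunM].
apply: (aeS E) => p Ep; have [p0|p0] := ltP 0 p.1.2; first by rewrite Ep.
by rewrite /wt ltNge p0 /= !mul0r.
Qed.

End weighted_L2.

Section weighted_L2_bounded.
Context {R : realType} {N : nat} (eps a : R).
Hypotheses (eps01 : 0 <= eps < 1) (a_gtN1 : -1 < a).
Local Notation ZT := ('rV[R]_N * R * R)%type.
Local Notation mR := (measurableTypeR R).
Local Notation mZT := ('rV[mR]_N * mR * mR)%type.
Local Notation leb := (@lebesgue_zt R N).
Local Notation w := (@wt R N eps a).
Local Notation L2 := (@L2 R N eps a).
Implicit Types (F f g : ZT -> R) (p : ZT) (c r : R).

Definition inQ r p : R := (\1_(Q r) : ZT -> R) p.

Lemma measurable_Q r : measurable (Q r : set mZT).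
Proof.
rewrite (_ : Q r = (fun p : ZT => sqnormz p.1) @^-1` `]-oo, r ^+ 2[ `&`
    (fun p : ZT => p.2) @^-1` `]- r ^+ 2, r ^+ 2[).
  apply: measurableI.
    rewrite -[X in measurable X]setTI.
    exact: (mfun_smooth smooth_sqnormz measurableT (measurable_itv _)).
  rewrite -[X in measurable X]setTI.
  exact: (measurable_t measurableT (measurable_itv _)).
by apply/seteqP; split => p [] /= ; rewrite in_itv.
Qed.

Lemma mfun_inQ r : mfun (inQ r).
Proof. by apply: mfun_indic; exact: measurable_Q. Qed.

Lemma inQE r p : inQ r p = if `[< Q r p >] then 1 else 0.
Proof.
by rewrite /inQ indicE; case: asboolP => Qp; [rewrite mem_set|rewrite memNset].
Qed.

Lemma inQ_bound r p : `|inQ r p| <= 1.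
Proof. by rewrite inQE; case: asboolP; rewrite ?normr1 ?normr0. Qed.

(** The upper half of [Q r] lies in the box |x_i| < r, 0 < y < r, |t| < r^2, over which the integral
    of the weight factors by Tonelli. *)
Lemma wt_integral_Q : exists C : R, exists m : nat, 0 <= C /\ forall r, 1 <= r ->
  intgb (fun p => w p * inQ r p) /\ J (fun p => w p * inQ r p) <= C * r ^+ m.
Proof.
have [C [m [C0 HC]]] := integral_rho_le eps01 a_gtN1.
exists (2 ^+ N * C * 2), (N + m + 2)%N; split; first by rewrite !mulr_ge0// exprn_ge0.
move=> r r1; have r0 : 0 < r by lra.
have mw : mfun (fun p => w p * inQ r p).
  by apply: mfunM; [exact: mfun_wt|exact: mfun_inQ].
have w0 p : 0 <= w p * inQ r p.
  by rewrite mulr_ge0 ?wt_ge0// inQE; case: ifP.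
suff K : (\int[leb]_p (w p * inQ r p)%:E <= (2 ^+ N * C * 2 * r ^+ (N + m + 2))%:E)%E.
  have i : intgb (fun p => w p * inQ r p).
    apply/integrableP; split; first exact: mfun_EFin.
    under eq_integral do rewrite /= ger0_norm//.
    by apply: (le_lt_trans K); rewrite ltry.
  by split => //; rewrite -lee_fin EFin_J.
pose X : set 'rV[mR]_N := [set v | forall i, (`]- r, r[%classic : set R) (v ord0 i)].
have mX : measurable X.
  rewrite (_ : X = \bigcap_(i in [set: 'I_N])
      ((fun v : 'rV[mR]_N => v ord0 i) @^-1` `]- r, r[)).
    apply: fin_bigcap_measurable; first exact: finite_finset.
    move=> i _; rewrite -[X in measurable X]setTI.
    exact: (measurable_rV_coord i measurableT (measurable_itv _)).
  by apply/seteqP; split => v /= H i; [move=> _|]; exact: H.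
pose f (v : 'rV[mR]_N) : \bar R := (\1_X v)%:E.
pose g : mR -> \bar R := (fun y => (rho eps a y)%:E) \_ `]0, r[.
pose k (t : mR) : \bar R := (\1_(`]- r ^+ 2, r ^+ 2[%classic : set mR) t)%:E.
have mf : measurable_fun setT f by apply/measurable_EFinP; exact: measurable_indic.
have mk : measurable_fun setT k.
  by apply/measurable_EFinP; exact: measurable_indic.
have mg : measurable_fun setT g.
  apply/(measurable_restrictT _ _).1; first exact: measurable_itv.
  by apply: measurable_funTS; apply/measurable_EFinP; exact: measurable_rho.
have f0 v : (0 <= f v)%E by rewrite lee_fin.
have k0 v : (0 <= k v)%E by rewrite lee_fin.
have g0 v : (0 <= g v)%E.
  by apply: erestrict_ge0 => x _; rewrite lee_fin powR_ge0.
have mfg : measurable_fun setT (fun z : 'rV[mR]_N * mR => (f z.1 * g z.2)%E).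
  apply: emeasurable_funM.
    exact: (measurableT_comp mf measurable_fst).
  exact: (measurableT_comp mg measurable_snd).
have mfgk : measurable_fun setT (fun p : mZT => (f p.1.1 * g p.1.2 * k p.2)%E).
  apply: emeasurable_funM.
    exact: (measurableT_comp mfg measurable_fst).
  exact: (measurableT_comp mk measurable_snd).
apply: (@le_trans _ _ (\int[leb]_p (f p.1.1 * g p.1.2 * k p.2))%E).
  apply: ge0_le_integral => //.
  - by move=> p _; rewrite lee_fin.
  - exact: mfun_EFin.
  move=> p _; rewrite inQE; case: asboolP; last first.
    by move=> _; rewrite mulr0 !mule_ge0.
  move=> [/= Hz Ht]; rewrite mulr1 /wt.
  case: ifP => p0; last by rewrite !mule_ge0.
  have ci i : `|comp i p.1| < r.
    rewrite ltNge; apply/negP => H.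
    have : r ^+ 2 <= comp i p.1 ^+ 2.
      by rewrite -[leRHS]real_normK ?num_real// lerXn2r ?nnegrE// ltW.
    by apply/negP; rewrite -ltNge (le_lt_trans (comp_sqr_le _ _)).
  have -> : f p.1.1 = 1%E.
    rewrite /f indicE mem_set// => i /=; rewrite in_itv/= -ltr_norml.
    exact: (ci (Some i)).
  have -> : k p.2 = 1%E by rewrite /k indicE mem_set.
  rewrite mul1e mule1 /g patchE mem_set//= in_itv/= p0/=.
  exact: (le_lt_trans (ler_norm _) (ci None)).
rewrite (@ge0_integral_prodM _ _ _ _ _ (lebesgue_z N) lebesgue_measure
  (fun z => f z.1 * g z.2)%E k)//; last by move=> z; exact: mule_ge0.
rewrite (@ge0_integral_prodM _ _ _ _ _ (lebesgue_rV N) lebesgue_measure f g)//.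
have -> : (\int[lebesgue_rV N]_v f v = ((2 * r) ^+ N)%:E)%E.
  rewrite integral_indic// setIT.
  have mI (i : 'I_N) : measurable (`]- r, r[%classic : set R) by exact: measurable_itv.
  apply: etrans (lebesgue_rV_box mI) _.
  rewrite (eq_bigr (fun=> (2 * r)%:E)); last first.
    move=> i _; rewrite lebesgue_measure_itv/= lte_fin gtrN// -EFinB.
    by congr EFin; rewrite opprK [RHS]mulr_natl mulr2n.
  by rewrite prodEFin prodr_const card_ord.
have -> : (\int[lebesgue_measure]_t k t = (2 * r ^+ 2)%:E)%E.
  rewrite integral_indic// setIT.
  apply: etrans (lebesgue_measure_itv _) _; rewrite /= lte_fin.
  have r2 : 0 < r ^+ 2 by rewrite exprn_gt0.
  by rewrite gtrN// -EFinB; congr EFin; rewrite opprK [RHS]mulr_natl mulr2n.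
apply: (@le_trans _ _ (((2 * r) ^+ N)%:E * (C * r ^+ m)%:E * (2 * r ^+ 2)%:E)%E).
  apply: lee_wpmul2r; first by rewrite lee_fin mulr_ge0// sqr_ge0.
  apply: lee_wpmul2l; first by rewrite lee_fin exprn_ge0// mulr_ge0// ltW.
  by rewrite /g -integral_mkcond; exact: HC.
rewrite -!EFinM lee_fin exprMn !exprD; apply: eq_ler; ring.
Qed.

Lemma L2_inQ_bounded r F c : mfun F -> 1 <= r ->
  (forall p, Q r p -> 0 < p.1.2 -> `|F p| <= c) ->
  L2 (fun p => inQ r p * F p).
Proof.
move=> mF r1 Fc; split; first by apply: mfunM => //; exact: mfun_inQ.
have [C [m [_ /(_ _ r1)[i _]]]] := wt_integral_Q.
apply: (intgb_dom _ _ (intgbZ (c ^+ 2) i)).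
  apply: mfunM; first exact: mfun_wt.
  by under eq_fun do rewrite expr2; apply: mfunM; apply: mfunM => //; exact: mfun_inQ.
move=> p; rewrite normrM (ger0_norm (wt_ge0 _ _ _)) mulrCA.
have [p0|p0] := ltP 0 p.1.2; last by rewrite /wt ltNge p0 /= !mul0r.
rewrite ler_wpM2l ?wt_ge0// inQE; case: asboolP => Qp.
  rewrite mul1r mulr1 ger0_norm ?sqr_ge0// -[X in X <= _]real_normK ?num_real//.
  by rewrite -[leRHS]real_normK ?num_real// lerXn2r ?nnegrE// (le_trans (Fc p _ _))// ler_norm.
by rewrite mul0r expr0n normr0 mulr0.
Qed.

Lemma nrm_inQ_bounded : exists C : R, exists m : nat, 0 <= C /\ forall r F c, 1 <= r ->
  mfun F -> 0 <= c ->
  {ae leb, forall p : ZT, Q r p -> 0 < p.1.2 -> `|F p| <= c} ->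
  L2 (fun p => inQ r p * F p) /\
  nrm eps a (fun p => inQ r p * F p) <= c ^+ 2 * (C * r ^+ m).
Proof.
have [C [m [C0 HC]]] := wt_integral_Q.
exists C, m; split=> // r F c r1 mF c0 Fc.
have [i iC] := HC r r1.
have mQF : mfun (fun p => inQ r p * F p) by apply: mfunM => //; exact: mfun_inQ.
have ci : intgb (fun p => c ^+ 2 * (w p * inQ r p)) by exact: intgbZ.
have E : {ae leb, forall p : ZT, w p * (inQ r p * F p) ^+ 2 <= c ^+ 2 * (w p * inQ r p)}.
  apply: (aeS Fc) => p H; rewrite [leRHS]mulrCA.
  have [p0|p0] := ltP 0 p.1.2; last by rewrite /wt ltNge p0 /= !mul0r.
  rewrite ler_wpM2l ?wt_ge0// inQE; case: asboolP => Qp; last first.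
    by rewrite mul0r expr0n mulr0.
  rewrite mul1r mulr1 -[X in X <= _]real_normK ?num_real//.
  by rewrite lerXn2r ?nnegrE// H.
have mw2 : mfun (fun p => w p * (inQ r p * F p) ^+ 2).
  by apply: mfunM; [exact: mfun_wt|exact: (mfunM mQF mQF)].
have ge0 p : 0 <= w p * (inQ r p * F p) ^+ 2 by rewrite mulr_ge0 ?wt_ge0// sqr_ge0.
have K : (\int[leb]_p (w p * (inQ r p * F p) ^+ 2)%:E <=
          \int[leb]_p (c ^+ 2 * (w p * inQ r p))%:E)%E.
  apply: ae_ge0_le_integral => //.
  - by move=> p _; rewrite lee_fin.
  - exact: mfun_EFin.
  - by move=> p _; rewrite lee_fin !mulr_ge0 ?sqr_ge0 ?wt_ge0// inQE; case: ifP.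
  - by apply: mfun_EFin; exact: intgb_mfun.
  by apply: (aeS E) => p H _; rewrite lee_fin.
have LF : L2 (fun p => inQ r p * F p).
  split => //; apply/integrableP; split; first exact: mfun_EFin.
  under eq_integral do rewrite /= ger0_norm//.
  apply: (le_lt_trans K); rewrite -EFin_J// ltry//.
split => //.
have -> : nrm eps a (fun p => inQ r p * F p) = J (fun p => w p * (inQ r p * F p) ^+ 2).
  by apply: eq_J => p; rewrite expr2.
rewrite -lee_fin EFin_J//; last by case: LF.
apply: (le_trans K); rewrite -EFin_J// JZ// lee_fin ler_wpM2l ?sqr_ge0//.
Qed.

End weighted_L2_bounded.

Section smooth_more.
Context {R : realType} {N : nat}.
Local Notation ZT := ('rV[R]_N * R * R)%type.
Implicit Types (F f : ZT -> R) (p v : ZT) (c r s : R).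

Lemma derive_dirZ f p v c : smooth f -> 'D_(c *: v) f p = c * 'D_v f p.
Proof.
move=> sf; have df := smooth_differentiable p sf.
by rewrite !deriveE// linearZ.
Qed.

Lemma smooth_lipschitz f v c s p : smooth f -> (forall p, `|'D_v f p| <= c) ->
  `|f (p + s *: v) - f p| <= c * `|s|.
Proof.
move=> sf Dc.
have D t := derive_fun_shift p v t sf.
have cont (i : interval R) : {within [set` i], continuous (fun t : R => f (p + t *: v))}.
  by apply: derivable_within_continuous => t _; have [] := D t.
have p0 : f p = f (p + (0 : R) *: v) by rewrite scale0r addr0.
have [s0|s0] := leP 0 s.
  have [t _ E] := MVT_segment s0 (fun t _ => D t) (cont _).
  by rewrite p0 E subr0 normrM ler_wpM2r.
have [t _ E] := MVT_segment (ltW s0) (fun t _ => D t) (cont _).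
by rewrite p0 distrC E sub0r normrM normrN ler_wpM2r.
Qed.

Lemma inQ_01 r p : inQ r p = 1 \/ inQ r p = 0.
Proof. by rewrite inQE; case: ifP; [left|right]. Qed.

Lemma inQ_supp r A B F p : supp_in A B F -> A < r ^+ 2 -> B < r ^+ 2 ->
  inQ r p * F p = F p.
Proof.
move=> suppF Ar Br; rewrite inQE; case: asboolP => [_|nQ]; first by rewrite mul1r.
rewrite mul0r; apply/esym/eqP; apply: contrapT => /negP /suppF[H1 H2]; apply: nQ.
split => /=; first exact: le_lt_trans Ar.
by rewrite /Itime/= in_itv/= -ltr_norml; exact: le_lt_trans Br.
Qed.

Lemma supp_in_test_L2 eps a F A B : 0 <= eps < 1 -> -1 < a -> smooth F ->
  supp_in A B F -> L2 eps a F.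
Proof.
move=> e01 a1 sF suppF.
have [c c0 Fc] := supp_in_bounded (smooth_continuous sF) suppF.
pose r : R := `|A| + `|B| + 1.
have r1 : 1 <= r by rewrite lerDr addr_ge0.
have rr : r <= r ^+ 2 by rewrite expr2 ler_peMr//; lra.
have AB : A < r ^+ 2 /\ B < r ^+ 2.
  have := ler_norm A; have := ler_norm B; have := normr_ge0 A; have := normr_ge0 B.
  by rewrite /r in rr *; split; lra.
have -> : F = fun p => inQ r p * F p.
  by apply/funext => p; rewrite (inQ_supp p suppF AB.1 AB.2).
apply: (@L2_inQ_bounded _ _ _ _ e01 a1 _ _ c) => //; exact: mfun_smooth.
Qed.

Lemma L2_inQ_smooth eps a F r : 0 <= eps < 1 -> -1 < a -> smooth F -> 1 <= r ->
  L2 eps a (fun p => inQ r p * F p).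
Proof.
move=> e01 a1 sF r1.
have [c c0 Fc] := cyl_bounded (r ^+ 2) (r ^+ 2) (smooth_continuous sF).
apply: (@L2_inQ_bounded _ _ _ _ e01 a1 _ _ c) => //; first exact: mfun_smooth.
move=> p [/= H1 H2] _; apply: Fc; split; first exact: ltW.
by move: H2; rewrite /Itime/= in_itv/= -ltr_norml; exact: ltW.
Qed.

Lemma supp_in_shift_t A B F s : supp_in A B F ->
  supp_in A (B + `|s|) (fun p => F (p + s *: et)).
Proof.
move=> sF p /sF[H1 H2]; split.
  move: H1; rewrite (_ : (p + s *: et).1 = p.1)//.
  rewrite /= (_ : s *: (0, 0) = 0) ?addr0//.
  by congr pair; rewrite ?scaler0.
have -> : p.2 = (p + s *: et).2 - s.
  by rewrite /= [s *: 1]mulr1 addrK.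
by apply: (le_trans (ler_normB _ _)); rewrite lerD2r.
Qed.

End smooth_more.

(** * Solutions on cylinders *)

Section local_solutions.
Context {R : realType} {N : nat} (eps a : R).
Hypotheses (eps01 : 0 <= eps < 1) (a_gtN1 : -1 < a).
Local Notation ZT := ('rV[R]_N * R * R)%type.
Local Notation w := (@wt R N eps a).
Local Notation L2 := (@L2 R N eps a).
Local Notation ip := (@ip R N eps a).
Local Notation nrm := (@nrm R N eps a).
Implicit Types (U F G H f phi psi : ZT -> R) (V : option 'I_N -> ZT -> R).
Implicit Types (p : ZT) (c r s tau d : R).

(** Membership in the completion, read on [Q r]: (U, V) is a limit of smooth functions with their
    gradients. The approximants are multiplied by [inQ r], so [U] and [V] vanish outside [Q r] as
    far as the norm can see. *)
Definition approx r U V : Prop := forall d, 0 < d -> exists phi, [/\ smooth phi,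
  nrm (fun p => inQ r p * phi p - U p) <= d &
  forall i, nrm (fun p => inQ r p * 'D_(dir i) phi p - V i p) <= d].

Definition weak r U V : Prop := forall psi A B, smooth psi -> supp_in A B psi ->
  A < r ^+ 2 -> B < r ^+ 2 ->
  ip U (fun p => 'D_et psi p) = \sum_i ip (V i) (fun p => 'D_(dir i) psi p).

Definition sol_at r U V : Prop :=
  [/\ L2 U, forall i, L2 (V i), approx r U V & weak r U V].

Lemma ip_small F d : L2 F -> 0 < d -> exists2 d', 0 < d' &
  forall G, L2 G -> nrm G <= d' -> `|ip F G| <= d.
Proof.
move=> LF d0; have F0 := nrm_ge0 eps a F.
pose c := d / (2 * (nrm F + 1)).
have F1 : 0 < nrm F + 1 by lra.
have c0 : 0 < c by rewrite divr_gt0// mulr_gt0.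
exists (c * (d / 2)); first by rewrite mulr_gt0// divr_gt0.
move=> G LG Gd; apply: (le_trans (ip_young c0 LF LG)).
have -> : d = d / 2 + d / 2 by field.
apply: lerD.
  have -> : c * nrm F = d / 2 * (nrm F / (nrm F + 1)).
    by rewrite /c; field; rewrite gt_eqF.
  by rewrite ler_piMr ?divr_ge0 ?(ltW d0)// ler_pdivrMr// mul1r; lra.
by rewrite mulrC ler_pdivrMr// [leRHS]mulrC.
Qed.

Lemma et_y s : (s *: (et : ZT)).1.2 = 0.
Proof. by rewrite /= scaler0. Qed.

Lemma mulet s c : s *: (c *: (et : ZT)) = (s * c) *: et.
Proof. by rewrite scalerA. Qed.

(** Continuity of time translations against a fixed [F], for limits [G] of smooth functions with a
    common support. The difference splits into pairings of [F] with [psi - G], with its translate,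
    and with the increment of [psi], each worth [d / 3]. *)
Lemma ip_translation_cont F G A B : L2 F -> L2 G ->
  (forall d, 0 < d -> exists psi, [/\ smooth psi, supp_in A B psi &
     nrm (fun p => psi p - G p) <= d]) ->
  forall d, 0 < d -> exists2 t, 0 < t & forall s, `|s| < t ->
    `|ip F (fun p => G (p + s *: et)) - ip F G| <= d.
Proof.
move=> LF LG HG d d0.
have d3 : 0 < d / 3 by rewrite divr_gt0.
have [d' d'0 Hd'] := ip_small LF d3.
have [psi [spsi suppsi psiG]] := HG d' d'0.
have Lpsi : L2 psi by exact: supp_in_test_L2 suppsi.
have LpG : L2 (fun p => psi p - G p) by exact: L2B.
have sDpsi : smooth (fun p => 'D_et psi p) by exact: smooth_derive.
have [c c0 Dc] := supp_in_bounded (smooth_continuous sDpsi) (supp_in_derive (v := et) suppsi).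
(* The radius leaves room for shifts with |s| < 1, which the entry 1 of [t] below enforces; [psi]
   and its shift then both vanish outside [Q r]. *)
pose r : R := `|A| + `|B| + 2.
have r1 : 1 <= r by have := normr_ge0 A; have := normr_ge0 B; rewrite /r; lra.
have rr : r <= r ^+ 2 by rewrite expr2 ler_peMr//; lra.
have rA : A < r ^+ 2 /\ B + 1 < r ^+ 2.
  have := ler_norm A; have := ler_norm B; have := normr_ge0 A; have := normr_ge0 B.
  by rewrite /r in rr *; split; lra.
have LQ : L2 (fun p => inQ r p * 1).
  by apply: L2_inQ_smooth => //; exact: smooth_cst.
pose M := nrm (fun p => inQ r p * 1).
have M0 : 0 <= M by exact: nrm_ge0.
(* The increment of [psi] is at most c |s| on [Q r], so its squared norm is at most c^2 M s^2 <= c^2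
   M |s|, which this [t] keeps below [d']. *)
pose t := Num.min 1 (d' / (c ^+ 2 * M + 1)).
have cM : 0 < c ^+ 2 * M + 1 by rewrite ltr_wpDl// mulr_ge0// sqr_ge0.
exists t; first by rewrite lt_min ltr01 divr_gt0.
move=> s; rewrite lt_min => /andP[s1 sd].
have h0 := et_y s.
have LGs : L2 (fun p => G (p + s *: et)) by exact: L2_shift.
have Lps : L2 (fun p => psi (p + s *: et)) by exact: L2_shift.
have E : ip F (fun p => G (p + s *: et)) - ip F G =
   (ip F (fun p => psi p - G p) - ip F (fun p => psi (p + s *: et) - G (p + s *: et)))
   + ip F (fun p => psi (p + s *: et) - psi p).
  by rewrite !ipBr//; ring.
rewrite E (_ : d = (d / 3 + d / 3) + d / 3); last by field.
apply: (le_trans (ler_normD _ _)); apply: lerD.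
  apply: (le_trans (ler_normB _ _)); apply: lerD; first exact: Hd'.
  apply: Hd'; first exact: L2B.
  by rewrite (nrm_shift (F := fun p => psi p - G p)).
apply: Hd'; first exact: L2B.
apply: (@le_trans _ _ (nrm (fun p => (c * `|s|) * (inQ r p * 1)))).
  apply: le_nrm; [exact: L2B|exact: L2Z|].
  move=> p _; rewrite mulr1.
  have H := smooth_lipschitz s p spsi Dc.
  have [->|nz] := eqVneq (inQ r p) 1; first by rewrite mulr1 (ger0_norm (mulr_ge0 c0 (normr_ge0 s))).
  have nQ : inQ r p = 0 by move: nz; rewrite inQE; case: ifP; rewrite ?eqxx.
  have -> : psi p = 0 by rewrite -(inQ_supp p suppsi rA.1) ?nQ ?mul0r//; lra.
  have -> : psi (p + s *: et) = 0.
    rewrite -(inQ_supp (r := r) p (supp_in_shift_t (s := s) suppsi)) ?nQ ?mul0r//; first exact: rA.1.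
    by have := rA.2; lra.
  by rewrite subrr normr0.
rewrite nrmZ//.
have sq : `|s| ^+ 2 <= `|s| by rewrite expr2 ler_piMr// ltW.
rewrite exprMn; apply: (@le_trans _ _ (c ^+ 2 * M * `|s|)).
  rewrite [leLHS](_ : _ = c ^+ 2 * M * `|s| ^+ 2); last by rewrite /M; ring.
  by rewrite ler_wpM2l// mulr_ge0// sqr_ge0.
move: sd; rewrite ltr_pdivlMr// => /ltW sd; apply: le_trans sd.
by rewrite mulrC ler_wpM2l// lerDl.
Qed.

(** The mean value theorem produces [tau] times the time derivative of a translate of [psi], and
    this translate is itself an admissible test function: the room [|tau|] in the support condition
    keeps it inside [Q r]. *)
Lemma weak_time_difference r U V psi A B tau : sol_at r U V -> 1 <= r ->
  smooth psi -> supp_in A B psi -> A < r ^+ 2 -> B + `|tau| < r ^+ 2 ->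
  exists2 s, 0 < s < 1 & ip U (fun p => psi (p + tau *: et) - psi p) =
    tau * \sum_i ip (V i) (fun p => 'D_(dir i) psi (p + (s * tau) *: et)).
Proof.
move=> [LU LV _ wUV] r1 spsi suppsi Ar Br.
have LQ : L2 (fun p => inQ r p * 1).
  by apply: L2_inQ_smooth => //; exact: smooth_cst.
pose theta p := w p * ((inQ r p * 1) * U p).
have ti : intgb theta by exact: L2_intgb.
have [c c0 psic] := supp_in_bounded (smooth_continuous spsi) suppsi.
have sD : smooth (fun p => 'D_(tau *: et) psi p) by exact: smooth_derive.
have [c' c'0 Dc] := supp_in_bounded (smooth_continuous sD) (supp_in_derive (v := tau *: et) suppsi).
have [||s s01 E] := @J_mean_value R N theta psi (tau *: et) (Num.max c c') ti spsi.
- by move=> p s _ _; rewrite le_max psic.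
- by move=> p s _ _; rewrite le_max Dc orbT.
exists s => //.
have B0 : B < r ^+ 2 by have := normr_ge0 tau; lra.
have ps0 p : inQ r p * psi p = psi p by exact: inQ_supp suppsi Ar B0.
have psT p t : `|t| <= `|tau| -> forall f, supp_in A B f ->
    inQ r p * f (p + t *: et) = f (p + t *: et).
  move=> tt f sf; apply: (inQ_supp (F := fun p => f (p + t *: et)) p (supp_in_shift_t (s := t) sf)) => //.
  by lra.
have st : `|s * tau| <= `|tau|.
  by rewrite normrM ler_piMl// norm_unit_le1.
have -> : ip U (fun p => psi (p + tau *: et) - psi p) =
    J (fun p => theta p * (psi (p + tau *: et) - psi p)).
  apply: eq_J => p; rewrite /theta; have [q1|q0] := inQ_01 r p.
    by rewrite q1; ring.
  have -> : psi p = 0 by rewrite -(ps0 p) q0 mul0r.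
  have -> : psi (p + tau *: et) = 0 by rewrite -(psT p tau _ psi)// q0 mul0r.
  by ring.
rewrite E.
pose psis p := psi (p + (s * tau) *: et).
have spsis : smooth psis by exact: smooth_shift.
have supps : supp_in A (B + `|s * tau|) psis by exact: supp_in_shift_t.
have -> : J (fun p => theta p * 'D_(tau *: et) psi (p + s *: (tau *: et))) =
    tau * ip U (fun p => 'D_et psis p).
  rewrite -ipZr//; last first.
    apply: (supp_in_test_L2 (A := A) (B := B + `|s * tau|)) => //.
      exact: smooth_derive.
    exact: supp_in_derive.
  apply: eq_J => p; rewrite mulet derive_dirZ// derive_shiftp.
  rewrite /theta; have [q1|q0] := inQ_01 r p; first by rewrite q1; ring.
  have -> : 'D_et psi (p + (s * tau) *: et) = 0.
    by rewrite -(psT p _ st _ (supp_in_derive (v := et) suppsi)) q0 mul0r.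
  by ring.
have supB : B + `|s * tau| < r ^+ 2 by lra.
have key : \sum_i ip (V i) (fun p => 'D_(dir i) psis p) =
    \sum_i ip (V i) (fun p => 'D_(dir i) psi (p + (s * tau) *: et)).
  by apply: eq_bigr => i _; apply: eq_ip => p _; rewrite /psis derive_shiftp.
have H := etrans (wUV _ _ _ spsis supps Ar supB) key.
clear -H.
by rewrite H.
Qed.

End local_solutions.

Section finite_choice.
Context {R : realType} (I : finType).

Lemma fin_min (P : I -> R -> Prop) :
  (forall i s t, s <= t -> P i t -> P i s) ->
  (forall i, exists2 t : R, 0 < t & P i t) -> exists2 t : R, 0 < t & forall i, P i t.
Proof.
move=> Pm /(_ _)/cid2-/all_sig2[f f0 Pf].
have S0 : 0 <= \sum_i (f i)^-1 by apply: sumr_ge0 => i _; rewrite invr_ge0 ltW// f0.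
(* Its inverse exceeds every [(f i)^-1], and the 1 covers the empty index type. *)
exists (\sum_i (f i)^-1 + 1)^-1; first by rewrite invr_gt0; lra.
move=> i; apply: Pm (Pf i).
rewrite invf_ple ?posrE ?f0//; last by lra.
rewrite (bigD1 i)//= -addrA lerDl addr_ge0//.
by apply: sumr_ge0 => j _; rewrite invr_ge0 ltW// f0.
Qed.

End finite_choice.

(** * Caccioppoli inequality *)

Section caccioppoli.
Context {R : realType} {N : nat} (eps a : R).
Hypotheses (eps01 : 0 <= eps < 1) (a_gtN1 : -1 < a).
Local Notation ZT := ('rV[R]_N * R * R)%type.
Local Notation L2 := (@L2 R N eps a).
Local Notation ip := (@ip R N eps a).
Local Notation nrm := (@nrm R N eps a).
Implicit Types (U F H f g phi : ZT -> R) (V : option 'I_N -> ZT -> R).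
Implicit Types (p v : ZT) (c r tau d : R).

(** The square matters: its derivative carries a factor [cutoff r], which pairs with
    [cutoff r * V i] and makes the cross term absorbable. *)
Definition cutsq r p : R := cutoff r p * cutoff r p.

Lemma smooth_cutsq r : smooth (@cutsq r).
Proof. by apply: smoothM; exact: smooth_cutoff. Qed.

Lemma cutsq_ge0 r p : 0 <= cutsq r p.
Proof. by rewrite mulr_ge0 ?cutoff_ge0. Qed.

Lemma cutsq_le1 r p : cutsq r p <= 1.
Proof. by rewrite mulr_ile1 ?cutoff_ge0 ?cutoff_le1. Qed.

Lemma norm_cutsq r p : `|cutsq r p| <= 1.
Proof. by rewrite ger0_norm ?cutsq_ge0 ?cutsq_le1. Qed.

Lemma norm_cutoff r p : `|cutoff r p| <= 1.
Proof. by rewrite ger0_norm ?cutoff_ge0 ?cutoff_le1. Qed.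

Lemma derive_cutsq r p v : 'D_v (cutsq r) p = 2 * cutoff r p * 'D_v (cutoff r) p.
Proof. by rewrite derive_smoothM ?mulr2n; [ring|exact: smooth_cutoff..]. Qed.

Lemma norm_derive_cutsq r p v c : `|'D_v (cutoff r) p| <= c ->
  `|'D_v (cutsq r) p| <= 2 * c.
Proof.
move=> Dc; rewrite derive_cutsq 2!normrM ger0_norm// -mulrA ler_wpM2l//.
by apply: le_trans Dc; rewrite ler_piMl// norm_cutoff.
Qed.

Lemma supp_cutsq r : 0 < r -> supp_in (4 * r ^+ 2) (2 * r ^+ 2) (@cutsq r).
Proof. by move=> r0; apply: supp_inMl; exact: supp_in_cutoff. Qed.

Lemma cutsqM_smooth r phi : smooth phi -> smooth (fun p => cutsq r p * phi p).
Proof. by move=> sphi; apply: smoothM => //; exact: smooth_cutsq. Qed.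

Lemma derive_cutsqM r phi p v : smooth phi ->
  'D_v (fun p => cutsq r p * phi p) p =
  cutsq r p * 'D_v phi p + 'D_v (cutsq r) p * phi p.
Proof. by move=> sphi; rewrite derive_smoothM//; [ring|exact: smooth_cutsq]. Qed.

Lemma L2_cutsqM r F : L2 F -> L2 (fun p => cutsq r p * F p).
Proof.
move=> LF; apply: (@L2_bM _ _ _ _ _ _ 1) => //.
  by apply: mfun_smooth; exact: smooth_cutsq.
by move=> p _; exact: norm_cutsq.
Qed.

Lemma mfun_derive f v : smooth f -> mfun (fun p => 'D_v f p).
Proof. by move=> sf; apply: mfun_smooth; exact: smooth_derive. Qed.

Lemma L2_dcutsqM r i F : 0 < r -> L2 F -> L2 (fun p => 'D_(dir i) (cutsq r) p * F p).
Proof.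
move=> r0 LF; apply: (@L2_bM _ _ _ _ _ _ (2 * (8 / r))) => //.
  by apply: mfun_derive; exact: smooth_cutsq.
by move=> p _; exact/norm_derive_cutsq/derive_cutoff_dir.
Qed.

Lemma nrm_bM g F c : mfun g -> (forall p, 0 < p.1.2 -> `|g p| <= c) -> L2 F ->
  nrm (fun p => g p * F p) <= c ^+ 2 * nrm F.
Proof.
move=> mg gc LF; rewrite -nrmZ//; apply: le_nrm => //.
- exact: L2_bM mg gc LF.
- exact: L2Z.
move=> p p0; rewrite !normrM ler_wpM2r// (le_trans (gc p p0))//; exact: ler_norm.
Qed.

(** The factor 3 comes from the support of the cut-off, where |z|^2 <= 4 r^2 and |t| <= 2 r^2, both
    strictly below (3 r)^2. *)
Lemma cutsq_inQ r r' p : 0 < r -> 3 * r <= r' -> cutsq r p * inQ r' p = cutsq r p.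
Proof.
move=> r0 rr; rewrite mulrC (inQ_supp p (supp_cutsq r0))//.
  by apply: (@lt_le_trans _ _ ((3 * r) ^+ 2)); [|rewrite lerXn2r ?nnegrE//]; nra.
by apply: (@lt_le_trans _ _ ((3 * r) ^+ 2)); [|rewrite lerXn2r ?nnegrE//]; nra.
Qed.

Lemma dcutsq_inQ r r' p i : 0 < r -> 3 * r <= r' ->
  'D_(dir i) (cutsq r) p * inQ r' p = 'D_(dir i) (cutsq r) p.
Proof.
move=> r0 rr; rewrite mulrC (inQ_supp p (supp_in_derive (v := dir i) (supp_cutsq r0)))//.
  by apply: (@lt_le_trans _ _ ((3 * r) ^+ 2)); [|rewrite lerXn2r ?nnegrE//]; nra.
by apply: (@lt_le_trans _ _ ((3 * r) ^+ 2)); [|rewrite lerXn2r ?nnegrE//]; nra.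
Qed.

(* [localized U V i] is the [i]-th derivative of [cutsq r * U] when [V] is the
   gradient of [U]. *)
Definition localized r U V i p : R :=
  cutsq r p * V i p + 'D_(dir i) (cutsq r) p * U p.

Lemma L2_localized r U V i : 0 < r -> L2 U -> L2 (V i) -> L2 (localized r U V i).
Proof. by move=> r0 LU LV; apply: L2D; [exact: L2_cutsqM|exact: L2_dcutsqM]. Qed.

(** Approximants of [U] multiplied by [cutsq r] have gradients close to [localized]. The constant is
    that of [nrmD_le], with |cutsq| <= 1 and the bound 16 / r for its space derivatives. *)
Lemma nrm_localized r r' U V phi d i : 1 <= r -> 3 * r <= r' -> smooth phi ->
  L2 U -> L2 (V i) ->
  nrm (fun p => inQ r' p * phi p - U p) <= d ->
  nrm (fun p => inQ r' p * 'D_(dir i) phi p - V i p) <= d ->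
  nrm (fun p => 'D_(dir i) (fun p => cutsq r p * phi p) p - localized r U V i p) <=
    (2 + 2 * (16 / r) ^+ 2) * d.
Proof.
move=> r1 rr sphi LU LV H1 H2; have r0 : 0 < r by lra.
have r'1 : 1 <= r' by lra.
have L1 : L2 (fun p => inQ r' p * phi p - U p).
  by apply: L2B => //; exact: L2_inQ_smooth.
have L2' : L2 (fun p => inQ r' p * 'D_(dir i) phi p - V i p).
  by apply: L2B => //; apply: L2_inQ_smooth => //; exact: smooth_derive.
have E p : 'D_(dir i) (fun p => cutsq r p * phi p) p - localized r U V i p =
    cutsq r p * (inQ r' p * 'D_(dir i) phi p - V i p) +
    'D_(dir i) (cutsq r) p * (inQ r' p * phi p - U p).
  rewrite derive_cutsqM// /localized -{1}(cutsq_inQ p r0 rr) -{1}(dcutsq_inQ p i r0 rr).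
  by ring.
rewrite (_ : (fun p => _) = fun p =>
    cutsq r p * (inQ r' p * 'D_(dir i) phi p - V i p) +
    'D_(dir i) (cutsq r) p * (inQ r' p * phi p - U p)); last exact/funext.
apply: (le_trans (nrmD_le _ _)); [exact: L2_cutsqM|exact: L2_dcutsqM|].
rewrite [leRHS]mulrDl; apply: lerD.
  rewrite ler_wpM2l//; apply: le_trans H2.
  apply: (le_trans (@nrm_bM _ _ 1 _ _ L2')).
  - by apply: mfun_smooth; exact: smooth_cutsq.
  - by move=> p _; exact: norm_cutsq.
  - by rewrite expr1n mul1r.
rewrite -mulrA ler_wpM2l//.
apply: (le_trans (@nrm_bM _ _ (2 * (8 / r)) _ _ L1)).
- by apply: mfun_derive; exact: smooth_cutsq.
- by move=> p _; exact/norm_derive_cutsq/derive_cutoff_dir.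
- have -> : 2 * (8 / r) = 16 / r by ring.
  by rewrite ler_wpM2l// sqr_ge0.
Qed.

Lemma nrm_cutsq_approx r r' U phi d : 1 <= r -> 3 * r <= r' -> smooth phi -> L2 U ->
  nrm (fun p => inQ r' p * phi p - U p) <= d ->
  nrm (fun p => cutsq r p * phi p - cutsq r p * U p) <= d.
Proof.
move=> r1 rr sphi LU H1; have r0 : 0 < r by lra.
have r'1 : 1 <= r' by lra.
have L1 : L2 (fun p => inQ r' p * phi p - U p).
  by apply: L2B => //; exact: L2_inQ_smooth.
have E p : cutsq r p * phi p - cutsq r p * U p = cutsq r p * (inQ r' p * phi p - U p).
  by rewrite -{1}(cutsq_inQ p r0 rr); ring.
rewrite (_ : (fun p => _) = fun p => cutsq r p * (inQ r' p * phi p - U p)); last exact/funext.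
apply: le_trans H1; apply: (le_trans (@nrm_bM _ _ 1 _ _ L1)).
- by apply: mfun_smooth; exact: smooth_cutsq.
- by move=> p _; exact: norm_cutsq.
- by rewrite expr1n mul1r.
Qed.

(** Moving the backward shift onto the other factor turns both terms into integrals of U U(. + tau),
    one with the weight [cutsq r] and one with its translate. Only the increment of [cutsq r]
    survives, of size 16 tau / r^2, and no time derivative of [U] appears. Young's inequality with
    [c] equal to that size doubles it to 32. *)
Lemma time_boundary_term r U tau : 1 <= r -> L2 U -> 0 < tau ->
  `|ip U (fun p => cutsq r (p + tau *: et) * U (p + tau *: et) -
             cutsq r (p - tau *: et) * U (p - tau *: et))|
  <= 32 / r ^+ 2 * tau * nrm U.
Proof.
move=> r1 LU tau0; have r0 : 0 < r by lra.
have h0 : (tau *: (et : ZT)).1.2 = 0 by exact: et_y.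
have h0' : (- (tau *: (et : ZT))).1.2 = 0 by rewrite /= scaler0 oppr0.
have LG : L2 (fun p => cutsq r p * U p) by exact: L2_cutsqM.
have LUt : L2 (fun p => U (p + tau *: et)) by exact: L2_shift.
have LGp : L2 (fun p => cutsq r (p + tau *: et) * U (p + tau *: et)).
  exact: (L2_shift (F := fun p => cutsq r p * U p)).
have LGm : L2 (fun p => cutsq r (p - tau *: et) * U (p - tau *: et)).
  exact: (L2_shift (F := fun p => cutsq r p * U p)).
have LcU : L2 (fun p => cutsq r p * U (p + tau *: et)) by exact: L2_cutsqM.
have E : ip U (fun p => cutsq r (p + tau *: et) * U (p + tau *: et) -
             cutsq r (p - tau *: et) * U (p - tau *: et)) =
    ip U (fun p => (cutsq r (p + tau *: et) - cutsq r p) * U (p + tau *: et)).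
  rewrite ipBr//.
  rewrite (ip_shiftr (G := fun p => cutsq r p * U p) h0')//.
  have -> : ip (fun p => U (p - - (tau *: et))) (fun p => cutsq r p * U p) =
      ip U (fun p => cutsq r p * U (p + tau *: et)).
    by apply: eq_ip => p _; rewrite opprK; ring.
  rewrite -ipBr//; apply: eq_ip => p _; ring.
rewrite E.
pose L := 16 / r ^+ 2.
have L0 : 0 < L by rewrite divr_gt0// exprn_gt0.
have Lt0 : 0 < L * tau by rewrite mulr_gt0.
have md : mfun (fun p => cutsq r (p + tau *: et) - cutsq r p).
  apply: mfun_smooth; apply: smoothB; last exact: smooth_cutsq.
  by apply: smooth_shift; exact: smooth_cutsq.
have bd p : `|cutsq r (p + tau *: et) - cutsq r p| <= L * tau.
  rewrite -[X in _ <= _ * X](gtr0_norm tau0).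
  apply: smooth_lipschitz; first exact: smooth_cutsq.
  move=> q; rewrite /L (_ : 16 / r ^+ 2 = 2 * (8 / r ^+ 2)); last by ring.
  exact/norm_derive_cutsq/derive_cutoff_t.
have LH : L2 (fun p => (cutsq r (p + tau *: et) - cutsq r p) * U (p + tau *: et)).
  by apply: L2_bM LUt => //.
apply: (le_trans (ip_young Lt0 LU LH)).
have H : nrm (fun p => (cutsq r (p + tau *: et) - cutsq r p) * U (p + tau *: et)) <=
    (L * tau) ^+ 2 * nrm U.
  by rewrite -(nrm_shift h0 LU); apply: nrm_bM.
apply: (@le_trans _ _ (L * tau * nrm U + (L * tau)^-1 * ((L * tau) ^+ 2 * nrm U))).
  by rewrite lerD2l ler_wpM2l// invr_ge0 ltW.
apply: eq_ler; rewrite /L.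
by field; rewrite !gt_eqF.
Qed.

End caccioppoli.

Section caccioppoli_inequality.
Context {R : realType} {N : nat} (eps a : R).
Hypotheses (eps01 : 0 <= eps < 1) (a_gtN1 : -1 < a).
Local Notation ZT := ('rV[R]_N * R * R)%type.
Local Notation L2 := (@L2 R N eps a).
Local Notation ip := (@ip R N eps a).
Local Notation nrm := (@nrm R N eps a).
Local Notation sol_at := (@sol_at R N eps a).
Implicit Types (U F phi psi : ZT -> R) (V : option 'I_N -> ZT -> R).
Implicit Types (p v : ZT) (r s tau d : R).

Lemma L2_cutsq_smooth r phi : 0 < r -> smooth phi ->
  L2 (fun p => cutsq r p * phi p) /\
  forall v, L2 (fun p => 'D_v (fun p => cutsq r p * phi p) p).
Proof.
move=> r0 sphi; have s1 := cutsqM_smooth r sphi.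
have supp := supp_inMl (g := phi) (@supp_cutsq R N r r0).
split; first exact: supp_in_test_L2 supp.
move=> v; apply: (supp_in_test_L2 eps01 a_gtN1 _ (supp_in_derive (v := v) supp)).
exact: smooth_derive.
Qed.

Lemma norm_chain (x y z d : R) : `|x - y| <= d -> `|z - x| <= d -> y <= z + 2 * d.
Proof. by rewrite !ler_norml => /andP[? ?] /andP[? ?]; lra. Qed.

Lemma quarter_le (x e : R) : x <= e / 4 -> 2 * x + 2 * x <= e.
Proof. by lra. Qed.

Lemma energy_arith (S X K q tau d : R) :
  `|X| <= 2 * q * tau * K + 2 * tau * d -> X = 2 * tau * S -> 0 < tau ->
  S <= q * K + d.
Proof.
move=> H E t0; have tt0 : 0 < 2 * tau by rewrite mulr_gt0.
rewrite -(ler_pM2l tt0) -E; apply: (le_trans (ler_norm _)); apply: (le_trans H).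
by apply: eq_ler; ring.
Qed.

Lemma ler_sum_const (I : finType) (x y : I -> R) (c : R) :
  (forall i, x i <= y i + c) -> \sum_i x i <= \sum_i y i + #|I|%:R * c.
Proof.
move=> H; apply: (@le_trans _ _ (\sum_i (y i + c))); first by apply: ler_sum.
by rewrite big_split/= lerD2l sumr_const [leRHS]mulr_natl.
Qed.

(** A discrete form of testing the equation with [cutsq r * U]. The test function is a symmetric
    time difference of [cutsq r * phi], with [phi] an approximant of [U]. The time term is bounded
    by [time_boundary_term]; after division by 2 tau the gradient term is close to the left-hand
    side, by continuity of translations. *)
Lemma energy_le r r' U V : sol_at r' U V -> 1 <= r -> 3 * r <= r' ->
  \sum_i ip (V i) (localized r U V i) <= 16 / r ^+ 2 * nrm U.
Proof.
move=> sUV r1 rr; have r0 : 0 < r by lra.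
have r'1 : 1 <= r' by lra.
have [LU LV aUV wUV] := sUV.
have LG i : L2 (localized r U V i) by exact: L2_localized.
have K0 : 0 < 2 + 2 * (16 / r) ^+ 2 by rewrite ltr_wpDr// mulr_ge0// sqr_ge0.
have rr2 : 9 * r ^+ 2 <= r' ^+ 2.
  by apply: (@le_trans _ _ ((3 * r) ^+ 2)); [|rewrite lerXn2r ?nnegrE//]; nra.
have r2 : 1 <= r ^+ 2 by rewrite expr_ge1// ltW.
apply/ler_addgt0Pr => d d0.
set n := #|{: option 'I_N}|.
(* The total error is [d1] from the time term and [2 * d1] from each of the [n] gradient
   components. *)
pose d1 := d / (2 * n%:R + 1).
have n0 : 0 < 2 * n%:R + 1 :> R by rewrite ltr_wpDl// mulr_ge0.
have d10 : 0 < d1 by rewrite divr_gt0.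
have [t t0 Ht] : exists2 t, 0 < t & forall i s, `|s| < t ->
    `|ip (V i) (fun p => localized r U V i (p + s *: et)) -
      ip (V i) (localized r U V i)| <= d1.
  apply: (@fin_min R _ (fun i t => forall s, `|s| < t -> _)).
    by move=> i s t st H s' s's; apply: H; exact: lt_le_trans st.
  move=> i; apply: (@ip_translation_cont _ _ _ _ eps01 a_gtN1 _ _ (4 * r ^+ 2) (2 * r ^+ 2)) => //.
  move=> e e0.
  have [phi [sphi H1 H2]] := aUV (e / (2 + 2 * (16 / r) ^+ 2)) (divr_gt0 e0 K0).
  exists (fun p => 'D_(dir i) (fun p => cutsq r p * phi p) p); split.
  - by apply: smooth_derive; exact: cutsqM_smooth.
  - by apply: supp_in_derive; apply: supp_inMl; exact: supp_cutsq.
  have := nrm_localized eps01 a_gtN1 r1 rr sphi LU (LV i) H1 (H2 i).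
  by rewrite mulrCA divff ?mulr1// gt_eqF.
pose tau := Num.min t 1 / 2.
have m0 : 0 < Num.min t 1 by rewrite lt_min t0 ltr01.
have mt : Num.min t 1 <= t /\ Num.min t 1 <= 1 by rewrite !ge_min !lexx orbT.
have tau0 : 0 < tau by rewrite divr_gt0.
have taut : tau < t by rewrite /tau; case: mt; lra.
have tau1 : tau <= 2^-1 by rewrite /tau; case: mt; lra.
have td0 : 0 < 2 * tau * d1 by rewrite !mulr_gt0.
(* The error of the time term will be divided by 2 tau: [tau] is fixed before the approximant, and
   the tolerance [e1] is chosen relative to it. *)
have [e1 e10 He1] := ip_small LU td0.
have [e2 e20 He2] : exists2 e, 0 < e & forall i F, L2 F -> nrm F <= e -> `|ip (V i) F| <= d1.
  apply: (@fin_min R _ (fun i e => forall F, L2 F -> nrm F <= e -> _)).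
    by move=> i s s' ss H F LF Fs; apply: H => //; exact: le_trans ss.
  by move=> i; have [e e0 He] := ip_small (LV i) d10; exists e.
pose e := Num.min (e1 / 4) (e2 / (2 + 2 * (16 / r) ^+ 2)).
have e0 : 0 < e by rewrite lt_min !divr_gt0.
have [phi [sphi H1 H2]] := aUV e e0.
pose psi p := cutsq r p * phi p.
have spsi : smooth psi by exact: cutsqM_smooth.
have supp : supp_in (4 * r ^+ 2) (2 * r ^+ 2) psi by apply: supp_inMl; exact: supp_cutsq.
have [Lpsi LDpsi] := L2_cutsq_smooth r0 sphi.
have LcU : L2 (fun p => cutsq r p * U p) by exact: L2_cutsqM.
have Ldiff : L2 (fun p => psi p - cutsq r p * U p) by exact: L2B.
have ndiff : nrm (fun p => psi p - cutsq r p * U p) <= e1 / 4.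
  apply: (le_trans (nrm_cutsq_approx eps01 a_gtN1 r1 rr sphi LU H1)).
  by rewrite ge_min lexx.
have hp : (tau *: (et : ZT)).1.2 = 0 by exact: et_y.
have hm : (- (tau *: (et : ZT))).1.2 = 0 by rewrite /= scaler0 oppr0.
pose psim p := psi (p - tau *: et).
have spsim : smooth psim by exact: smooth_shift.
have suppm : supp_in (4 * r ^+ 2) (2 * r ^+ 2 + tau) psim.
  have := supp_in_shift_t (s := - tau) supp.
  by rewrite normrN (gtr0_norm tau0); under eq_fun do rewrite scaleNr.
have A1 : 4 * r ^+ 2 < r' ^+ 2 by clear -rr2 r2; lra.
have A2 : 2 * r ^+ 2 + tau + `|2 * tau| < r' ^+ 2.
  by clear -rr2 r2 tau1 tau0; rewrite ger0_norm; lra.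
have [s s01 E] := weak_time_difference eps01 a_gtN1 sUV r'1 spsim suppm A1 A2.
(* The increment 2 tau starts from the translate by -tau, so the intermediate shift lies between
   -tau and tau, where the continuity of translations applies. *)
pose sg := s * (2 * tau) - tau.
have sgt : `|sg| < t.
  case/andP: s01 => s0 s1; clear -s0 s1 tau0 taut.
  by rewrite ltr_norml /sg; apply/andP; split; nra.
have E1 : ip U (fun p => psi (p + tau *: et) - psi (p - tau *: et)) =
    2 * tau * \sum_i ip (V i) (fun p => 'D_(dir i) psi (p + sg *: et)).
  have <- : ip U (fun p => psim (p + (2 * tau) *: et) - psim p) =
      ip U (fun p => psi (p + tau *: et) - psi (p - tau *: et)).
    apply: eq_ip => p _; rewrite /psim; congr (_ * (psi _ - _)).
    by rewrite -addrA -scalerBl; congr (_ + _ *: _); ring.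
  have key : \sum_i ip (V i) (fun p => 'D_(dir i) psim (p + (s * (2 * tau)) *: et)) =
      \sum_i ip (V i) (fun p => 'D_(dir i) psi (p + sg *: et)).
    apply: eq_bigr => i _; apply: eq_ip => p _; rewrite derive_shiftp.
    by rewrite -addrA -scalerBl.
  exact: (etrans E (congr1 (fun x => 2 * tau * x) key)).
have B1 : `|ip U (fun p => psi (p + tau *: et) - psi (p - tau *: et))| <=
    2 * (16 / r ^+ 2) * tau * nrm U + 2 * tau * d1.
  have -> : ip U (fun p => psi (p + tau *: et) - psi (p - tau *: et)) =
    ip U (fun p => cutsq r (p + tau *: et) * U (p + tau *: et) -
             cutsq r (p - tau *: et) * U (p - tau *: et)) +
    ip U (fun p => (psi (p + tau *: et) - cutsq r (p + tau *: et) * U (p + tau *: et))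
       - (psi (p - tau *: et) - cutsq r (p - tau *: et) * U (p - tau *: et))).
    rewrite -ipDr//; first by apply: eq_ip => p _; ring.
      by apply: L2B; exact: (L2_shift (F := fun p => cutsq r p * U p)).
    by apply: L2B; exact: (L2_shift (F := fun p => psi p - cutsq r p * U p)).
  apply: (le_trans (ler_normD _ _)); apply: lerD.
    apply: (le_trans (time_boundary_term r1 LU tau0)).
    by apply: eq_ler; ring.
  apply: He1.
    by apply: L2B; exact: (L2_shift (F := fun p => psi p - cutsq r p * U p)).
  apply: (le_trans (nrmB_le _ _)).
  - exact: (L2_shift (F := fun p => psi p - cutsq r p * U p)).
  - exact: (L2_shift (F := fun p => psi p - cutsq r p * U p)).
  have P1 := nrm_shift hp Ldiff; have P2 := nrm_shift hm Ldiff.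
  cbv beta in P1, P2; rewrite P1 P2.
  exact: quarter_le.
have B2 i : ip (V i) (localized r U V i) <=
    ip (V i) (fun p => 'D_(dir i) psi (p + sg *: et)) + 2 * d1.
  have h0 : (sg *: (et : ZT)).1.2 = 0 by exact: et_y.
  have T1 := Ht i sg sgt.
  have LD : L2 (fun p => 'D_(dir i) psi p - localized r U V i p) by exact: L2B.
  have T2 : `|ip (V i) (fun p => 'D_(dir i) psi (p + sg *: et) -
      localized r U V i (p + sg *: et))| <= d1.
    apply: He2; first exact: (L2_shift (F := fun p => 'D_(dir i) psi p - localized r U V i p)).
    rewrite (nrm_shift (F := fun p => 'D_(dir i) psi p - localized r U V i p))//.
    apply: (le_trans (nrm_localized eps01 a_gtN1 r1 rr sphi LU (LV i) H1 (H2 i))).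
    have : e <= e2 / (2 + 2 * (16 / r) ^+ 2) by rewrite ge_min lexx orbT.
    by rewrite ler_pdivlMr// mulrC.
  rewrite ipBr// in T2; last 2 first.
  - exact: (L2_shift (F := fun p => 'D_(dir i) psi p)).
  - exact: L2_shift.
  exact: (norm_chain T1 T2).
have B3 := energy_arith B1 E1 tau0.
have B4 := ler_sum_const B2.
apply: (le_trans B4); apply: (le_trans (lerD B3 (lexx _))).
have -> : d = (2 * n%:R + 1) * d1 by rewrite /d1 mulrCA divff ?mulr1// gt_eqF.
by rewrite -addrA lerD2l -/n; apply: eq_ler; ring.
Qed.

(** The 16 is that of [energy_le]. The 512 is half of 1024 = 16 * 64, the price per component in
    [caccioppoli], where 64 / r^2 is the square of the bound 8 / r for the space derivatives of the
    cut-off. *)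
Definition ccac : R := 2 * (16 + 512 * #|{: option 'I_N}|%:R).

Lemma ccac_ge0 : 0 <= ccac.
Proof.
apply: mulr_ge0; first exact: ler0n.
apply: addr_ge0; first exact: ler0n.
apply: mulr_ge0; exact: ler0n.
Qed.

Lemma L2_cutoffM r F : L2 F -> L2 (fun p => cutoff r p * F p).
Proof.
move=> LF; apply: (@L2_bM _ _ _ _ _ _ 1) => //.
  by apply: mfun_smooth; exact: smooth_cutoff.
by move=> p _; exact: norm_cutoff.
Qed.

(** The pairing of [V i] with [localized] is the norm of [cutoff r * V i] plus a cross term with U
    times the derivative of the cut-off; Young's inequality with constant 1/4 absorbs half of that
    norm. *)
Lemma caccioppoli r r' U V : sol_at r' U V -> 1 <= r -> 3 * r <= r' ->
  \sum_i nrm (fun p => cutoff r p * V i p) <= ccac / r ^+ 2 * nrm U.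
Proof.
move=> sUV r1 rr; have r0 : 0 < r by lra.
have [LU LV _ _] := sUV.
have r2 : 0 < r ^+ 2 by rewrite exprn_gt0.
have key i : nrm (fun p => cutoff r p * V i p) <=
    2 * ip (V i) (localized r U V i) + 1024 / r ^+ 2 * nrm U.
  have LcV : L2 (fun p => cutoff r p * V i p) by exact: L2_cutoffM.
  have LdU : L2 (fun p => 'D_(dir i) (cutoff r) p * U p).
    apply: (@L2_bM _ _ _ _ _ _ (8 / r)) => //.
      by apply: mfun_derive; exact: smooth_cutoff.
    by move=> p _; exact: derive_cutoff_dir.
  have -> : ip (V i) (localized r U V i) = nrm (fun p => cutoff r p * V i p) +
      2 * ip (fun p => cutoff r p * V i p) (fun p => 'D_(dir i) (cutoff r) p * U p).
    rewrite ipDr//; [|exact: L2_cutsqM|exact: L2_dcutsqM]; congr (_ + _).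
      by apply: eq_ip => p _; rewrite /cutsq; ring.
    by rewrite -(ipZl 2 LcV LdU); apply: eq_ip => p _; rewrite derive_cutsq; ring.
  have q0 : 0 < 4^-1 :> R by rewrite invr_gt0.
  have := ip_young q0 LcV LdU; rewrite invrK ler_norml => /andP[H _].
  have H2 : nrm (fun p => 'D_(dir i) (cutoff r) p * U p) <= 64 / r ^+ 2 * nrm U.
    apply: (le_trans (@nrm_bM _ _ _ _ _ _ (8 / r) _ _ LU)).
    - by apply: mfun_derive; exact: smooth_cutoff.
    - by move=> p _; exact: derive_cutoff_dir.
    - by apply: eq_ler; field; rewrite gt_eqF.
  have H0 := nrm_ge0 eps a U.
  have -> : 1024 / r ^+ 2 * nrm U = 16 * (64 / r ^+ 2 * nrm U) by ring.
  lra.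
apply: (le_trans (ler_sum_const key)); rewrite -mulr_sumr.
have := energy_le sUV r1 rr.
have -> : ccac / r ^+ 2 * nrm U = 2 * (16 / r ^+ 2 * nrm U) +
    #|{: option 'I_N}|%:R * (1024 / r ^+ 2 * nrm U) by rewrite /ccac; ring.
by rewrite lerD2r ler_pM2l.
Qed.

End caccioppoli_inequality.

(** * Tangential differences *)

Section difference_estimates.
Context {R : realType} {N : nat} (eps a : R).
Hypotheses (eps01 : 0 <= eps < 1) (a_gtN1 : -1 < a).
Local Notation ZT := ('rV[R]_N * R * R)%type.
Local Notation L2 := (@L2 R N eps a).
Local Notation nrm := (@nrm R N eps a).
Local Notation sol_at := (@sol_at R N eps a).
Local Notation ccac := (@ccac R N).
Local Notation b := (@bump R 0 2).
Implicit Types (U F G f : ZT -> R) (V : option 'I_N -> ZT -> R).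
Implicit Types (p h v : ZT) (r tau d : R).

Definition diff h F p : R := F (p + h) - F p.

Lemma L2_diff h F : h.1.2 = 0 -> L2 F -> L2 (diff h F).
Proof. by move=> h0 LF; apply: L2B => //; exact: L2_shift. Qed.

Lemma mfun_diff h F : mfun F -> mfun (diff h F).
Proof. by move=> mF; apply: mfunB => //; exact: mfun_shift. Qed.

Lemma smooth_diff h F : smooth F -> smooth (diff h F).
Proof. by move=> sF; apply: smoothB => //; exact: smooth_shift. Qed.

Lemma derive_diff h F p v : smooth F -> 'D_v (diff h F) p = diff h (fun p => 'D_v F p) p.
Proof.
by move=> sF; rewrite (derive_smoothB p v (smooth_shift h sF) sF) derive_shiftp.
Qed.

Lemma inQP r p : inQ r p = 1 <-> Q r p.
Proof.
rewrite inQE; case: asboolP => H; split => // /esym/eqP.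
by rewrite oner_eq0.
Qed.

Lemma L2_inQM r F : L2 F -> L2 (fun p => inQ r p * F p).
Proof.
move=> LF; apply: (@L2_bM _ _ _ _ _ _ 1) => //; first exact: mfun_inQ.
by move=> p _; exact: inQ_bound.
Qed.

Lemma nrm_inQM r F : L2 F -> nrm (fun p => inQ r p * F p) <= nrm F.
Proof.
move=> LF; rewrite -[leRHS]mul1r -(expr1n _ 2); apply: nrm_bM => //.
  exact: mfun_inQ.
by move=> p _; exact: inQ_bound.
Qed.

Lemma nrm_inQ_shift r r' h F : h.1.2 = 0 -> L2 F ->
  (forall p, Q r p -> Q r' (p + h)) ->
  nrm (fun p => inQ r p * F (p + h)) <= nrm (fun p => inQ r' p * F p).
Proof.
move=> h0 LF sub; have L1 : L2 (fun p => inQ r' p * F p) by exact: L2_inQM.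
rewrite -(nrm_shift h0 L1); apply: le_nrm.
- by apply: L2_inQM; exact: L2_shift.
- exact: (L2_shift h0 L1).
move=> p _; have [q1|->] := inQ_01 r p; last by rewrite mul0r normr0.
by rewrite q1 (inQP _ _).2//; apply: sub; exact/inQP.
Qed.

Lemma le_inQ r r' F : L2 F -> (forall p, Q r p -> Q r' p) ->
  nrm (fun p => inQ r p * F p) <= nrm (fun p => inQ r' p * F p).
Proof.
move=> LF sub; apply: le_nrm; [exact: L2_inQM|exact: L2_inQM|].
move=> p _; have [q1|->] := inQ_01 r p; last by rewrite mul0r normr0.
by rewrite q1 (inQP _ _).2//; apply: sub; exact/inQP.
Qed.

Lemma double_le (x y z : R) : x <= z -> y <= z -> 2 * x + 2 * y <= 4 * z.
Proof. by lra. Qed.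

Lemma nrm_inQ_diff r r' h F : h.1.2 = 0 -> L2 F ->
  (forall p, Q r p -> Q r' p) -> (forall p, Q r p -> Q r' (p + h)) ->
  nrm (fun p => inQ r p * diff h F p) <= 4 * nrm (fun p => inQ r' p * F p).
Proof.
move=> h0 LF sub subh.
have E p : inQ r p * diff h F p = inQ r p * F (p + h) - inQ r p * F p.
  by rewrite /diff; ring.
rewrite (_ : (fun p => _) = fun p => inQ r p * F (p + h) - inQ r p * F p); last exact/funext.
apply: (le_trans (nrmB_le _ _)).
- by apply: L2_inQM; exact: L2_shift.
- exact: L2_inQM.
exact: double_le (nrm_inQ_shift h0 LF subh) (le_inQ LF sub).
Qed.

Lemma nrm_diff_approx r r' h f G d : h.1.2 = 0 -> 1 <= r' -> smooth f -> L2 G ->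
  (forall p, Q r p -> Q r' p) -> (forall p, Q r p -> Q r' (p + h)) ->
  nrm (fun p => inQ r' p * f p - G p) <= d ->
  nrm (fun p => inQ r p * diff h f p - inQ r p * diff h G p) <= 4 * d.
Proof.
move=> h0 r'1 sf LG sub subh Hd.
have LD : L2 (fun p => inQ r' p * f p - G p).
  by apply: L2B => //; exact: L2_inQ_smooth.
apply: (@le_trans _ _ (4 * nrm (fun p => inQ r' p * (inQ r' p * f p - G p)))); last first.
  by rewrite ler_wpM2l//; apply: le_trans Hd; exact: nrm_inQM.
rewrite [X in X <= _](_ : _ = nrm (fun p => inQ r p * diff h (fun p => inQ r' p * f p - G p) p)).
  exact: nrm_inQ_diff.
congr nrm; apply/funext => p; rewrite /diff.
have [q1|->] := inQ_01 r p; last by rewrite !mul0r subr0.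
have Qp := (inQP r p).1 q1.
by rewrite q1 ((inQP r' p).2 (sub _ Qp)) ((inQP r' (p + h)).2 (subh _ Qp)); ring.
Qed.

Lemma Q_le r r' p : 0 <= r -> r <= r' -> Q r p -> Q r' p.
Proof.
move=> r0 rr [/= H1 H2]; have r2 : r ^+ 2 <= r' ^+ 2 by rewrite lerXn2r ?nnegrE//; lra.
split => /=; first exact: lt_le_trans r2.
by move: H2; rewrite /Itime/= !in_itv/= -!ltr_norml => H2; exact: lt_le_trans r2.
Qed.

Lemma Q_shift r h p : 1 <= r -> sqnormz h.1 <= r ^+ 2 -> `|h.2| <= r ^+ 2 ->
  Q r p -> Q (2 * r) (p + h).
Proof.
move=> r1 h1 h2 [/= H1 H2]; split => /=.
  apply: (le_lt_trans (sqnormzD_le _ _)); rewrite /ball_z /= in H1.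
  have -> : (2 * r) ^+ 2 = 2 * r ^+ 2 + 2 * r ^+ 2 by ring.
  by apply: ltr_leD; rewrite ?ltr_pM2l// ler_pM2l.
move: H2; rewrite /Itime/= !in_itv/= -!ltr_norml => H2.
apply: (le_lt_trans (ler_normD _ _)).
have -> : (2 * r) ^+ 2 = 4 * r ^+ 2 by ring.
by have : 0 <= r ^+ 2 := sqr_ge0 r; lra.
Qed.

Lemma et_z p tau : (p + tau *: et).1 = p.1.
Proof. by case: p => [[x y] t] /=; rewrite !scaler0 !addr0. Qed.

Lemma Q_shift_t r tau p : 1 <= r -> `|tau| <= r ^+ 2 ->
  Q (3 * r) p -> Q (4 * r) (p + tau *: et).
Proof.
move=> r1 h2 [/= H1 H2].
have r2 : 0 < r ^+ 2 by rewrite exprn_gt0//; lra.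
split.
  change (sqnormz (p + tau *: et).1 < (4 * r) ^+ 2); rewrite et_z.
  by apply: (lt_trans H1); rewrite !exprMn ltr_pM2r//; lra.
rewrite /=.
move: H2; rewrite /Itime/= !in_itv/= -!ltr_norml => H2.
apply: (le_lt_trans (ler_normD _ _)).
have -> : tau *: (1 : R) = tau by rewrite /GRing.scale/= mulr1.
by move: H2; rewrite !exprMn; lra.
Qed.

Lemma b_gt0 : 0 < b. Proof. exact: bump2_gt0. Qed.

Lemma nrm_inQ_cutoff r F : 1 <= r -> L2 F ->
  nrm (fun p => inQ r p * F p) <= b ^- 2 * nrm (fun p => cutoff r p * F p).
Proof.
move=> r1 LF; have r0 : 0 < r by lra.
have bi : 0 < b^-1 by rewrite invr_gt0 b_gt0.
rewrite -exprVn -nrmZ; last exact: L2_cutoffM.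
apply: le_nrm; [exact: L2_inQM|by apply: L2Z; exact: L2_cutoffM|].
move=> p _; have [q1|->] := inQ_01 r p; last by rewrite mul0r normr0.
have [H1 H2] := (inQP r p).1 q1.
rewrite q1 mulrA normrM [leRHS]normrM ler_wpM2r// normr1 normrM gtr0_norm//.
rewrite ger0_norm ?cutoff_ge0// mulrC ler_pdivlMr ?b_gt0// mul1r.
apply: cutoff_lb => //; move: H2; by rewrite /Itime/= in_itv/= -ltr_norml.
Qed.

(** [Q (4 r)] contains the translates of [Q (3 r)] by times up to r^2, as needed for time
    differences; a cut-off of radius 4 r in turn needs a solution on the cylinder of radius 12 r. *)
Lemma gradient_bound r U V : sol_at (12 * r) U V -> 1 <= r ->
  \sum_i nrm (fun p => inQ (4 * r) p * V i p) <= b ^- 2 * ccac / r ^+ 2 * nrm U.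
Proof.
move=> sUV r1; have [LU LV _ _] := sUV.
have r2 : 0 < r ^+ 2 by rewrite exprn_gt0//; lra.
have r4 : 1 <= 4 * r by lra.
have r12 : 3 * (4 * r) <= 12 * r by lra.
have bi : 0 <= b ^- 2 by rewrite invr_ge0 sqr_ge0.
apply: (@le_trans _ _ (\sum_i b ^- 2 * nrm (fun p => cutoff (4 * r) p * V i p))).
  by apply: ler_sum => i _; exact: nrm_inQ_cutoff.
have -> : b ^- 2 * ccac / r ^+ 2 * nrm U = b ^- 2 * (ccac / r ^+ 2 * nrm U) by ring.
rewrite -mulr_sumr; apply: ler_wpM2l => //.
apply: (le_trans (caccioppoli eps01 a_gtN1 sUV r4 r12)).
apply: ler_wpM2r; first exact: nrm_ge0.
apply: ler_wpM2l; first exact: ccac_ge0.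
rewrite lef_pV2 ?posrE//; last by rewrite exprMn mulr_gt0.
by rewrite exprMn ler_peMl ?(ltW r2)//; lra.
Qed.

Lemma nrm_sum (I : Type) (s : seq I) (F : I -> ZT -> R) : (forall i, L2 (F i)) ->
  L2 (fun p => \sum_(i <- s) F i p) /\
  nrm (fun p => \sum_(i <- s) F i p) <= 2 ^+ size s * \sum_(i <- s) nrm (F i).
Proof.
move=> LF; elim: s => [|i s [IHL IH]].
  have -> : (fun p : ZT => \sum_(i <- [::]) F i p) = fun=> 0.
    by apply/funext => p; rewrite big_nil.
  have L1 : L2 (fun p => inQ 1 p * 1).
    by apply: L2_inQ_smooth => //; exact: smooth_cst.
  have -> : (fun=> 0) = (fun p : ZT => 0 * (inQ 1 p * 1)).
    by apply/funext => p; rewrite mul0r.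
  by split; [exact: L2Z|rewrite nrmZ// expr0n mul0r big_nil mulr0].
have -> : (fun p : ZT => \sum_(j <- i :: s) F j p) = fun p => F i p + \sum_(j <- s) F j p.
  by apply/funext => p; rewrite big_cons.
split; first exact: L2D.
rewrite big_cons; apply: (le_trans (nrmD_le (LF i) IHL)).
rewrite mulrDr; apply: lerD.
  by rewrite ler_wpM2r ?nrm_ge0// /= exprS ler_peMr// exprn_ege1// ler1n.
by rewrite /= exprS -mulrA ler_wpM2l.
Qed.

End difference_estimates.

Section difference_decay.
Context {R : realType} {N : nat} (eps a : R).
Hypotheses (eps01 : 0 <= eps < 1) (a_gtN1 : -1 < a).
Local Notation ZT := ('rV[R]_N * R * R)%type.
Local Notation w := (@wt R N eps a).
Local Notation L2 := (@L2 R N eps a).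
Local Notation ip := (@ip R N eps a).
Local Notation nrm := (@nrm R N eps a).
Local Notation sol_at := (@sol_at R N eps a).
Local Notation dim := #|{: option 'I_N}|.
Implicit Types (U f phi : ZT -> R) (V : option 'I_N -> ZT -> R).
Implicit Types (p h : ZT) (c r s d : R).

Lemma ler_addgt0M (x y c : R) : 0 <= c -> (forall d, 0 < d -> x <= y + c * d) -> x <= y.
Proof.
move=> c0 H; apply/ler_addgt0Pr => e e0.
have c1 : 0 < c + 1 by lra.
apply: (le_trans (H (e / (c + 1)) (divr_gt0 e0 c1))); rewrite lerD2l.
by rewrite mulrCA ler_piMr ?(ltW e0)// ler_pdivrMr// mul1r; lra.
Qed.

Lemma dir_decomp h : h.2 = 0 -> h = \sum_i comp i h.1 *: dir i.
Proof.
move=> h2.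
have E1 : (\sum_i comp i h.1 *: (dir i : ZT)).1.1 = h.1.1.
  rewrite !raddf_sum/=; apply/rowP => j; rewrite summxE.
  rewrite (bigD1 (Some j))//= !mxE !eqxx mulr1 big1 ?addr0// => -[k|] /= kj; rewrite !mxE ?mulr0//.
  rewrite eqxx /=; case: eqVneq => [E|]; last by rewrite mulr0.
  by move: kj; rewrite E eqxx.
have E2 : (\sum_i comp i h.1 *: (dir i : ZT)).1.2 = h.1.2.
  rewrite !raddf_sum/= (bigD1 None)//= big1 => [|[k|]//= _]; last by rewrite [_ *: 0]mulr0.
  by rewrite addr0 [_ *: 1]mulr1.
have E3 : (\sum_i comp i h.1 *: (dir i : ZT)).2 = h.2.
  by rewrite raddf_sum/= big1 ?h2// => i _; rewrite [_ *: 0]mulr0.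
by case: (\sum_i _) E1 E2 E3 => [[? ?] ?] /= -> -> ->; case: h {h2} => [[? ?] ?].
Qed.

Lemma derive_dir_decomp f h p : h.2 = 0 -> smooth f ->
  'D_h f p = \sum_i comp i h.1 * 'D_(dir i) f p.
Proof.
move=> h2 sf; have df := smooth_differentiable p sf.
rewrite {1}(dir_decomp h2) deriveE// linear_sum; apply: eq_bigr => i _.
by rewrite linearZ/= deriveE.
Qed.

Lemma absorb_le (X Y : R) : `|X| <= 2^-1 * X + 2^-1^-1 * Y -> X <= 4 * Y.
Proof. by rewrite invrK => /(le_trans (ler_norm _)); lra. Qed.

(** The squared norm of the difference is its pairing with the difference itself, so the mean value
    theorem for that pairing gives the derivative at a single shift [s], the same for all points.
    Young's inequality absorbs half of the left-hand side, whence the 4. *)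
Lemma smooth_difference_quotient r h phi : 1 <= r -> h.1.2 = 0 -> h.2 = 0 ->
  sqnormz h.1 <= r ^+ 2 -> smooth phi ->
  nrm (fun p => inQ r p * diff h phi p) <= 4 * nrm (fun p => inQ (2 * r) p * 'D_h phi p).
Proof.
move=> r1 h0 h2 hr sphi.
have r21 : 1 <= 2 * r by lra.
have LQ : L2 (fun p => inQ r p * 1).
  by apply: L2_inQ_smooth => //; exact: smooth_cst.
have Ld : L2 (fun p => inQ r p * diff h phi p).
  by apply: L2_inQ_smooth => //; exact: smooth_diff.
pose theta p := w p * ((inQ r p * 1) * (inQ r p * diff h phi p)).
have ti : intgb theta by exact: L2_intgb.
have sD : smooth (fun p => 'D_h phi p) by exact: smooth_derive.
(* A squared radius containing all shifts of [Q r] by s h with -1 < s < 2, where s^2 <= 4. *)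
pose A := 2 * r ^+ 2 + 8 * sqnormz h.1.
have [c c0 Hc] := cyl_bounded A (r ^+ 2) (smooth_continuous sphi).
have [c' c'0 Hc'] := cyl_bounded A (r ^+ 2) (smooth_continuous sD).
have cylP p s : -1 < s < 2 -> theta p != 0 -> cyl A (r ^+ 2) (p + s *: h).
  move=> /andP[s0 s1] tp.
  have : Q r p.
    apply/inQP; have [//|q0] := inQ_01 r p.
    by move: tp; rewrite /theta q0 !mul0r mulr0 eqxx.
  move=> [/= H1 H2]; split.
    apply: (le_trans (sqnormzD_le _ _)); rewrite /A; apply: lerD.
      by rewrite ler_pM2l// ltW.
    rewrite (_ : (s *: h).1 = s *: h.1)// sqnormzZ.
    have : s ^+ 2 <= 4 by nra.
    by have := sqnormz_ge0 h.1; nra.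
  rewrite /= h2 (_ : s *: (0 : R) = 0) ?addr0; last by rewrite scaler0.
  by move: H2; rewrite /Itime/= in_itv/= -ltr_norml => /ltW.
have [||s s01 E] := @J_mean_value R N theta phi h (Num.max c c') ti sphi.
- by move=> p s s12 tp; rewrite le_max Hc//; exact: cylP.
- by move=> p s s12 tp; rewrite le_max Hc' ?orbT//; exact: cylP.
have hs : (s *: h).1.2 = 0 by rewrite /= h0 scaler0.
have LDs : L2 (fun p => inQ r p * 'D_h phi (p + s *: h)).
  exact: (@L2_inQ_smooth _ _ _ _ _ _ eps01 a_gtN1 (smooth_shift (s *: h) sD) r1).
have E1 : nrm (fun p => inQ r p * diff h phi p) =
    ip (fun p => inQ r p * diff h phi p) (fun p => inQ r p * 'D_h phi (p + s *: h)).
  transitivity (J (fun p => theta p * (phi (p + h) - phi p))).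
    apply: eq_J => p; rewrite /theta /diff.
    by have [->|->] := inQ_01 r p; ring.
  rewrite E; apply: eq_J => p; rewrite /theta; ring.
have h12 : 0 < 2^-1 :> R by rewrite invr_gt0.
have := ip_young h12 Ld LDs.
rewrite -E1 => /absorb_le Y; apply: (le_trans Y).
apply: ler_wpM2l; first exact: ler0n.
have r31 : 1 <= 3 * r by lra.
have LD3 : L2 (fun p => inQ (3 * r) p * 'D_h phi p) by exact: L2_inQ_smooth.
have sub2 p : Q r p -> Q (2 * r) (p + s *: h).
  apply: Q_shift => //.
    rewrite (_ : (s *: h).1 = s *: h.1)// sqnormzZ.
    apply: le_trans hr; rewrite ler_piMl ?sqnormz_ge0//.
    by case/andP: s01 => s0 s1; rewrite expr_le1 ?ltW.
  rewrite /= h2 (_ : s *: (0 : R) = 0) ?normr0 ?sqr_ge0//; by rewrite scaler0.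
have sub23 p : Q (2 * r) p -> Q (3 * r) p by apply: Q_le; lra.
have sub3 p : Q r p -> Q (3 * r) (p + s *: h) by move=> /sub2/sub23.
rewrite [X in X <= _](_ : _ = nrm (fun p => inQ r p * (inQ (3 * r) (p + s *: h) * 'D_h phi (p + s *: h)))).
  apply: (le_trans (nrm_inQ_shift hs LD3 sub2)).
  apply: eq_ler; congr nrm; apply/funext => p.
  have [q1|->] := inQ_01 (2 * r) p; last by rewrite !mul0r.
  by rewrite ((inQP (3 * r) p).2 (sub23 _ ((inQP _ _).1 q1))) mul1r.
congr nrm; apply/funext => p.
have [q1|->] := inQ_01 r p; last by rewrite !mul0r.
by rewrite ((inQP (3 * r) (p + s *: h)).2 (sub3 _ ((inQP _ _).1 q1))) mul1r.
Qed.

(** The power of 2 is the loss of [nrm_sum] over the components of the gradient; 16 collects the 4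
    of [smooth_difference_quotient] and two factors 2 for replacing [U] and [V] by an
    approximant. *)
Definition xconst h : R := 16 * (2 ^+ size (index_enum (option 'I_N)) * sqnormz h.1).

Lemma xconst_ge0 h : 0 <= xconst h.
Proof. by apply: mulr_ge0 => //; apply: mulr_ge0; [exact: exprn_ge0|exact: sqnormz_ge0]. Qed.

Lemma space_difference r h U V : 1 <= r -> h.1.2 = 0 -> h.2 = 0 ->
  sqnormz h.1 <= r ^+ 2 -> sol_at (12 * r) U V ->
  nrm (fun p => inQ r p * diff h U p) <=
  xconst h * \sum_i nrm (fun p => inQ (4 * r) p * V i p).
Proof.
move=> r1 h0 h2 hr [LU LV aUV _].
have r121 : 1 <= 12 * r by lra.
have r21 : 1 <= 2 * r by lra.
have M0 : 0 <= 2 ^+ size (index_enum (option 'I_N)) :> R by exact: exprn_ge0.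
set M := 2 ^+ size (index_enum (option 'I_N)) in M0 *.
have S0 := sqnormz_ge0 h.1; set S := sqnormz h.1 in hr S0.
apply: (@ler_addgt0M _ _ (16 * M * S * dim%:R + 8)).
  by rewrite addr_ge0// !mulr_ge0.
move=> d d0.
have [phi [sphi H1 H2]] := aUV d d0.
have sub p : Q r p -> Q (12 * r) p by apply: Q_le; lra.
have sub2 p : Q r p -> Q (2 * r) (p + h).
  by apply: Q_shift => //; rewrite h2 normr0 sqr_ge0.
have sub24 p : Q (2 * r) p -> Q (4 * r) p by apply: Q_le; lra.
have sub212 p : Q (2 * r) p -> Q (12 * r) p by apply: Q_le; lra.
have subh p : Q r p -> Q (12 * r) (p + h) by move=> /sub2/sub212.
have LdU : L2 (diff h U) by exact: L2_diff.
have LQdU : L2 (fun p => inQ r p * diff h U p) by exact: L2_inQM.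
have LQdp : L2 (fun p => inQ r p * diff h phi p).
  by apply: L2_inQ_smooth => //; exact: smooth_diff.
have A1 := nrm_diff_approx eps01 a_gtN1 h0 r121 sphi LU sub subh H1.
have A2 := smooth_difference_quotient r1 h0 h2 hr sphi.
have LDi i : L2 (fun p => inQ (2 * r) p * 'D_(dir i) phi p).
  by apply: L2_inQ_smooth => //; exact: smooth_derive.
have A3 : nrm (fun p => inQ (2 * r) p * 'D_h phi p) <=
    M * \sum_i (S * nrm (fun p => inQ (2 * r) p * 'D_(dir i) phi p)).
  have LZ i : L2 (fun p => comp i h.1 * (inQ (2 * r) p * 'D_(dir i) phi p)) by exact: L2Z.
  have [_ HS] := nrm_sum eps01 a_gtN1 (index_enum (option 'I_N)) LZ.
  rewrite [X in X <= _](_ : _ = nrm (fun p => \sum_i comp i h.1 * (inQ (2 * r) p * 'D_(dir i) phi p))).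
    apply: (le_trans HS); rewrite ler_wpM2l//; apply: ler_sum => i _.
    rewrite (nrmZ (comp i h.1) (LDi i)); apply: ler_wpM2r; first exact: nrm_ge0.
    exact: comp_sqr_le.
  congr nrm; apply/funext => p; rewrite derive_dir_decomp// mulr_sumr.
  by apply: eq_bigr => i _; rewrite mulrCA.
have A4 i : nrm (fun p => inQ (2 * r) p * 'D_(dir i) phi p) <=
    2 * nrm (fun p => inQ (4 * r) p * V i p) + 2 * d.
  have LW : L2 (fun p => inQ (12 * r) p * 'D_(dir i) phi p - V i p).
    by apply: L2B => //; apply: L2_inQ_smooth => //; exact: smooth_derive.
  rewrite [X in X <= _](_ : _ = nrm (fun p => inQ (2 * r) p * V i p +
      inQ (2 * r) p * (inQ (12 * r) p * 'D_(dir i) phi p - V i p))).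
    apply: (le_trans (nrmD_le _ _)); [exact: L2_inQM|exact: L2_inQM|].
    apply: lerD; first by rewrite ler_pM2l//; exact: le_inQ.
    by rewrite ler_pM2l//; apply: (le_trans (nrm_inQM _ LW)).
  congr nrm; apply/funext => p.
  have [q1|->] := inQ_01 (2 * r) p; last by rewrite !mul0r addr0.
  by rewrite q1 ((inQP (12 * r) p).2 (sub212 _ ((inQP _ _).1 q1))); ring.
set W := \sum_i nrm (fun p => inQ (4 * r) p * V i p).
have A5 : \sum_i (S * nrm (fun p => inQ (2 * r) p * 'D_(dir i) phi p)) <=
    S * (2 * W) + dim%:R * (S * (2 * d)).
  have K i : S * nrm (fun p => inQ (2 * r) p * 'D_(dir i) phi p) <=
      S * (2 * nrm (fun p => inQ (4 * r) p * V i p)) + S * (2 * d).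
    by rewrite -mulrDr ler_wpM2l.
  by apply: (le_trans (ler_sum_const K)); rewrite -!mulr_sumr.
have A6 : nrm (fun p => inQ r p * diff h U p) <=
    2 * nrm (fun p => inQ r p * diff h phi p) + 2 * (4 * d).
  rewrite [X in X <= _](_ : _ = nrm (fun p => inQ r p * diff h phi p -
      (inQ r p * diff h phi p - inQ r p * diff h U p))).
    apply: (le_trans (nrmB_le _ _)) => //; first exact: L2B.
    by rewrite lerD2l ler_pM2l.
  by congr nrm; apply/funext => p; ring.
apply: (le_trans A6).
apply: (@le_trans _ _ (2 * (4 * (M * (S * (2 * W) + dim%:R * (S * (2 * d))))) + 2 * (4 * d))).
  rewrite lerD2r ler_pM2l//; apply: (le_trans A2); rewrite ler_pM2l//.
  by apply: (le_trans A3); rewrite ler_wpM2l.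
by rewrite /xconst -/M -/S; apply: eq_ler; ring.
Qed.

End difference_decay.

Section time_decay.
Context {R : realType} {N : nat} (eps a : R).
Hypotheses (eps01 : 0 <= eps < 1) (a_gtN1 : -1 < a).
Local Notation ZT := ('rV[R]_N * R * R)%type.
Local Notation L2 := (@L2 R N eps a).
Local Notation ip := (@ip R N eps a).
Local Notation nrm := (@nrm R N eps a).
Local Notation sol_at := (@sol_at R N eps a).
Local Notation dim := #|{: option 'I_N}|.
Implicit Types (U phi psi : ZT -> R) (V : option 'I_N -> ZT -> R).
Implicit Types (p : ZT) (r s tau d : R).

Lemma norm_sum_le (I : finType) (x y : I -> R) (X : R) :
  (forall i, `|x i| <= y i) -> X = \sum_i x i -> `|X| <= \sum_i y i.
Proof.
by move=> H ->; apply: (le_trans (ler_norm_sum _ _ _)); apply: ler_sum.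
Qed.

Lemma time_arith1 (X A B C d e : R) : `|X| <= A + B -> B <= 2 * (C * (4 * d)) + 2 * e ->
  `|X| <= A + 2 * e + 8 * C * d.
Proof. by lra. Qed.

Lemma time_arith2 (x y z W K q : R) : x <= 2 * y + 2 * (q ^+ 2 * z) -> y <= 4 * W ->
  z <= 4 * K -> x <= 8 * W + 8 * q ^+ 2 * K.
Proof.
move=> H1 H2 H3; apply: (le_trans H1).
have : q ^+ 2 * z <= q ^+ 2 * (4 * K) by rewrite ler_wpM2l// sqr_ge0.
lra.
Qed.

Lemma time_arith3 (x y t W n Y K d e : R) :
  `|x - y| <= e -> `|x| <= t * (17 * W + n * (Y + 8 * K * d)) ->
  0 <= t * (n * (8 * K)) -> d <= e ->
  y <= t * (17 * W + n * Y) + (t * (n * (8 * K)) + 1) * e.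
Proof.
rewrite ler_norml => /andP[H1 H2] /(le_trans (ler_norm _)) H3 H4 de.
have : t * (n * (8 * K)) * d <= t * (n * (8 * K)) * e by rewrite ler_wpM2l.
have : t * (17 * W + n * (Y + 8 * K * d)) =
  t * (17 * W + n * Y) + t * (n * (8 * K)) * d by ring.
lra.
Qed.

Lemma radius_arith (c r y : R) : 4 <= c -> 1 <= r ^+ 2 -> y <= r ^+ 2 ->
  4 * r ^+ 2 < (c * r) ^+ 2 /\ 2 * r ^+ 2 + y < (c * r) ^+ 2.
Proof.
move=> c4 r2 yr; have c2 : 16 <= c ^+ 2 by nra.
have : 16 * r ^+ 2 <= (c * r) ^+ 2 by rewrite exprMn ler_wpM2r// sqr_ge0.
by split; lra.
Qed.

(** The difference is paired with [psi], an approximant of the difference times [cutsq r]. Moving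
    the difference over to [psi] and using the equation gives [tau] times pairings of [V] with space
    derivatives of [psi]. These are bounded crudely by the gradient of [U], without using smallness
    of the difference: the gradient alone is already O(r^-2), and linearity in [tau] is enough. *)
Lemma time_difference r tau U V : 1 <= r -> `|tau| <= r ^+ 2 ->
  sol_at (12 * r) U V ->
  nrm (fun p => cutoff r p * diff (tau *: et) U p) <=
  `|tau| * (17 * (\sum_i nrm (fun p => inQ (4 * r) p * V i p)) +
            dim%:R * (16 * (16 / r) ^+ 2 * nrm U)).
Proof.
move=> r1 tr sUV; have [LU LV aUV wUV] := sUV.
have r0 : 0 < r by lra.
have r2 : 1 <= r ^+ 2 by rewrite expr_ge1// ltW.
have r121 : 1 <= 12 * r by lra.
have r31 : 1 <= 3 * r by lra.
have h0 : (tau *: (et : ZT)).1.2 = 0 by exact: et_y.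
have LDU : L2 (diff (tau *: et) U) by exact: L2_diff.
have LDV i : L2 (diff (tau *: et) (V i)) by exact: L2_diff.
(* The difference and its gradient are restricted to [Q (3 r)]: this contains the support of
   [cutsq r], and its translates stay in [Q (4 r)]. *)
pose U3 p := inQ (3 * r) p * diff (tau *: et) U p.
pose V3 i p := inQ (3 * r) p * diff (tau *: et) (V i) p.
have LU3 : L2 U3 by exact: L2_inQM.
have LV3 i : L2 (V3 i) by exact: L2_inQM.
have LcU : L2 (fun p => cutsq r p * diff (tau *: et) U p) by exact: L2_cutsqM.
set K := 2 + 2 * (16 / r) ^+ 2.
have K0 : 0 <= K by rewrite addr_ge0// mulr_ge0// sqr_ge0.
apply: (@ler_addgt0M _ _ _ (`|tau| * (dim%:R * (8 * K)) + 1)).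
  by rewrite addr_ge0// mulr_ge0// mulr_ge0// mulr_ge0.
move=> dl dl0.
have [e1 e10 He1] := ip_small LDU dl0.
pose d := Num.min (e1 / 4) dl.
have d0 : 0 < d by rewrite lt_min dl0 divr_gt0.
have d4 : 4 * d <= e1.
  have : d <= e1 / 4 by rewrite ge_min lexx.
  lra.
have ddl : d <= dl by rewrite ge_min lexx orbT.
have [phi [sphi H1 H2]] := aUV d d0.
have sdphi : smooth (diff (tau *: et) phi) by exact: smooth_diff.
have sub p : Q (3 * r) p -> Q (12 * r) p by apply: Q_le; lra.
have sub4 p : Q (4 * r) p -> Q (12 * r) p by apply: Q_le; lra.
have sub34 p : Q (3 * r) p -> Q (4 * r) p by apply: Q_le; lra.
have subh4 p : Q (3 * r) p -> Q (4 * r) (p + tau *: et) by exact: Q_shift_t.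
have subh p : Q (3 * r) p -> Q (12 * r) (p + tau *: et) by move=> /subh4/sub4.
have A1 : nrm (fun p => inQ (3 * r) p * diff (tau *: et) phi p - U3 p) <= 4 * d.
  exact: (nrm_diff_approx eps01 a_gtN1 h0 r121 sphi LU sub subh H1).
have A2 i : nrm (fun p => inQ (3 * r) p * 'D_(dir i) (diff (tau *: et) phi) p - V3 i p) <= 4 * d.
  have := nrm_diff_approx eps01 a_gtN1 h0 r121 (smooth_derive (dir i) sphi) (LV i) sub subh (H2 i).
  by under eq_fun do rewrite -derive_diff//.
pose psi p := cutsq r p * diff (tau *: et) phi p.
have spsi : smooth psi by exact: cutsqM_smooth.
have supp : supp_in (4 * r ^+ 2) (2 * r ^+ 2) psi by apply: supp_inMl; exact: supp_cutsq.
have [Lpsi LDpsi] := L2_cutsq_smooth eps01 a_gtN1 r0 sdphi.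
have B1 : nrm (fun p => psi p - cutsq r p * diff (tau *: et) U p) <= 4 * d.
  have := nrm_cutsq_approx eps01 a_gtN1 r1 (lexx _) sdphi LU3 A1.
  rewrite [X in X <= _ -> _](_ : _ = nrm (fun p => psi p - cutsq r p * diff (tau *: et) U p))//.
  congr nrm; apply/funext => p.
  by rewrite /psi /U3 mulrA (cutsq_inQ p r0 (lexx _)).
have B2 i : nrm (fun p => 'D_(dir i) psi p) <=
    2 * (K * (4 * d)) + 2 * (8 * nrm (fun p => inQ (4 * r) p * V i p) + 8 * (16 / r) ^+ 2 * nrm U).
  have LL : L2 (localized r U3 V3 i) by exact: L2_localized.
  have C1 := nrm_localized eps01 a_gtN1 r1 (lexx _) sdphi LU3 (LV3 i) A1 (A2 i).
  have C2 : nrm (localized r U3 V3 i) <=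
      8 * nrm (fun p => inQ (4 * r) p * V i p) + 8 * (16 / r) ^+ 2 * nrm U.
    have D1 : nrm (V3 i) <= 4 * nrm (fun p => inQ (4 * r) p * V i p).
      exact: nrm_inQ_diff.
    have D2 : nrm U3 <= 4 * nrm U.
      apply: (le_trans (nrm_inQ_diff h0 LU sub34 subh4)).
      by apply: ler_wpM2l; [exact: ler0n|exact: nrm_inQM].
    have D3 : nrm (localized r U3 V3 i) <= 2 * nrm (V3 i) + 2 * ((16 / r) ^+ 2 * nrm U3).
      apply: (le_trans (nrmD_le (L2_cutsqM r (LV3 i)) (L2_dcutsqM i r0 LU3))).
      apply: lerD; apply: ler_wpM2l; try exact: ler0n.
        have m1 : mfun (@cutsq R N r) by apply: mfun_smooth; exact: smooth_cutsq.
        have b1 p : 0 < p.1.2 -> `|@cutsq R N r p| <= 1 by move=> _; exact: norm_cutsq.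
        by apply: (le_trans (nrm_bM m1 b1 (LV3 i))); rewrite expr1n mul1r.
      have m1 : mfun (fun p => 'D_(dir i) (@cutsq R N r) p).
        by apply: mfun_derive; exact: smooth_cutsq.
      have b1 p : 0 < p.1.2 -> `|'D_(dir i) (@cutsq R N r) p| <= 16 / r.
        move=> _; have -> : 16 / r = 2 * (8 / r) by ring.
        exact/norm_derive_cutsq/derive_cutoff_dir.
      exact: (nrm_bM m1 b1 LU3).
    exact: time_arith2 D3 D1 D2.
  have LDL : L2 (fun p => 'D_(dir i) psi p - localized r U3 V3 i p) by exact: L2B.
  have -> : nrm (fun p => 'D_(dir i) psi p) =
      nrm (fun p => ('D_(dir i) psi p - localized r U3 V3 i p) + localized r U3 V3 i p).
    by apply: eq_ip => p _; rewrite subrK.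
  apply: (le_trans (nrmD_le LDL LL)); apply: lerD; apply: ler_wpM2l; try exact: ler0n.
    exact: C1.
  exact: C2.
have c12 : 4 <= 12 :> R by rewrite ler_nat.
have [A4 A5] := radius_arith c12 r2 tr; rewrite -normrN in A5.
have [s s01 E] := weak_time_difference eps01 a_gtN1 sUV r121 spsi supp A4 A5.
set sg := s * - tau in E.
have sgt : `|sg| <= r ^+ 2.
  apply: le_trans tr; rewrite /sg normrM normrN ler_piMl//.
  exact: norm_unit_le1.
have hm : (- (tau *: (et : ZT))).1.2 = 0 by rewrite /= scaler0 oppr0.
(* The difference passes from [U] to [psi], which turns the shift [tau] into [- tau]. *)
have E1 : ip (diff (tau *: et) U) psi =
    (- tau) * \sum_i ip (V i) (fun p => 'D_(dir i) psi (p + sg *: et)).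
  apply: etrans _ E; rewrite /diff ipBl//; last exact: L2_shift.
  rewrite ipBr//; last by apply: L2_shift => //; exact: et_y.
  congr (_ - _).
  have := ip_shiftr hm LU Lpsi.
  rewrite [X in _ = X](_ : _ = ip (fun p => U (p + tau *: et)) psi); last first.
    by apply: eq_ip => p _; rewrite opprK.
  by move=> <-; apply: eq_ip => p _; rewrite scaleNr.
have hs : (sg *: (et : ZT)).1.2 = 0 by exact: et_y.
have B3 i : `|ip (V i) (fun p => 'D_(dir i) psi (p + sg *: et))| <=
    nrm (fun p => inQ (4 * r) p * V i p) +
    2 * (8 * nrm (fun p => inQ (4 * r) p * V i p) + 8 * (16 / r) ^+ 2 * nrm U) + 8 * K * d.
  have LDs : L2 (fun p => 'D_(dir i) psi (p + sg *: et)).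
    exact: (L2_shift hs (LDpsi (dir i))).
  have -> : ip (V i) (fun p => 'D_(dir i) psi (p + sg *: et)) =
      ip (fun p => inQ (4 * r) p * V i p) (fun p => 'D_(dir i) psi (p + sg *: et)).
    apply: eq_ip => p _.
    have sD := supp_in_shift_t (s := sg) (supp_in_derive (v := dir i) supp).
    have [Q1 Q2] := radius_arith (lexx _) r2 sgt.
    by rewrite -[in LHS](inQ_supp p sD Q1 Q2); ring.
  have LQV : L2 (fun p => inQ (4 * r) p * V i p) by exact: L2_inQM.
  have := ip_young (@ltr01 R) LQV LDs; rewrite invr1 !mul1r => Y.
  have nD := nrm_shift hs (LDpsi (dir i)); cbv beta in nD; rewrite nD in Y.
  exact: time_arith1 Y (B2 i).
have C0 : ip (diff (tau *: et) U) (fun p => cutsq r p * diff (tau *: et) U p) =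
    nrm (fun p => cutoff r p * diff (tau *: et) U p).
  by apply: eq_ip => p _; rewrite /cutsq; ring.
have C1 : `|ip (diff (tau *: et) U) (fun p => psi p - cutsq r p * diff (tau *: et) U p)| <= dl.
  by apply: He1; [exact: L2B|exact: le_trans B1 d4].
rewrite (ipBr Lpsi LcU LDU) C0 in C1.
have C2 := norm_sum_le B3 (erefl _).
set W := \sum_i nrm (fun p => inQ (4 * r) p * V i p).
have C3 : `|ip (diff (tau *: et) U) psi| <= `|tau| * (17 * W +
    dim%:R * (16 * (16 / r) ^+ 2 * nrm U + 8 * K * d)).
  rewrite E1 normrM normrN; apply: ler_wpM2l => //; apply: (le_trans C2).
  have K1 i : nrm (fun p => inQ (4 * r) p * V i p) +
    2 * (8 * nrm (fun p => inQ (4 * r) p * V i p) + 8 * (16 / r) ^+ 2 * nrm U) + 8 * K * d <=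
    17 * nrm (fun p => inQ (4 * r) p * V i p) + (16 * (16 / r) ^+ 2 * nrm U + 8 * K * d).
    by apply: eq_ler; ring.
  by apply: (le_trans (ler_sum_const K1)); rewrite -mulr_sumr.
have T0 : 0 <= `|tau| * (dim%:R * (8 * K)) by rewrite mulr_ge0// mulr_ge0// mulr_ge0.
exact: (time_arith3 C1 C3 T0 ddl).
Qed.

End time_decay.

(** * Iterated differences of global solutions *)

Section iteration.
Context {R : realType} {N : nat} (eps a : R).
Hypotheses (eps01 : 0 <= eps < 1) (a_gtN1 : -1 < a).
Local Notation ZT := ('rV[R]_N * R * R)%type.
Local Notation leb := (@lebesgue_zt R N).
Local Notation L2 := (@L2 R N eps a).
Local Notation ip := (@ip R N eps a).
Local Notation nrm := (@nrm R N eps a).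
Local Notation sol_at := (@sol_at R N eps a).
Local Notation ccac := (@ccac R N).
Local Notation b := (@bump R 0 2).
Local Notation dim := #|{: option 'I_N}|.
Implicit Types (u F G H phi : ZT -> R) (V : option 'I_N -> ZT -> R).
Implicit Types (p h v : ZT) (r tau : R).

(** The gradient may depend on [r], so no compatibility between cylinders is asked for. Radii start
    at 1 because the integral bounds by powers of [r] are stated from there on. *)
Definition sol u : Prop := mfun u /\
  forall r, 1 <= r -> exists V, sol_at r (fun p => inQ r p * u p) V.

Definition energy u r : R := nrm (fun p => inQ r p * u p).

Lemma inQ_diff r r' h u p : (forall p, Q r p -> Q r' p) ->
  (forall p, Q r p -> Q r' (p + h)) ->
  inQ r p * diff h (fun p => inQ r' p * u p) p = inQ r p * diff h u p.
Proof.
move=> sub subh; have [q1|->] := inQ_01 r p; last by rewrite !mul0r.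
have Qp := (inQP r p).1 q1; rewrite /diff.
by rewrite ((inQP r' p).2 (sub _ Qp)) ((inQP r' (p + h)).2 (subh _ Qp)) !mul1r.
Qed.

(** The shift is moved to the test function: the equation on a larger cylinder is used for psi(. -
    h) and for psi, and the two identities are subtracted. *)
Lemma sol_diff h u : h.1.2 = 0 -> sol u -> sol (diff h u).
Proof.
move=> h0 [mu su]; split; first exact: mfun_diff.
move=> r r1; have r0 : 0 <= r by lra.
have H0 := sqnormz_ge0 h.1; have H1 := normr_ge0 h.2.
(* Large enough that [Q (2 q)] contains [Q r] and its translate by [h], and also the support of the
   translated test function. *)
pose q := r + sqnormz h.1 + `|h.2| + 1.
have q1 : 1 <= q by rewrite /q; lra.
have rq : r < q by rewrite /q; lra.
have qq : q <= q ^+ 2 by rewrite expr2 ler_peMr//; lra.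
have hq : sqnormz h.1 <= q ^+ 2 by apply: le_trans qq; rewrite /q; lra.
have hq2 : `|h.2| <= q ^+ 2 by apply: le_trans qq; rewrite /q; lra.
have q21 : 1 <= 2 * q by lra.
have sub p : Q r p -> Q (2 * q) p by apply: Q_le => //; lra.
have subq p : Q r p -> Q q p by apply: Q_le => //; lra.
have subh p : Q r p -> Q (2 * q) (p + h) by move=> /subq; exact: Q_shift.
have rq2 : r ^+ 2 < q ^+ 2 by rewrite ltr_pXn2r// nnegrE; lra.
have [V [LU LV aUV wUV]] := su _ q21.
have E p : inQ r p * diff h (fun p => inQ (2 * q) p * u p) p = inQ r p * diff h u p.
  exact: inQ_diff.
have LdU : L2 (diff h (fun p => inQ (2 * q) p * u p)) by exact: L2_diff.
exists (fun i p => inQ r p * diff h (V i) p); split.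
- have := L2_inQM r LdU.
  by rewrite (_ : (fun p => inQ r p * diff h (fun p => inQ (2 * q) p * u p) p) =
    (fun p => inQ r p * diff h u p)); last exact/funext.
- by move=> i; apply: L2_inQM; exact: L2_diff.
- move=> d d0; have d4 : 0 < d / 4 by rewrite divr_gt0.
  have E4 : 4 * (d / 4) = d by rewrite mulrC divfK.
  have [phi [sphi H2 H3]] := aUV _ d4.
  exists (diff h phi); split; first exact: smooth_diff.
    have := nrm_diff_approx eps01 a_gtN1 h0 q21 sphi LU sub subh H2.
    rewrite E4; under eq_fun do rewrite E; exact.
  move=> i; have := nrm_diff_approx eps01 a_gtN1 h0 q21 (smooth_derive (dir i) sphi) (LV i) sub subh (H3 i).
  by rewrite E4; under eq_fun do rewrite -derive_diff//.
- move=> psi A B spsi supp Ar Br.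
  have hm : (- h).1.2 = 0 by rewrite /= h0 oppr0.
  have key F G : L2 F -> (forall p, inQ r p * G p = G p) -> L2 G ->
      ip (fun p => inQ r p * diff h F p) G = ip F (fun p => G (p - h)) - ip F G.
    move=> LF QG LG; rewrite (ip_shiftr hm)// -ipBl//; last first.
      by apply: L2_shift => //; rewrite opprK.
    by apply: eq_ip => p _; rewrite opprK /diff -{2}(QG p); ring.
  have inQd v p : inQ r p * 'D_v psi p = 'D_v psi p.
    exact: (inQ_supp p (supp_in_derive (v := v) supp) Ar Br).
  have LD v : L2 (fun p => 'D_v psi p).
    apply: (supp_in_test_L2 eps01 a_gtN1 _ (supp_in_derive (v := v) supp)).
    exact: smooth_derive.
  have -> : ip (fun p => inQ r p * diff h u p) (fun p => 'D_et psi p) =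
      ip (fun p => inQ r p * diff h (fun p => inQ (2 * q) p * u p) p) (fun p => 'D_et psi p).
    by apply: eq_ip => p _; rewrite E.
  rewrite (key _ _ LU (inQd et) (LD et)).
  pose psih p := psi (p - h).
  have spsih : smooth psih by exact: smooth_shift.
  have supph := supp_in_shift (h := - h) supp.
  have A1 : A < (2 * q) ^+ 2 by rewrite exprMn; lra.
  have B1 : B < (2 * q) ^+ 2 by rewrite exprMn; lra.
  have A2 : 2 * A + 2 * sqnormz (- h).1 < (2 * q) ^+ 2.
    by rewrite (_ : (- h).1 = - h.1)// sqnormzN exprMn; lra.
  have B2 : B + `|(- h).2| < (2 * q) ^+ 2.
    by rewrite (_ : (- h).2 = - h.2)// normrN exprMn; lra.
  have W1 := wUV _ _ _ spsi supp A1 B1.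
  have W2 := wUV _ _ _ spsih supph A2 B2.
  rewrite W1.
  have -> : ip (fun p => inQ (2 * q) p * u p) (fun p => 'D_et psi (p - h)) =
      \sum_i ip (V i) (fun p => 'D_(dir i) psih p).
    apply: etrans _ W2; apply: eq_ip => p _; by rewrite /psih derive_shiftp.
  rewrite -sumrB; apply: eq_bigr => i _; rewrite (key _ _ (LV i) (inQd (dir i)) (LD (dir i))).
  have EE : ip (V i) (fun p => 'D_(dir i) psih p) = ip (V i) (fun p => 'D_(dir i) psi (p - h)).
    by apply: eq_ip => p _; rewrite /psih derive_shiftp.
  exact: (congr1 (fun x => x - ip (V i) (fun p => 'D_(dir i) psi p)) EE).
Qed.

(** The constants depend on [h] and not on [u], so that the estimate can be applied again to the
    differences of [u]. *)
Definition decay h : Prop := exists C r0, [/\ 0 <= C, 1 <= r0 &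
  forall u, sol u -> forall r, r0 <= r ->
  energy (diff h u) r <= C / r ^+ 2 * energy u (12 * r)].

Lemma decay_space h : h.1.2 = 0 -> h.2 = 0 -> decay h.
Proof.
move=> h0 h2; have S0 := sqnormz_ge0 h.1.
exists (xconst h * (b ^- 2 * ccac)), (1 + sqnormz h.1); split; [|lra|].
  apply: mulr_ge0; first exact: xconst_ge0.
  by apply: mulr_ge0; [rewrite invr_ge0 sqr_ge0|exact: ccac_ge0].
move=> u [mu su] r rh; have r1 : 1 <= r by lra.
have hr : sqnormz h.1 <= r ^+ 2.
  have : r <= r ^+ 2 by rewrite expr2 ler_peMr//; lra.
  lra.
have r121 : 1 <= 12 * r by lra.
have [V sUV] := su _ r121.
have sub p : Q r p -> Q (12 * r) p by apply: Q_le; lra.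
have sub2 p : Q r p -> Q (2 * r) (p + h).
  by apply: Q_shift => //; rewrite h2 normr0 sqr_ge0.
have sub212 p : Q (2 * r) p -> Q (12 * r) p by apply: Q_le; lra.
have subh p : Q r p -> Q (12 * r) (p + h) by move=> /sub2/sub212.
have H1 := space_difference eps01 a_gtN1 r1 h0 h2 hr sUV.
have H2 := gradient_bound eps01 a_gtN1 sUV r1.
have -> : energy (diff h u) r =
    nrm (fun p => inQ r p * diff h (fun p => inQ (12 * r) p * u p) p).
  by apply: eq_ip => p _; rewrite inQ_diff.
apply: (le_trans H1).
have -> : xconst h * (b ^- 2 * ccac) / r ^+ 2 * energy u (12 * r) =
    xconst h * (b ^- 2 * ccac / r ^+ 2 * energy u (12 * r)) by ring.
apply: ler_wpM2l; first exact: xconst_ge0.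
exact: H2.
Qed.

Lemma decay_time tau : decay (tau *: et).
Proof.
have t0 := normr_ge0 tau.
have b0 : 0 <= b ^- 2 by rewrite invr_ge0 sqr_ge0.
exists (b ^- 2 * (`|tau| * (17 * (b ^- 2 * ccac) + dim%:R * (16 * 256)))), (1 + `|tau|).
split; [|lra|].
  apply: mulr_ge0; first exact: b0.
  apply: mulr_ge0; first exact: t0.
  apply: addr_ge0; apply: mulr_ge0; try exact: ler0n.
    by apply: mulr_ge0; [exact: b0|exact: ccac_ge0].
  by apply: mulr_ge0; exact: ler0n.
move=> u [mu su] r rh; have r1 : 1 <= r by lra.
have r2 : 0 < r ^+ 2 by rewrite exprn_gt0//; lra.
have hr : `|tau| <= r ^+ 2.
  have : r <= r ^+ 2 by rewrite expr2 ler_peMr//; lra.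
  lra.
have r121 : 1 <= 12 * r by lra.
have [V sUV] := su _ r121.
have [LU _ _ _] := sUV.
have h0 : (tau *: (et : ZT)).1.2 = 0 by exact: et_y.
have sub p : Q r p -> Q (12 * r) p by apply: Q_le; lra.
have sub3 p : Q r p -> Q (3 * r) p by apply: Q_le; lra.
have sub412 p : Q (4 * r) p -> Q (12 * r) p by apply: Q_le; lra.
have subh p : Q r p -> Q (12 * r) (p + tau *: et) by move=> /sub3/(Q_shift_t r1 hr)/sub412.
have LdU : L2 (diff (tau *: et) (fun p => inQ (12 * r) p * u p)) by exact: L2_diff.
have H1 := time_difference eps01 a_gtN1 r1 hr sUV.
have H2 := gradient_bound eps01 a_gtN1 sUV r1.
have H3 := nrm_inQ_cutoff r1 LdU.
have -> : energy (diff (tau *: et) u) r =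
    nrm (fun p => inQ r p * diff (tau *: et) (fun p => inQ (12 * r) p * u p) p).
  by apply: eq_ip => p _; rewrite inQ_diff.
apply: (le_trans H3).
have -> : b ^- 2 * (`|tau| * (17 * (b ^- 2 * ccac) + dim%:R * (16 * 256))) / r ^+ 2 *
   energy u (12 * r) = b ^- 2 * (`|tau| * (17 * (b ^- 2 * ccac / r ^+ 2 * energy u (12 * r)) +
     dim%:R * (16 * (16 / r) ^+ 2 * energy u (12 * r)))).
  have -> : (16 / r) ^+ 2 = 256 / r ^+ 2 by field; rewrite gt_eqF//; lra.
  by ring.
apply: ler_wpM2l; first exact: b0.
apply: (le_trans H1); apply: ler_wpM2l; first exact: t0.
apply: lerD; last exact: lexx.
by apply: ler_wpM2l; [exact: ler0n|exact: H2].
Qed.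

Lemma sol_iter_diff h k u : h.1.2 = 0 -> sol u -> sol (iter k (diff h) u).
Proof. by move=> h0 su; elim: k => //= k IH; exact: sol_diff. Qed.

(** Each difference gains r^-2 and enlarges the radius by 12; the latter costs 12^m in the constant,
    as the factor of 12 in the denominator may be dropped. *)
Lemma energy_iter h u C r0 m k : h.1.2 = 0 -> decay h -> sol u -> 0 <= C ->
  (forall r, r0 <= r -> energy u r <= C * r ^+ m) ->
  exists C' r1, [/\ 0 <= C', 1 <= r1 & forall r, r1 <= r ->
    energy (iter k (diff h) u) r <= C' * (r ^+ m / r ^+ k.*2)].
Proof.
move=> h0 [D [rd [D0 rd1 HD]]] su C0 HC; elim: k => [|k [C' [r1 [C'0 r11 IH]]]].
  exists C, (Num.max r0 1); split=> //; first by rewrite le_max lexx orbT.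
  by move=> r; rewrite ge_max => /andP[r0r _]; rewrite expr0 divr1; exact: HC.
exists (D * (C' * 12 ^+ m)), (Num.max rd r1); split.
- by rewrite !mulr_ge0// exprn_ge0.
- by rewrite le_max rd1.
move=> r; rewrite ge_max => /andP[rdr r1r].
have rp : 0 < r by lra.
have r12 : r1 <= 12 * r by lra.
have r2 : 0 < r ^+ 2 by rewrite exprn_gt0.
have rk : 0 < r ^+ k.*2 by rewrite exprn_gt0.
apply: (le_trans (HD _ (sol_iter_diff k h0 su) r rdr)).
apply: (@le_trans _ _ (D / r ^+ 2 * (C' * ((12 * r) ^+ m / (12 * r) ^+ k.*2)))).
  by apply: ler_wpM2l; [rewrite divr_ge0// ltW|exact: IH].
apply: (@le_trans _ _ (D / r ^+ 2 * (C' * ((12 * r) ^+ m / r ^+ k.*2)))).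
  apply: ler_wpM2l; first by rewrite divr_ge0// ltW.
  apply: ler_wpM2l => //; apply: ler_wpM2l; first by rewrite exprn_ge0// mulr_ge0// ltW.
  rewrite lef_pV2 ?posrE//; last by rewrite exprn_gt0// mulr_gt0.
  by rewrite exprMn ler_peMl ?(ltW rk)// exprn_ege1// ler1n.
apply: eq_ler; rewrite doubleS !exprS exprMn; field.
by rewrite !gt_eqF// exprn_gt0.
Qed.

Lemma Q_exhaust p : exists n : nat, Q n.+1%:R p.
Proof.
pose M := sqnormz p.1 + `|p.2|; exists (Num.truncn M).
have Mn : M < (Num.truncn M).+1%:R by exact: truncnS_gt.
have nn : (Num.truncn M).+1%:R <= (Num.truncn M).+1%:R ^+ 2 :> R.
  by rewrite expr2 ler_peMr// ler1n.
split => /=.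
  by rewrite /ball_z /=; apply: lt_le_trans nn; apply: le_lt_trans Mn; rewrite /M lerDl.
rewrite /Itime/= in_itv/= -ltr_norml; apply: lt_le_trans nn; apply: le_lt_trans Mn.
by rewrite /M lerDr sqnormz_ge0.
Qed.

Lemma energy0_ae u : mfun u -> (forall r, 1 <= r -> L2 (fun p => inQ r p * u p)) ->
  (forall r, 1 <= r -> energy u r = 0) ->
  {ae leb, forall p : ZT, 0 < p.1.2 -> u p = 0}.
Proof.
move=> mu Lu E0.
have H n : {ae leb, forall p : ZT, 0 < p.1.2 -> inQ n.+1%:R p * u p = 0}.
  by apply: (nrm0_ae (Lu _ _) (E0 _ _)); rewrite ler1n.
apply: (aeS (ae_forall H)) => p Hp p0.
have [n Qn] := Q_exhaust p.
by have := Hp n p0; rewrite ((inQP _ _).2 Qn) mul1r.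
Qed.

Lemma energy_mono u r r' : L2 (fun p => inQ r' p * u p) -> 0 <= r -> r <= r' ->
  energy u r <= energy u r'.
Proof.
move=> Lu r0 rr; have sub p : Q r p -> Q r' p by exact: Q_le.
have -> : energy u r = nrm (fun p => inQ r p * (inQ r' p * u p)).
  apply: eq_ip => p _; have [q1|->] := inQ_01 r p; last by rewrite !mul0r.
  by rewrite ((inQP r' p).2 (sub _ ((inQP _ _).1 q1))) mul1r.
exact: nrm_inQM.
Qed.

(** With m + 1 differences the energy on [Q r] is O(r^(m - 2(m+1))), which tends to 0; being
    nondecreasing in [r], it vanishes for every [r]. *)
Lemma iter_diff_eq0 h u C r0 m : h.1.2 = 0 -> decay h -> sol u -> 0 <= C ->
  (forall r, r0 <= r -> energy u r <= C * r ^+ m) ->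
  {ae leb, forall p : ZT, 0 < p.1.2 -> iter m.+1 (diff h) u p = 0}.
Proof.
move=> h0 dh su C0 HC.
have [C' [r1 [C'0 r11 H]]] := energy_iter m.+1 h0 dh su C0 HC.
have sk := sol_iter_diff m.+1 h0 su.
have Lk r : 1 <= r -> L2 (fun p => inQ r p * iter m.+1 (diff h) u p).
  by move=> r1'; have [V [LU _ _ _]] := sk.2 r r1'.
apply: energy0_ae => //; first exact: sk.1.
move=> r rr1; apply/le_anti/andP; split; last exact: nrm_ge0.
apply/ler_addgt0Pr => e e0; rewrite add0r.
(* The energy on [Q q] is at most C' / q, hence at most [e]. *)
pose q := Num.max (Num.max r r1) (C' / e).
have qr : r <= q by rewrite !le_max lexx.
have qr1 : r1 <= q by rewrite !le_max lexx orbT.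
have qe : C' / e <= q by rewrite !le_max lexx !orbT.
have q1 : 1 <= q by lra.
apply: (le_trans (energy_mono (Lk q q1) _ qr)); first by lra.
apply: (le_trans (H q qr1)).
have qm : 0 < q ^+ m by rewrite exprn_gt0//; lra.
have -> : q ^+ m / q ^+ (m.+1).*2 = (q ^+ 2 * q ^+ m)^-1.
  have -> : (m.+1).*2 = (m + (2 + m))%N by rewrite doubleS -addnn addnCA.
  by rewrite !exprD; field; rewrite !gt_eqF//; lra.
apply: (@le_trans _ _ (C' * q^-1)).
  apply: ler_wpM2l => //; rewrite lef_pV2 ?posrE ?mulr_gt0 ?exprn_gt0//; try lra.
  rewrite expr2 -mulrA ler_peMr//; first lra.
  have : 1 <= q ^+ m by rewrite exprn_ege1.
  by move=> qm1; rewrite -[1]mulr1 ler_pM.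
rewrite ler_pdivrMr; last by lra.
by move: qe; rewrite ler_pdivrMr// mulrC.
Qed.

End iteration.

(** * Sequences with vanishing differences *)

Section sequences.
Context {R : realType}.
Implicit Types (x : nat -> R) (c C s : R).

Definition dseq x n : R := x n.+1 - x n.
(** An eventual one-sided bound from below: summing the differences raises its exponent by one
    whatever the initial terms are. *)
Definition grows q x : Prop := exists c n0, 0 < c /\
  forall n, (n0 <= n)%N -> c * n%:R ^+ q <= x n.

Lemma iter_dseqN k x n : iter k dseq (fun n => - x n) n = - iter k dseq x n.
Proof.
elim: k n => //= k IH n; rewrite {1}/dseq !IH /dseq; ring.
Qed.

Lemma iter_dseq0 k x : (forall n, x n = 0) -> forall n, iter k dseq x n = 0.
Proof. by move=> x0; elim: k => //= k IH n; rewrite /dseq !IH subr0. Qed.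

Lemma growsW q x : grows q.+1 x -> grows q x.
Proof.
move=> [c [n0 [c0 H]]]; exists c, n0.+1; split=> // n nn0.
apply: le_trans (H n (ltnW nn0)); rewrite ler_pM2l// exprS ler_peMl ?exprn_ge0//.
by rewrite ler1n; apply: leq_trans nn0.
Qed.

Lemma dominates (f x : nat -> R) n0 :
  (forall n, (n0 <= n)%N -> dseq f n <= dseq x n) ->
  forall n, (n0 <= n)%N -> f n - (f n0 - x n0) <= x n.
Proof.
move=> H; elim=> [|n IH]; first by rewrite leqn0 => /eqP ->; lra.
rewrite leq_eqVlt => /orP[/eqP <-|]; first by lra.
rewrite ltnS => n0n; have := IH n0n; have := H n n0n; rewrite /dseq; lra.
Qed.

Lemma grows_up q x : (q < 2)%N -> grows q (dseq x) -> grows q.+1 x.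
Proof.
move=> q2 [c [n0 [c0 H]]].
(* The third is there because (n+1)^(q+1) - n^(q+1) <= 3 n^q for n >= 1 and q = 0 or 1. *)
pose f n : R := c / 3 * n%:R ^+ q.+1.
have fx n : (maxn n0 1 <= n)%N -> dseq f n <= dseq x n.
  rewrite geq_max => /andP[n0n n1]; apply: le_trans (H n n0n).
  have {}n1 : 1 <= n%:R :> R by rewrite ler1n.
  have nS : n.+1%:R = n%:R + 1 :> R by rewrite -addn1 natrD.
  rewrite /dseq /f nS; case: q q2 {H f} => [|[|//]] _.
    by rewrite !expr1 expr0; lra.
  by rewrite expr1; nra.
pose D := `|f (maxn n0 1) - x (maxn n0 1)|.
(* Half of c / 3 is given up to absorb the offset [D], which is at most c n / 6 from this index
   on. *)
exists (c / 6), (maxn (maxn n0 1) (Num.truncn (6 * D / c)).+1); split.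
  by rewrite divr_gt0.
move=> n; rewrite geq_max => /andP[n0n nD].
have H1 := dominates fx n0n; rewrite {1}/f in H1.
have Dn : 6 * D <= n%:R * c.
  rewrite -ler_pdivrMr//.
  by apply/ltW/(lt_le_trans (truncnS_gt _)); rewrite ler_nat.
have n1 : 1 <= n%:R :> R by rewrite ler1n; apply: leq_trans n0n; rewrite leq_max orbT.
have nq : n%:R <= n%:R ^+ q.+1 :> R by rewrite exprS ler_peMr// exprn_ege1.
have H2 : f (maxn n0 1) - x (maxn n0 1) <= D by exact: ler_norm.
have H3 : c * n%:R <= c * n%:R ^+ q.+1 by rewrite ler_pM2l.
set Y := f (maxn n0 1) - x (maxn n0 1) in H1 H2.
move: H1 H2 H3 Dn; set M := n%:R ^+ q.+1; set m : R := n%:R; lra.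
Qed.

Lemma grows_dseq q x : (0 < q <= 2)%N -> grows q (dseq x) -> grows q x.
Proof. by case: q => // q /= q2 /growsW/(grows_up q2). Qed.

Lemma grows_iter_dseq q k x : (0 < q <= 2)%N -> grows q (iter k dseq x) -> grows q x.
Proof. by move=> q2; elim: k => //= k IH /(grows_dseq q2)/IH. Qed.

(** Summing [q] times raises the exponent from 0 to [q]; the remaining j - q summations only have to
    keep it. *)
Lemma grows0 q j x : (0 < q <= 2)%N -> (q <= j)%N -> grows 0 (iter j dseq x) -> grows q x.
Proof.
case: q => [//|[|[|//]]] _ qj g0.
- apply: (@grows_iter_dseq 1 j.-1) => //; apply: grows_up => //.
  by case: j qj g0.
- apply: (@grows_iter_dseq 2 j.-2) => //; apply: grows_up => //; apply: grows_up => //.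
  by case: j qj g0 => [|[|j]].
Qed.

Lemma bounded_not_grows q C s x : s < q%:R ->
  (forall n, `|x n| <= C * n.+1%:R `^ s) -> ~ grows q x.
Proof.
move=> sq xC [c [n0 [c0 H]]].
have e0 : 0 < q%:R - s by lra.
(* Chosen so that c y exceeds 2^q |C|. The index [n] below gives y <= (n+1)^(q - s), and 2^q comes
   from comparing (n+1)^q with n^q. *)
pose y := `|C| * 2 ^+ q / c + 1.
have y0 : 0 < y by rewrite ltr_wpDl// divr_ge0 ?mulr_ge0 ?exprn_ge0// ltW.
pose n := maxn (maxn n0 1) (Num.truncn (y `^ (q%:R - s)^-1)).
have n0n : (n0 <= n)%N by rewrite !leq_max leqnn.
have n1 : (1 <= n)%N by rewrite !leq_max leqnn orbT.
have M0 : 0 < n.+1%:R :> R by rewrite ltr0n.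
have yn : y <= n.+1%:R `^ (q%:R - s).
  have Y : y `^ (q%:R - s)^-1 <= n.+1%:R.
    apply/ltW/(lt_le_trans (truncnS_gt _)); rewrite ler_nat ltnS.
    by rewrite leq_max leqnn orbT.
  have := ge0_ler_powR (ltW e0) _ _ Y; rewrite !nnegrE => /(_ (powR_ge0 _ _) (ltW M0)).
  by rewrite -powRrM mulVf ?gt_eqF// powRr1// ltW.
have H1 : c * n%:R ^+ q <= `|C| * n.+1%:R `^ s.
  apply: (le_trans (H n n0n)); apply: (le_trans (ler_norm _)); apply: (le_trans (xC n)).
  by rewrite ler_wpM2r ?powR_ge0// ler_norm.
have H2 : n.+1%:R ^+ q <= 2 ^+ q * n%:R ^+ q :> R.
  rewrite -exprMn lerXn2r ?nnegrE ?mulr_ge0// -natrM ler_nat; by rewrite mul2n -addnn -addn1 leq_add2l.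
have H3 : n.+1%:R ^+ q = n.+1%:R `^ (q%:R - s) * n.+1%:R `^ s :> R.
  rewrite -powR_mulrn ?(ltW M0)// -powRD; first by congr (_ `^ _); ring.
  by apply/implyP => _; rewrite gt_eqF.
have S0 : 0 < n.+1%:R `^ s by rewrite powR_gt0.
have : c * (y * n.+1%:R `^ s) <= 2 ^+ q * `|C| * n.+1%:R `^ s.
  apply: (@le_trans _ _ (c * (2 ^+ q * n%:R ^+ q))).
    by rewrite ler_pM2l//; apply: le_trans H2; rewrite H3 ler_pM2r.
  by rewrite mulrCA -[leRHS]mulrA ler_wpM2l ?exprn_ge0.
rewrite mulrA ler_pM2r// => K.
have : c * y = 2 ^+ q * `|C| + c by rewrite /y; field; rewrite gt_eqF.
lra.
Qed.

(** Descent on [k]: if the difference of order k + 1 vanishes, that of order [k] is constant. For k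
    >= q a nonzero constant would make [x] or [- x] grow at least like n^q, against the exponent s <
    q. *)
Lemma iter_dseq_eq0 q k C s x : (0 < q <= 2)%N -> s < q%:R ->
  (forall n, `|x n| <= C * n.+1%:R `^ s) ->
  (forall n, iter k dseq x n = 0) -> forall n, iter q dseq x n = 0.
Proof.
move=> q12 sq xC; elim: k => [x0|k IH].
  exact: iter_dseq0.
have [kq H|qk H] := ltnP k q.
  rewrite -(subnK kq) iterD; exact: iter_dseq0.
apply: IH.
have cst n : iter k dseq x n = iter k dseq x 0%N.
  elim: n => // n <-; apply/eqP; rewrite -subr_eq0; apply/eqP; exact: H.
have [c0|c0|c0] := ltgtP 0 (iter k dseq x 0%N); last by move=> n; rewrite cst -c0.
- exfalso; apply: (bounded_not_grows sq xC); apply: grows0 qk _ => //.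
  by exists (iter k dseq x 0%N), 0%N; split => // n _; rewrite expr0 mulr1 cst.
- exfalso; have xC' n : `|- x n| <= C * n.+1%:R `^ s by rewrite normrN.
  apply: (bounded_not_grows sq xC'); apply: grows0 qk _ => //.
  exists (- iter k dseq x 0%N), 0%N; split; first by rewrite oppr_gt0.
  by move=> n _; rewrite expr0 mulr1 iter_dseqN lerN2 cst.
Qed.

(** The factor M^(e gamma) is at least 1, so it can be pulled out of the summand 1 as well. *)
Lemma powR_growth (X K M e gamma : R) : 0 <= X -> 0 <= K -> 1 <= M -> 0 <= e ->
  0 <= gamma -> X <= K * M `^ e ->
  (1 + X `^ gamma) `^ 2^-1 <= (1 + K `^ gamma) `^ 2^-1 * M `^ (e * gamma / 2).
Proof.
move=> X0 K0 M1 e0 g0 XK.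
have M0 : 0 <= M by lra.
have H1 : X `^ gamma <= K `^ gamma * M `^ (e * gamma).
  rewrite powRrM -powRM ?powR_ge0//; apply: ge0_ler_powR; rewrite ?nnegrE//.
  by rewrite mulr_ge0// powR_ge0.
have H2 : 1 <= M `^ (e * gamma).
  rewrite -[leLHS](powRr0 M); apply: ler_powR => //; exact: mulr_ge0.
have A0 : 0 <= 1 + K `^ gamma by rewrite addr_ge0// powR_ge0.
have B0 : 0 <= M `^ (e * gamma) by exact: powR_ge0.
have -> : M `^ (e * gamma / 2) = (M `^ (e * gamma)) `^ 2^-1 by rewrite -powRrM.
rewrite -(powRM 2^-1 A0 B0).
apply: ge0_ler_powR.
- by rewrite invr_ge0.
- by rewrite nnegrE addr_ge0// powR_ge0.
- by rewrite nnegrE mulr_ge0 ?powR_ge0// addr_ge0// powR_ge0.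
by rewrite mulrDl mul1r; apply: lerD.
Qed.

End sequences.

(** * Order of vanishing from the growth bound *)

Section growth.
Context {R : realType} {N : nat} (eps a : R).
Hypotheses (eps01 : 0 <= eps < 1) (a_gtN1 : -1 < a).
Local Notation ZT := ('rV[R]_N * R * R)%type.
Local Notation leb := (@lebesgue_zt R N).
Local Notation sol := (@sol R N eps a).
Local Notation energy := (@energy R N eps a).
Implicit Types (u : ZT -> R) (p h : ZT) (C gamma s r tau : R).

Definition bounded_growth gamma C u p : Prop := 0 < p.1.2 ->
  `|u p| <= C * (1 + (sqnormz p.1 + `|p.2|) `^ gamma) `^ 2^-1.

Lemma iter_diff_dseq h u k p n : iter k (diff h) u (p + n%:R *: h) =
  iter k dseq (fun n => u (p + n%:R *: h)) n.
Proof.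
elim: k n => //= k IH n; rewrite {1}/dseq -!IH.
rewrite -[LHS]/(iter k (diff h) u (p + n%:R *: h + h) - iter k (diff h) u (p + n%:R *: h)).
have -> // : p + n%:R *: h + h = p + n.+1%:R *: h.
by rewrite -addrA -{2}[h]scale1r -scalerDl -natr1.
Qed.

Lemma energy_growth gamma C u : 0 <= gamma < 2 -> 0 <= C -> mfun u ->
  {ae leb, forall p : ZT, bounded_growth gamma C u p} ->
  exists C' m, 0 <= C' /\ forall r, 1 <= r -> energy u r <= C' * r ^+ m.
Proof.
move=> /andP[g0 g2] C0 mu Hu.
have [D [m [D0 HD]]] := nrm_inQ_bounded (N := N) eps01 a_gtN1.
exists ((3 * C) ^+ 2 * D), (4 + m)%N; split; first by rewrite mulr_ge0// sqr_ge0.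
move=> r r1; have r0 : 0 < r by lra.
have r2 : 1 <= r ^+ 2 by rewrite expr_ge1// ltW.
(* On [Q r] one has |z|^2 + |t| <= 2 r^2; with gamma < 2 the growth bound is at most C (1 + 4
   r^4)^(1/2) <= 3 C r^2. *)
have c0 : 0 <= 3 * C * r ^+ 2 by rewrite mulr_ge0 ?sqr_ge0// mulr_ge0.
have [] := HD r u (3 * C * r ^+ 2) r1 mu c0.
  apply: (aeS Hu) => p Hp [/= Q1 Q2] p0; apply: (le_trans (Hp p0)).
  rewrite [3 * C]mulrC -mulrA ler_wpM2l//.
  have X0 : 0 <= sqnormz p.1 + `|p.2| by rewrite addr_ge0 ?sqnormz_ge0.
  have X2 : sqnormz p.1 + `|p.2| <= 2 * r ^+ 2.
    rewrite /ball_z/= in Q1; move: Q2; rewrite /Itime/= in_itv/= -ltr_norml => Q2; lra.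
  have H1 : (sqnormz p.1 + `|p.2|) `^ gamma <= (2 * r ^+ 2) ^+ 2.
    rewrite -powR_mulrn; last by lra.
    apply: (@le_trans _ _ ((2 * r ^+ 2) `^ gamma)).
      by apply: ge0_ler_powR; rewrite ?nnegrE//; lra.
    by apply: ler_powR; lra.
  rewrite powR12_sqrt; last by rewrite addr_ge0// powR_ge0.
  have -> : 3 * r ^+ 2 = Num.sqrt ((3 * r ^+ 2) ^+ 2) by rewrite sqrtr_sqr ger0_norm; lra.
  rewrite ler_sqrt ?sqr_ge0//; nra.
move=> _ H; apply: (le_trans H).
by apply: eq_ler; rewrite exprD; ring.
Qed.

(** Outside a countable union of null sets, the growth bound and the vanishing of a high difference
    hold at every p + n h. The question is then about one sequence of real numbers, the growth
    exponent of which lowers the order of the vanishing difference to [q]. *)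
Lemma iter_diff_growth gamma C u h q s : 0 <= gamma < 2 -> 0 <= C -> sol u ->
  {ae leb, forall p : ZT, bounded_growth gamma C u p} ->
  h.1.2 = 0 -> decay eps a h -> (0 < q <= 2)%N -> s < q%:R ->
  (forall p, 0 < p.1.2 -> (forall n : nat, bounded_growth gamma C u (p + n%:R *: h)) ->
    exists K, forall n : nat, `|u (p + n%:R *: h)| <= K * n.+1%:R `^ s) ->
  {ae leb, forall p : ZT, 0 < p.1.2 -> iter q (diff h) u p = 0}.
Proof.
move=> g02 C0 su Hu h0 dh q12 sq HK.
have [C' [m [C'0 HE]]] := energy_growth g02 C0 su.1 Hu.
have I0 := iter_diff_eq0 eps01 a_gtN1 h0 dh su C'0 HE.
have A1 := ae_forall (fun n : nat => ae_shift (n%:R *: h) Hu).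
have A2 := ae_forall (fun n : nat => ae_shift (n%:R *: h) I0).
apply: (aeS (aeI A1 A2)) => p [B1 B2] p0.
have [K HKp] := HK p p0 B1.
have y0 n : 0 < (p + n%:R *: h).1.2 by rewrite /= h0 scaler0 addr0.
have Z n : iter m.+1 dseq (fun n => u (p + n%:R *: h)) n = 0.
  by rewrite -iter_diff_dseq; apply: B2.
have := iter_dseq_eq0 q12 sq HKp Z 0%N.
by rewrite -iter_diff_dseq scale0r addr0.
Qed.

(** [e] is the growth exponent of |z|^2 + |t| along the sequence, 2 for a space shift and 1 for a
    time shift. So [u] grows with exponent at most gamma or gamma / 2, to be compared with the order
    of the difference. *)
Lemma growth_along gamma C u h e : 0 <= gamma -> 0 <= C -> 0 <= e -> h.1.2 = 0 ->
  (forall p, exists2 K, 0 <= K & forall n : nat,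
    sqnormz (p + n%:R *: h).1 + `|(p + n%:R *: h).2| <= K * n.+1%:R `^ e) ->
  forall p, 0 < p.1.2 -> (forall n : nat, bounded_growth gamma C u (p + n%:R *: h)) ->
    exists K, forall n : nat, `|u (p + n%:R *: h)| <= K * n.+1%:R `^ (e * gamma / 2).
Proof.
move=> g0 C0 e0 h0 HK p p0 Hp; have [K K0 HKp] := HK p.
exists (C * (1 + K `^ gamma) `^ 2^-1) => n.
have y0 : 0 < (p + n%:R *: h).1.2 by rewrite /= h0 scaler0 addr0.
apply: (le_trans (Hp n y0)); rewrite -mulrA ler_wpM2l//.
apply: powR_growth => //; first by rewrite addr_ge0 ?sqnormz_ge0.
by rewrite ler1n.
Qed.

Lemma growth_space h p : h.2 = 0 -> exists2 K, 0 <= K & forall n : nat,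
  sqnormz (p + n%:R *: h).1 + `|(p + n%:R *: h).2| <= K * n.+1%:R `^ 2%:R.
Proof.
move=> h2; have S0 := sqnormz_ge0 p.1; have S1 := sqnormz_ge0 h.1.
exists (2 * sqnormz p.1 + 2 * sqnormz h.1 + `|p.2|).
  by rewrite !addr_ge0// mulr_ge0.
move=> n; rewrite powR_mulrn ?ler0n//.
have n1 : 1 <= n.+1%:R :> R by rewrite ler1n.
have n2 : 1 <= n.+1%:R ^+ 2 :> R by rewrite expr_ge1// ltW.
have -> : (p + n%:R *: h).2 = p.2 by rewrite /= h2 scaler0 addr0.
have nn : n%:R ^+ 2 <= n.+1%:R ^+ 2 :> R by rewrite lerXn2r ?nnegrE// ler_nat.
have := sqnormzD_le p.1 (n%:R *: h.1); rewrite sqnormzZ => H.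
apply: (@le_trans _ _ (2 * sqnormz p.1 + 2 * (n%:R ^+ 2 * sqnormz h.1) + `|p.2|)).
  by rewrite lerD2r.
have := normr_ge0 p.2.
set M := n.+1%:R ^+ 2 in n2 nn *; set m := n%:R ^+ 2 in nn *; nra.
Qed.

Lemma growth_time tau p : exists2 K, 0 <= K & forall n : nat,
  sqnormz (p + n%:R *: (tau *: et)).1 + `|(p + n%:R *: (tau *: et)).2| <= K * n.+1%:R `^ 1%:R.
Proof.
have S0 := sqnormz_ge0 p.1.
exists (sqnormz p.1 + `|p.2| + `|tau|); first by apply: addr_ge0 => //; exact: addr_ge0.
move=> n; rewrite powR_mulrn ?ler0n// expr1.
have n1 : 1 <= n.+1%:R :> R by rewrite ler1n.
rewrite mulet et_z.
have -> : (p + (n%:R * tau) *: et).2 = p.2 + n%:R * tau by rewrite /= [_ *: 1]mulr1.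
have H := ler_normD p.2 (n%:R * tau); rewrite normrM ger0_norm// in H.
have nn : n%:R <= n.+1%:R :> R by rewrite ler_nat.
have := normr_ge0 p.2; have := normr_ge0 tau.
set M := n.+1%:R in n1 nn *; set m := n%:R in H nn *; nra.
Qed.

Lemma time_invariant gamma C u tau : 0 <= gamma < 2 -> 0 <= C -> sol u ->
  {ae leb, forall p : ZT, bounded_growth gamma C u p} ->
  {ae leb, forall p : ZT, 0 < p.1.2 -> diff (tau *: et) u p = 0}.
Proof.
move=> g02 C0 su Hu; have [g0 g2] := andP g02.
have h0 : (tau *: (et : ZT)).1.2 = 0 by exact: et_y.
have s1 : 1%:R * gamma / 2 < 1%:R by lra.
apply: (iter_diff_growth g02 C0 su Hu h0 (decay_time eps01 a_gtN1 tau) (q := 1) _ s1) => //.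
exact: (growth_along g0 C0 (ler0n R 1) h0 (growth_time tau)).
Qed.

Lemma second_difference gamma C u h : 0 <= gamma < 2 -> 0 <= C -> sol u ->
  {ae leb, forall p : ZT, bounded_growth gamma C u p} -> h.1.2 = 0 -> h.2 = 0 ->
  {ae leb, forall p : ZT, 0 < p.1.2 -> diff h (diff h u) p = 0}.
Proof.
move=> g02 C0 su Hu h0 h2; have [g0 g2] := andP g02.
have s1 : 2%:R * gamma / 2 < 2%:R by lra.
apply: (iter_diff_growth g02 C0 su Hu h0 (decay_space eps01 a_gtN1 h0 h2) (q := 2) _ s1) => //.
exact: (growth_along g0 C0 (ler0n R 2) h0 (fun p => growth_space p h2)).
Qed.

Lemma first_difference gamma C u h : 0 <= gamma < 1 -> 0 <= C -> sol u ->
  {ae leb, forall p : ZT, bounded_growth gamma C u p} -> h.1.2 = 0 -> h.2 = 0 ->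
  {ae leb, forall p : ZT, 0 < p.1.2 -> diff h u p = 0}.
Proof.
move=> /andP[g0 g1] C0 su Hu h0 h2.
have g02 : 0 <= gamma < 2 by apply/andP; split; lra.
have s1 : 2%:R * gamma / 2 < 1%:R by lra.
apply: (iter_diff_growth g02 C0 su Hu h0 (decay_space eps01 a_gtN1 h0 h2) (q := 1) _ s1) => //.
exact: (growth_along g0 C0 (ler0n R 2) h0 (fun p => growth_space p h2)).
Qed.

End growth.

(** * Solutions invariant under tangential translations *)

Section tangential_invariance.
Context {R : realType} {N : nat} (eps a : R).
Hypotheses (eps01 : 0 <= eps < 1) (a_gtN1 : -1 < a).
Local Notation ZT := ('rV[R]_N * R * R)%type.
Local Notation leb := (@lebesgue_zt R N).
Local Notation w := (@wt R N eps a).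
Local Notation L2 := (@L2 R N eps a).
Local Notation ip := (@ip R N eps a).
Implicit Types (u F G : ZT -> R).
Implicit Types (p h : ZT) (c r s A B : R).

Definition invariant h u : Prop :=
  forall s, {ae leb, forall p : ZT, 0 < p.1.2 -> diff (s *: h) u p = 0}.

Lemma big_radius (x : R) : 0 <= x -> x < (x + 1) ^+ 2.
Proof. by move=> x0; have : 0 <= x ^+ 2 := sqr_ge0 x; rewrite sqrrD1; lra. Qed.

Lemma ip_inQ r A B F G : mfun F -> supp_in A B G -> A < r ^+ 2 -> B < r ^+ 2 ->
  ip (fun p => inQ r p * F p) G = ip F G.
Proof.
by move=> mF sG Ar Br; apply: eq_ip => p _; rewrite -(inQ_supp p sG Ar Br); have [->|->] := inQ_01 r p; ring.
Qed.

(** The pairing of [u] with F(. + s h) does not depend on [s], so by the mean value theorem its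
    derivative vanishes at some [s]; by invariance again, that derivative is the pairing with 'D_h F
    unshifted. *)
Lemma orth_invariant u F h A B : mfun u ->
  (forall r, 1 <= r -> L2 (fun p => inQ r p * u p)) -> invariant h u ->
  h.1.2 = 0 -> smooth F -> supp_in A B F -> ip u (fun p => 'D_h F p) = 0.
Proof.
move=> mu Lu inv h0 sF supp.
have HA := normr_ge0 A; have HB := normr_ge0 B.
have AA := ler_norm A; have BB := ler_norm B.
have Hh := sqnormz_ge0 h.1; have Ht := normr_ge0 h.2.
pose X := 2 * `|A| + 2 * sqnormz h.1 + `|B| + `|h.2|.
have X0 : 0 <= X by rewrite /X; lra.
have XX := big_radius X0.
pose q := X + 1; have q1 : 1 <= q by rewrite /q; lra.
have qA : 2 * A + 2 * sqnormz h.1 < q ^+ 2 by apply: le_lt_trans XX; rewrite /X; lra.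
have qA' : A < q ^+ 2 by apply: le_lt_trans XX; rewrite /X; lra.
have qB : B + `|h.2| < q ^+ 2 by apply: le_lt_trans XX; rewrite /X; lra.
have qB' : B < q ^+ 2 by apply: le_lt_trans XX; rewrite /X; lra.
pose W p := inQ q p * u p.
have LW : L2 W by exact: Lu.
have LQ : L2 (fun p => inQ q p * 1).
  by apply: L2_inQ_smooth => //; exact: smooth_cst.
pose theta p := w p * ((inQ q p * 1) * W p).
have ti : intgb theta by exact: L2_intgb.
have sD : smooth (fun p => 'D_h F p) by exact: smooth_derive.
have suppD := supp_in_derive (v := h) supp.
have [c c0 Fc] := supp_in_bounded (smooth_continuous sF) supp.
have [c' c'0 Dc] := supp_in_bounded (smooth_continuous sD) suppD.
have [||s s01 E] := @J_mean_value R N theta F h (Num.max c c') ti sF.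
- by move=> p s _ _; rewrite le_max Fc.
- by move=> p s _ _; rewrite le_max Dc orbT.
have s1 : `|s| <= 1 by exact: norm_unit_le1.
have shift_supp G t : `|t| <= 1 -> supp_in A B G ->
    forall p, inQ q p * G (p + t *: h) = G (p + t *: h).
  move=> t1 sG p.
  apply: (inQ_supp (F := fun p => G (p + t *: h)) p (supp_in_shift (h := t *: h) sG)).
    apply: le_lt_trans qA; rewrite lerD2l ler_pM2l// sqnormzZ ler_piMl//.
    by rewrite -[t ^+ 2]real_normK ?num_real// expr_le1.
  apply: le_lt_trans qB; rewrite lerD2l /= normrM ler_piMl//.
(* The shift moves over to [u], where invariance removes it. This is used for [F] at the shifts 0
   and 1, and for its derivative at the intermediate shift. *)
have key G t : `|t| <= 1 -> mfun G -> L2 G -> supp_in A B G ->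
    J (fun p => theta p * G (p + t *: h)) = ip W G.
  move=> t1 mG LG sG.
  have ht0 : (t *: h).1.2 = 0 by rewrite /= h0 scaler0.
  have LWs : L2 (fun p => W (p - t *: h)).
    by apply: L2_shift => //; rewrite /= h0 scaler0 oppr0.
  transitivity (ip W (fun p => G (p + t *: h))).
    apply: eq_J => p; rewrite /theta -[in RHS](shift_supp G t t1 sG p).
    by have [->|->] := inQ_01 q p; ring.
  rewrite (ip_shiftr ht0 LW LG).
  have -> : ip W G = ip u G by exact: ip_inQ sG qA' qB'.
  have mshift : mfun (fun p => u (p - t *: h)) by exact: mfun_shift.
  have -> : ip (fun p => W (p - t *: h)) G = ip (fun p => u (p - t *: h)) G.
    apply: eq_ip => p _; rewrite /W.
    have := shift_supp G t t1 sG (p - t *: h); rewrite subrK => <-.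
    by have [->|->] := inQ_01 q (p - t *: h); ring.
  apply: ae_eq_ip => //.
  apply: (aeS (inv (- t))) => p Hp p0; have := Hp p0; rewrite /diff scaleNr.
  by move/eqP; rewrite subr_eq0 => /eqP.
have LF : L2 F by exact: supp_in_test_L2 supp.
have LD : L2 (fun p => 'D_h F p) by exact: supp_in_test_L2 suppD.
have mF : mfun F by exact: LF.1.
have mD : mfun (fun p => 'D_h F p) by exact: LD.1.
have n1 : `|1 : R| <= 1 by rewrite normr1.
have n0 : `|0 : R| <= 1 by rewrite normr0.
have K1 := key F 1 n1 mF LF supp.
have K0 := key F 0 n0 mF LF supp.
have KD := key _ s s1 mD LD suppD.
have ui (G : ZT -> R) t : `|t| <= 1 -> L2 G -> supp_in A B G -> intgb (fun p => theta p * G (p + t *: h)).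
  move=> t1 LG sG.
  have LGs : L2 (fun p => G (p + t *: h)) by apply: L2_shift => //; rewrite /= h0 scaler0.
  have := L2_intgb LW LGs; congr intgb; apply/funext => p.
  rewrite /theta -[in LHS](shift_supp G t t1 sG p).
  by have [->|->] := inQ_01 q p; ring.
have E0 : J (fun p => theta p * (F (p + h) - F p)) = 0.
  have I1 := ui F 1 n1 LF supp.
  have I0 := ui F 0 n0 LF supp.
  transitivity (J (fun p => theta p * F (p + (1 : R) *: h)) - J (fun p => theta p * F (p + (0 : R) *: h))).
    rewrite -JB//; apply: eq_J => p; by rewrite scale1r scale0r addr0 mulrBr.
  by rewrite K1 K0 subrr.
rewrite E0 KD in E.
by rewrite [LHS](_ : _ = ip W (fun p => 'D_h F p))//; apply/esym; exact: ip_inQ suppD qA' qB'.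
Qed.

End tangential_invariance.

Section normal_derivative.
Context {R : realType} {N : nat} (eps a : R).
Hypotheses (eps01 : 0 <= eps < 1) (a_gtN1 : -1 < a).
Local Notation ZT := ('rV[R]_N * R * R)%type.
Local Notation w := (@wt R N eps a).
Local Notation L2 := (@L2 R N eps a).
Local Notation ip := (@ip R N eps a).
Local Notation nrm := (@nrm R N eps a).
Local Notation sol_at := (@sol_at R N eps a).
Local Notation sol := (@sol R N eps a).
Local Notation ey := (dir None : ZT).
Implicit Types (u F phi psi : ZT -> R) (V : option 'I_N -> ZT -> R).
Implicit Types (p h : ZT) (c r s d A B : R).

Lemma sol_L2 u r : sol u -> 1 <= r -> L2 (fun p => inQ r p * u p).
Proof. by move=> [_ su] r1; have [V []] := su r r1. Qed.

Lemma norm_eq0 (x : R) : (forall d, 0 < d -> `|x| <= 2 * d) -> x = 0.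
Proof.
move=> H; apply/eqP; rewrite -normr_eq0; apply/eqP/le_anti; rewrite normr_ge0 andbT.
by apply: (@ler_addgt0M _ _ _ 2) => // d d0; rewrite add0r; exact: H.
Qed.

Lemma norm_chain2 (x y z d : R) : `|x - y| <= d -> `|y - z| <= d -> z = 0 -> `|x| <= 2 * d.
Proof.
move=> H1 H2 z0; rewrite z0 subr0 in H2.
have -> : x = (x - y) + y by ring.
by apply: (le_trans (ler_normD _ _)); lra.
Qed.

(** Formally an integration by parts: the pairing is minus that of [u] with the second derivative of
    [psi], which vanishes by [orth_invariant]. It is carried out on approximants of [u]. *)
Lemma tangential_orth r u V psi A B i : sol u -> (forall h, h.1.2 = 0 -> invariant h u) ->
  1 <= r -> sol_at r (fun p => inQ r p * u p) V ->
  smooth psi -> supp_in A B psi -> A < r ^+ 2 -> B < r ^+ 2 ->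
  ip (V (Some i)) (fun p => 'D_(dir (Some i)) psi p) = 0.
Proof.
move=> su inv r1 [LU LV aUV wUV] spsi supp Ar Br.
set e := dir (Some i).
have e0 : e.1.2 = 0 by [].
have sD : smooth (fun p => 'D_e psi p) by exact: smooth_derive.
have sDD : smooth (fun p => 'D_e (fun p => 'D_e psi p) p) by exact: smooth_derive.
have suppD := supp_in_derive (v := e) supp.
have suppDD := supp_in_derive (v := e) suppD.
have LD : L2 (fun p => 'D_e psi p) by exact: supp_in_test_L2 suppD.
have LDD : L2 (fun p => 'D_e (fun p => 'D_e psi p) p) by exact: supp_in_test_L2 suppDD.
have O1 := orth_invariant eps01 a_gtN1 su.1 (fun r => sol_L2 (r := r) su) (inv e e0) e0 sD suppD.
apply: norm_eq0 => d d0.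
have [d1 d10 H1] := ip_small LD d0.
have [d2 d20 H2] := ip_small LDD d0.
have m0 : 0 < Num.min d1 d2 by rewrite lt_min d10.
have [phi [sphi A1 A2]] := aUV _ m0.
have Lphi : L2 (fun p => inQ r p * phi p) by exact: L2_inQ_smooth.
have LDphi : L2 (fun p => inQ r p * 'D_e phi p).
  by apply: L2_inQ_smooth => //; exact: smooth_derive.
have B1 : `|ip (V (Some i)) (fun p => 'D_e psi p) -
   ip (fun p => inQ r p * 'D_e phi p) (fun p => 'D_e psi p)| <= d.
  rewrite distrC -ipBl// ipC; apply: H1; first exact: L2B.
  by apply: (le_trans (A2 (Some i))); rewrite ge_min lexx.
have B2 : `|ip (fun p => inQ r p * phi p) (fun p => 'D_e (fun p => 'D_e psi p) p) -
   ip (fun p => inQ r p * u p) (fun p => 'D_e (fun p => 'D_e psi p) p)| <= d.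
  rewrite -ipBl// ipC; apply: H2; first exact: L2B.
  by apply: (le_trans A1); rewrite ge_min lexx orbT.
have B3 : ip (fun p => inQ r p * u p) (fun p => 'D_e (fun p => 'D_e psi p) p) = 0.
  by rewrite (ip_inQ _ _ su.1 suppDD Ar Br).
pose F p := phi p * 'D_e psi p.
have sF : smooth F by exact: smoothM.
have suppF : supp_in A B F.
  by rewrite /F; under eq_fun do rewrite mulrC; exact: supp_inMl.
have m1 : mfun (fun _ : ZT => 1 : R) by exact: mfun_cst.
have L1 r' : 1 <= r' -> L2 (fun p => inQ r' p * 1).
  by move=> r'1; apply: L2_inQ_smooth => //; exact: smooth_cst.
have inv1 : invariant e (fun _ : ZT => 1 : R).
  by move=> s; apply: aeW => p _; rewrite /diff subrr.
(* Applied to the constant function 1: a tangential derivative of a compactly supported function has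
   weighted integral 0. For phi times 'D_e psi this is the integration by parts. *)
have O2 := orth_invariant eps01 a_gtN1 m1 L1 inv1 e0 sF suppF.
have E : ip (fun p => inQ r p * 'D_e phi p) (fun p => 'D_e psi p) =
   - ip (fun p => inQ r p * phi p) (fun p => 'D_e (fun p => 'D_e psi p) p).
  apply/eqP; rewrite -addr_eq0; apply/eqP; apply: etrans _ O2.
  rewrite [RHS](_ : _ = ip (fun p => inQ r p * 1) (fun p => 'D_e F p)); last first.
    apply/esym; apply: ip_inQ => //; [exact: (supp_in_derive (v := e) suppF)|exact: Ar|exact: Br].
  have iA := L2_intgb LDphi LD; have iB := L2_intgb Lphi LDD.
  rewrite /ip -JD//; apply: eq_J => p; rewrite derive_smoothM//; ring.
apply: (norm_chain2 B1 _ (erefl 0)).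
rewrite subr0 E normrN; move: B2; rewrite B3 subr0; exact.
Qed.

Lemma normal_orth r u V psi A B : sol u -> (forall h, h.1.2 = 0 -> invariant h u) ->
  1 <= r -> sol_at r (fun p => inQ r p * u p) V ->
  smooth psi -> supp_in A B psi -> A < r ^+ 2 -> B < r ^+ 2 ->
  ip (V None) (fun p => 'D_ey psi p) = 0.
Proof.
move=> su inv r1 sUV spsi supp Ar Br.
have [LU LV aUV wUV] := sUV.
have W := wUV _ _ _ spsi supp Ar Br.
have O := orth_invariant eps01 a_gtN1 su.1 (fun r => sol_L2 (r := r) su)
  (inv et (erefl 0)) (erefl 0) spsi supp.
have suppD := supp_in_derive (v := et) supp.
have E : ip (fun p => inQ r p * u p) (fun p => 'D_et psi p) = 0.
  by rewrite (ip_inQ _ _ su.1 suppD Ar Br).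
have S := etrans (esym E) W.
rewrite sum_option big1 in S.
  by rewrite add0r in S; exact: (esym S).
by move=> i _; exact: (tangential_orth i su inv r1 sUV spsi supp Ar Br).
Qed.

Lemma ey_scale c : (c *: ey).1.2 = c /\ (c *: ey).2 = 0 /\ sqnormz (c *: ey).1 = c ^+ 2.
Proof.
split; first by rewrite /= [_ *: 1]mulr1.
split; first by rewrite /= [_ *: 0]mulr0.
rewrite sqnormzZ sqnormzE (bigD1 None)//= big1 ?addr0 ?expr1n ?mulr1//.
by move=> [i|]//= _; rewrite mxE expr0n.
Qed.

(* Shifting [psi] below the boundary turns orthogonality to normal
   derivatives into orthogonality to [psi] itself. *)
Lemma normal_orth_test r u V psi A B : sol u -> (forall h, h.1.2 = 0 -> invariant h u) ->
  1 <= r -> sol_at r (fun p => inQ r p * u p) V ->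
  smooth psi -> supp_in A B psi -> 0 <= A -> 2 * A + 2 * (A + 1) ^+ 2 < r ^+ 2 ->
  B < r ^+ 2 -> ip (V None) psi = 0.
Proof.
move=> su inv r1 sUV spsi supp A0 Ar Br.
have [LU LV aUV wUV] := sUV.
have A1sq : A < (A + 1) ^+ 2 by exact: big_radius.
(* The support of [psi] satisfies y^2 <= A < c^2, so psi(. + c ey) vanishes in the whole half-space
   and only -psi is left of the difference. *)
pose c := A + 1; have c0 : 0 < c by rewrite /c; lra.
have [hy [ht hz]] := ey_scale c.
have LQ : L2 (fun p => inQ r p * 1).
  by apply: L2_inQ_smooth => //; exact: smooth_cst.
pose theta p := w p * ((inQ r p * 1) * V None p).
have ti : intgb theta by exact: L2_intgb.
have sD : smooth (fun p => 'D_(c *: ey) psi p) by exact: smooth_derive.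
have suppD := supp_in_derive (v := c *: ey) supp.
have [k k0 Fc] := supp_in_bounded (smooth_continuous spsi) supp.
have [k' k'0 Dc] := supp_in_bounded (smooth_continuous sD) suppD.
have [||s s01 E] := @J_mean_value R N theta psi (c *: ey) (Num.max k k') ti spsi.
- by move=> p s _ _; rewrite le_max Fc.
- by move=> p s _ _; rewrite le_max Dc orbT.
have Ar' : A < r ^+ 2 by have : 0 <= (A + 1) ^+ 2 := sqr_ge0 _; lra.
have z0 p : 0 < p.1.2 -> psi (p + c *: ey) = 0.
  move=> p0; apply/eqP; apply: contrapT => /negP /supp[H _].
  have := le_trans (comp_sqr_le None _) H; rewrite compD.
  have -> : comp None (c *: ey).1 = c by exact: hy.
  apply/negP; rewrite -ltNge; apply: (lt_trans A1sq).
  rewrite ltr_pXn2r// ?nnegrE /=; rewrite /c in c0 *; lra.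
have Lpsi : L2 psi by exact: supp_in_test_L2 supp.
have E1 : J (fun p => theta p * (psi (p + c *: ey) - psi p)) = - ip (V None) psi.
  rewrite -mulN1r -JZ; last exact: L2_intgb.
  apply: eq_J => p; rewrite /theta -[in RHS](inQ_supp p supp Ar' Br).
  have [p0|p0] := ltP 0 p.1.2; last by rewrite /wt ltNge p0 /= !mul0r mulr0.
  by rewrite z0//; ring.
pose psis p := psi (p + s *: (c *: ey)).
have spsis : smooth psis by exact: smooth_shift.
have suppS := supp_in_shift (h := s *: (c *: ey)) supp.
have st0 : (s *: (c *: ey)).2 = 0 by rewrite scalerA; have [_ []] := ey_scale (s * c).
have sz : sqnormz (s *: (c *: ey)).1 <= (A + 1) ^+ 2.
  rewrite scalerA; have [_ [_ ->]] := ey_scale (s * c).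
  by rewrite exprMn ler_piMl ?sqr_ge0//; case/andP: s01 => s0 s1; rewrite expr_le1 ?ltW.
have AS : 2 * A + 2 * sqnormz (s *: (c *: ey)).1 < r ^+ 2 by lra.
have BS : B + `|(s *: (c *: ey)).2| < r ^+ 2 by rewrite st0 normr0 addr0.
have O := normal_orth su inv r1 sUV spsis suppS AS BS.
have suppSD := supp_in_derive (v := ey) suppS.
have LSD : L2 (fun p => 'D_ey psis p).
  by apply: (supp_in_test_L2 eps01 a_gtN1 _ suppSD); exact: smooth_derive.
have E2 : J (fun p => theta p * 'D_(c *: ey) psi (p + s *: (c *: ey))) =
    c * ip (V None) (fun p => 'D_ey psis p).
  rewrite -JZ; last exact: L2_intgb.
  apply: eq_J => p; rewrite derive_dirZ// /theta.
  have X : 'D_ey psis p = 'D_ey psi (p + s *: (c *: ey)) by exact: derive_shiftp.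
  rewrite -X -[in RHS](inQ_supp p suppSD AS BS).
  by have [->|->] := inQ_01 r p; ring.
rewrite E1 E2 O mulr0 in E.
by apply/eqP; rewrite -oppr_eq0 E.
Qed.

(** [cutsq q] times the normal derivative of an approximant is an admissible [psi] in
    [normal_orth_test]; in the limit [V None] is orthogonal to [cutsq q * V None], hence zero on
    [Q q]. The conclusion is phrased with approximants because finite normal differences are
    estimated on smooth functions. *)
Lemma normal_derivative_eq0 q u : sol u -> (forall h, h.1.2 = 0 -> invariant h u) ->
  1 <= q -> forall d, 0 < d -> exists phi, [/\ smooth phi,
   nrm (fun p => inQ q p * phi p - inQ q p * u p) <= d &
   nrm (fun p => inQ q p * 'D_ey phi p) <= d].
Proof.
move=> su inv q1.
(* The test function has A = 4 q^2 and is shifted by up to A + 1, which needs 2 A + 2 (A + 1)^2 <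
   r^2; this holds since q >= 1. *)
pose r := 8 * q ^+ 2.
have q0 : 0 < q by lra.
have q2 : 1 <= q ^+ 2 by rewrite expr_ge1// ltW.
have qq : q <= q ^+ 2 by rewrite expr2 ler_peMr//; lra.
have r1 : 1 <= r by rewrite /r; lra.
have rq3 : 3 * q <= r by rewrite /r; lra.
have qr : q <= r by lra.
have [V sUV] := su.2 r r1.
have [LU LV aUV wUV] := sUV.
have A0 : 0 <= 4 * q ^+ 2 by lra.
have Ar : 2 * (4 * q ^+ 2) + 2 * (4 * q ^+ 2 + 1) ^+ 2 < r ^+ 2.
  by rewrite /r; set x := q ^+ 2 in q2 *; nra.
have Br : 2 * q ^+ 2 < r ^+ 2.
  by rewrite /r; set x := q ^+ 2 in q2 *; nra.
have LcV : L2 (fun p => cutsq q p * V None p) by exact: L2_cutsqM.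
have Z : ip (V None) (fun p => cutsq q p * V None p) = 0.
  apply: norm_eq0 => d d0.
  have [d1 d10 H1] := ip_small (LV None) d0.
  have [phi [sphi A1 A2]] := aUV d1 d10.
  have sDphi : smooth (fun p => 'D_ey phi p) by exact: smooth_derive.
  have spsi := cutsqM_smooth q sDphi.
  have supp := supp_inMl (g := fun p => 'D_ey phi p) (@supp_cutsq R N q q0).
  have O := normal_orth_test su inv r1 sUV spsi supp A0 Ar Br.
  have Lpsi : L2 (fun p => cutsq q p * 'D_ey phi p) by exact: supp_in_test_L2 supp.
  have B := nrm_cutsq_approx eps01 a_gtN1 q1 rq3 sDphi (LV None) (A2 None).
  have LB := L2B Lpsi LcV.
  have := H1 _ LB B; rewrite (ipBr Lpsi LcV (LV None)) O sub0r normrN => X.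
  by apply: (le_trans X); rewrite ler_peMl ?(ltW d0)// ler1n.
have Z1 : nrm (fun p => inQ q p * V None p) = 0.
  apply/le_anti; rewrite nrm_ge0 andbT.
  apply: (le_trans (nrm_inQ_cutoff q1 (LV None))).
  have -> : nrm (fun p => cutoff q p * V None p) = 0.
    by rewrite -[RHS]Z; apply: eq_ip => p _; rewrite /cutsq; ring.
  by rewrite mulr0.
have subq p : Q q p -> Q r p by apply: Q_le => //; exact: ltW.
move=> d d0; have d2 : 0 < d / 2 by rewrite divr_gt0.
have [phi [sphi A1 A2]] := aUV _ d2.
have sDphi : smooth (fun p => 'D_ey phi p) by exact: smooth_derive.
have L1 : L2 (fun p => inQ r p * phi p - inQ r p * u p).
  by apply: L2B => //; exact: L2_inQ_smooth.
have L2' : L2 (fun p => inQ r p * 'D_ey phi p - V None p).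
  by apply: L2B => //; exact: L2_inQ_smooth.
have dd : d / 2 <= d by lra.
exists phi; split => //.
  apply: le_trans dd; apply: le_trans A1; apply: le_trans (nrm_inQM q L1).
  apply: eq_ler; apply: eq_ip => p _.
  have [q1'|->] := inQ_01 q p; last by ring.
  by rewrite q1' ((inQP r p).2 (subq _ ((inQP _ _).1 q1'))); ring.
have LQV : L2 (fun p => inQ q p * V None p) by exact: L2_inQM.
have LQD : L2 (fun p => inQ q p * (inQ r p * 'D_ey phi p - V None p)) by exact: L2_inQM.
have -> : nrm (fun p => inQ q p * 'D_ey phi p) =
   nrm (fun p => inQ q p * (inQ r p * 'D_ey phi p - V None p) + inQ q p * V None p).
  apply: eq_ip => p _; have [q1'|->] := inQ_01 q p; last by ring.
  by rewrite q1' ((inQP r p).2 (subq _ ((inQP _ _).1 q1'))); ring.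
apply: (le_trans (nrmD_le LQD LQV)); rewrite Z1 mulr0 addr0.
have := le_trans (nrm_inQM q L2') (A2 None).
set X := nrm _; lra.
Qed.

End normal_derivative.

(** * Normal translations, away from the boundary *)

Section normal_invariance.
Context {R : realType} {N : nat} (eps a : R).
Hypotheses (eps01 : 0 <= eps < 1) (a_gtN1 : -1 < a).
Local Notation ZT := ('rV[R]_N * R * R)%type.
Local Notation mR := (measurableTypeR R).
Local Notation mZT := ('rV[mR]_N * mR * mR)%type.
Local Notation leb := (@lebesgue_zt R N).
Local Notation w := (@wt R N eps a).
Local Notation L20 := (@L2 R N eps 0).
Local Notation ip0 := (@ip R N eps 0).
Local Notation nrm0 := (@nrm R N eps 0).
Local Notation L2 := (@L2 R N eps a).
Local Notation ip := (@ip R N eps a).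
Local Notation nrm := (@nrm R N eps a).
Local Notation sol := (@sol R N eps a).
Local Notation ey := (dir None : ZT).
Implicit Types (u F f g phi : ZT -> R).
Implicit Types (p h : ZT) (c r s d q k : R).

(** The weight can only degenerate at y = 0 or at infinity. A positive lower bound on [k, q] allows
    weighted norms to control unweighted ones, which normal shifts do preserve. *)
Lemma rho_lb k q : 0 < k -> 1 <= q -> exists2 m, 0 < m &
  forall y, k <= y <= q -> m <= rho eps a y.
Proof.
move=> k0 q1; have e0 : 0 <= eps by case/andP: eps01.
have e1 : eps <= 1 by case/andP: eps01 => _ /ltW.
exists (Num.min ((k ^+ 2) `^ (a / 2)) ((1 + q ^+ 2) `^ (a / 2))).
  by rewrite lt_min !powR_gt0 ?exprn_gt0// ltr_wpDr// sqr_ge0.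
move=> y /andP[ky yq]; have y0 : 0 < y by lra.
have y2 : 0 < y ^+ 2 by rewrite exprn_gt0.
have ey0 : 0 < eps ^+ 2 + y ^+ 2 by rewrite ltr_wpDl// sqr_ge0.
rewrite ge_min; apply/orP; have [a0|a0] := leP 0 a.
  left; apply: ge0_ler_powR; rewrite ?nnegrE ?sqr_ge0 ?(ltW ey0)//; first by lra.
  apply: (@le_trans _ _ (y ^+ 2)); first by rewrite lerXn2r ?nnegrE ?(ltW k0) ?(ltW y0).
  by rewrite lerDr sqr_ge0.
right; rewrite /rho; have -> : a / 2 = - (- (a / 2)) by rewrite opprK.
rewrite [leLHS]powRN [leRHS]powRN.
have Q0 : 0 < 1 + q ^+ 2 by rewrite ltr_wpDr// sqr_ge0.
rewrite lef_pV2 ?posrE ?powR_gt0//.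
apply: ge0_ler_powR; rewrite ?nnegrE ?(ltW ey0) ?(ltW Q0)//; first by lra.
apply: lerD; first by rewrite expr_le1.
by rewrite lerXn2r ?nnegrE//; lra.
Qed.

Definition slab r k p : R := inQ r p * (\1_[set p : mZT | k < p.1.2] : ZT -> R) p.

Lemma slab_01 r k p : slab r k p = 1 /\ Q r p /\ k < p.1.2 \/ slab r k p = 0.
Proof.
rewrite /slab indicE; have [q1|->] := inQ_01 r p; last by right; rewrite mul0r.
rewrite q1 mul1r; have [H|H] := ltP k p.1.2.
  by left; rewrite mem_set//; split => //; split => //; exact/inQP.
by right; rewrite memNset//=; apply/negP; rewrite -leNgt.
Qed.

Lemma mfun_slab r k : mfun (slab r k).
Proof.
apply: mfunM; first exact: mfun_inQ.
apply: mfun_indic.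
rewrite (_ : mkset _ = (fun p : mZT => p.1.2) @^-1` `]k, +oo[); last first.
  by apply/seteqP; split => p /=; rewrite in_itv/= andbT.
rewrite -[X in measurable X]setTI.
exact: (measurable_comp None measurableT (measurable_itv _)).
Qed.

(* [wt eps 0] is the indicator function of the half-space, so [nrm eps 0]
   computes unweighted norms. *)
Lemma slab_compare r q k m F h : 0 < m ->
  (forall y, k <= y <= q -> m <= rho eps a y) -> 0 < k ->
  (forall p, Q r p -> k < p.1.2 -> Q q (p + h) /\ k <= (p + h).1.2 <= q) ->
  mfun F -> L2 (fun p => inQ q p * F p) ->
  L20 (fun p => slab r k p * F (p + h)) /\
  nrm0 (fun p => slab r k p * F (p + h)) <= m^-1 * nrm (fun p => inQ q p * F p).
Proof.
move=> m0 mrho k0 sub mF LF.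
have iF := intgbZ m^-1 (intgb_shift h (L2_intgb LF LF)).
have mS : mfun (fun p => slab r k p * F (p + h)).
  by apply: mfunM; [exact: mfun_slab|exact: mfun_shift].
have mi0 : 0 < m^-1 by rewrite invr_gt0.
have dom p : wt eps 0 p * ((slab r k p * F (p + h)) * (slab r k p * F (p + h))) <=
    m^-1 * (w (p + h) * ((inQ q (p + h) * F (p + h)) * (inQ q (p + h) * F (p + h)))).
  have R0 : 0 <= m^-1 * (w (p + h) * ((inQ q (p + h) * F (p + h)) * (inQ q (p + h) * F (p + h)))).
    by apply: mulr_ge0; [exact: ltW|apply: mulr_ge0; [exact: wt_ge0|rewrite -expr2; exact: sqr_ge0]].
  have [[s1 [Qp kp]]|->] := slab_01 r k p; last by rewrite !mul0r mulr0.
  have [Qph kq] := sub p Qp kp.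
  have /andP[kph _] := kq.
  have yp : 0 < (p + h).1.2 by exact: lt_le_trans kph.
  rewrite s1 !mul1r ((inQP q (p + h)).2 Qph) !mul1r [leRHS]mulrA.
  apply: ler_wpM2r; first by rewrite -expr2 sqr_ge0.
  have -> : wt eps 0 p = 1.
    by rewrite /wt (lt_trans k0 kp) /rho mul0r powRr0.
  rewrite mulrC ler_pdivlMr// mul1r /wt yp; exact: mrho.
have L0 : L20 (fun p => slab r k p * F (p + h)).
  split => //; apply: (intgb_dom _ _ iF).
    by apply: mfunM; [exact: mfun_wt|exact: (mfunM mS mS)].
  move=> p; rewrite ger0_norm; first exact: dom.
  by rewrite mulr_ge0 ?wt_ge0// sqr_ge0.
split => //.
apply: (@le_trans _ _ (J (fun p => m^-1 * (w (p + h) * ((inQ q (p + h) * F (p + h)) *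
    (inQ q (p + h) * F (p + h))))))).
  by apply: le_J => //; exact: L2_intgb.
rewrite JZ; last exact: (intgb_shift h (L2_intgb LF LF)).
rewrite (J_shift (f := fun p => w p * ((inQ q p * F p) * (inQ q p * F p))))//.
exact: (intgb_mfun (L2_intgb LF LF)).
Qed.

Lemma slab_region r k c q p s : 0 < k -> 0 < c -> 1 <= r -> q = 2 * (r + c + c ^+ 2) ->
  0 <= s <= 1 -> Q r p -> k < p.1.2 ->
  Q q (p + s *: (c *: ey)) /\ k <= (p + s *: (c *: ey)).1.2 <= q.
Proof.
move=> k0 c0 r1 qE /andP[s0 s1] Qp kp.
have c2 : 0 < c ^+ 2 by rewrite exprn_gt0.
have [hy [ht hz]] := ey_scale (N := N) (s * c); rewrite -scalerA in hy ht hz.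
(* A radius at which [Q_shift] applies to every intermediate shift, since c^2 <= r' <= r'^2; [q] is
   twice this radius. *)
pose r' := r + c + c ^+ 2.
have r'1 : 1 <= r' by rewrite /r'; lra.
have r'2 : r' <= r' ^+ 2 by rewrite expr2 ler_peMr//; lra.
have Qr' : Q r' p by apply: Q_le Qp; rewrite /r'; lra.
have s2 : s ^+ 2 <= 1 by rewrite expr_le1.
split.
  rewrite qE; apply: Q_shift => //.
    rewrite hz exprMn; apply: le_trans r'2; rewrite /r'.
    have : s ^+ 2 * c ^+ 2 <= c ^+ 2 by rewrite ler_piMl// ltW.
    lra.
  by rewrite ht normr0 sqr_ge0.
have -> : (p + s *: (c *: ey)).1.2 = p.1.2 + s * c by rewrite -hy.
have sc : 0 <= s * c <= c by rewrite mulr_ge0 ?(ltW c0)//= ler_piMl// ltW.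
have pr : p.1.2 <= r.
  have [/= H _] := Qp; rewrite /ball_z/= in H.
  have := le_lt_trans (comp_sqr_le None p.1) H; rewrite /= => H'.
  rewrite -[p.1.2]ger0_norm; last by lra.
  by apply: sqr_norm_le; [lra|exact: ltW].
by case/andP: sc => sc0 scc; apply/andP; split; lra.
Qed.

Lemma L2_slab0_smooth r k f : 1 <= r -> smooth f -> L20 (fun p => slab r k p * f p).
Proof.
move=> r1 sf; have a0 : -1 < 0 :> R by lra.
have L0 := L2_inQ_smooth eps01 a0 sf r1.
apply: (@L2_dom _ _ _ _ _ _ 1 _ _ L0).
  by apply: mfunM; [exact: mfun_slab|exact: mfun_smooth].
move=> p _; rewrite mul1r /slab !normrM ler_wpM2r// ler_piMr//.
by rewrite indicE; case: (_ \in _); rewrite ?normr1 ?normr0.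
Qed.

(** The argument of [smooth_difference_quotient], with the unweighted norm on the slab; the weight
    comes back through [slab_compare], at the price of 1/m. *)
Lemma slab_difference r k c q m phi : 1 <= r -> 0 < k -> 0 < c ->
  q = 2 * (r + c + c ^+ 2) -> 0 < m ->
  (forall y, k <= y <= q -> m <= rho eps a y) -> smooth phi ->
  nrm0 (fun p => slab r k p * diff (c *: ey) phi p) <=
  4 * (m^-1 * (c ^+ 2 * nrm (fun p => inQ q p * 'D_ey phi p))).
Proof.
move=> r1 k0 c0 qE m0 mrho sphi.
have q1 : 1 <= q by have := sqr_ge0 c; rewrite qE; lra.
have sdphi := smooth_diff (c *: ey) sphi.
have sD : smooth (fun p => 'D_(c *: ey) phi p) by exact: smooth_derive.
have Ls : L20 (fun p => slab r k p * diff (c *: ey) phi p) by exact: L2_slab0_smooth.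
have Ls1 : L20 (fun p => slab r k p * 1).
  by apply: L2_slab0_smooth => //; exact: smooth_cst.
pose theta p := wt eps 0 p * ((slab r k p * 1) * (slab r k p * diff (c *: ey) phi p)).
have ti : intgb theta by exact: L2_intgb.
pose A := 2 * r ^+ 2 + 2 * (4 * c ^+ 2).
have [C C0 HC] := cyl_bounded A (r ^+ 2) (smooth_continuous sphi).
have [C' C'0 HC'] := cyl_bounded A (r ^+ 2) (smooth_continuous sD).
have cylP p s : -1 < s < 2 -> theta p != 0 -> cyl A (r ^+ 2) (p + s *: (c *: ey)).
  move=> /andP[s0 s1] tp.
  have [[_ [[/= H1 H2] _]]|S0] := slab_01 r k p; last first.
    by move: tp; rewrite /theta S0 !mul0r mulr0 eqxx.
  have [hy [ht hz]] := ey_scale (N := N) (s * c); rewrite -scalerA in hy ht hz.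
  have s4 : s ^+ 2 <= 4 by nra.
  have c2 : 0 < c ^+ 2 by rewrite exprn_gt0.
  split.
    apply: (le_trans (sqnormzD_le _ _)); rewrite /A; apply: lerD.
      by rewrite ler_pM2l// ltW.
    by rewrite ler_pM2l// hz exprMn ler_wpM2r// ltW.
  rewrite [_.2](_ : _ = p.2); last by rewrite -[RHS]addr0 -ht.
  by move: H2; rewrite /Itime/= in_itv/= -ltr_norml => /ltW.
have [||s s01 E] := @J_mean_value R N theta phi (c *: ey) (Num.max C C') ti sphi.
- by move=> p s s12 tp; rewrite le_max HC//; exact: cylP.
- by move=> p s s12 tp; rewrite le_max HC' ?orbT//; exact: cylP.
have s01' : 0 <= s <= 1 by case/andP: s01 => s0 s1; rewrite !ltW.
have sub p : Q r p -> k < p.1.2 ->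
    Q q (p + s *: (c *: ey)) /\ k <= (p + s *: (c *: ey)).1.2 <= q.
  by move=> Qp kp; exact: (slab_region k0 c0 r1 qE s01' Qp kp).
have LD : L2 (fun p => inQ q p * 'D_(c *: ey) phi p) by exact: L2_inQ_smooth.
have [LDs HDs] := slab_compare m0 mrho k0 sub (mfun_smooth sD) LD.
have E1 : nrm0 (fun p => slab r k p * diff (c *: ey) phi p) =
    ip0 (fun p => slab r k p * diff (c *: ey) phi p)
      (fun p => slab r k p * 'D_(c *: ey) phi (p + s *: (c *: ey))).
  transitivity (J (fun p => theta p * (phi (p + c *: ey) - phi p))).
    apply: eq_J => p; rewrite /theta /diff.
    by have [[-> _]|->] := slab_01 r k p; ring.
  rewrite E; apply: eq_J => p; rewrite /theta; ring.
have h12 : 0 < 2^-1 :> R by rewrite invr_gt0.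
have := ip_young h12 Ls LDs; rewrite -E1 => /absorb_le Y; apply: (le_trans Y).
apply: ler_wpM2l; first exact: ler0n.
apply: (le_trans HDs); apply: ler_wpM2l; first by rewrite invr_ge0 ltW.
have LDy : L2 (fun p => inQ q p * 'D_ey phi p).
  exact: (L2_inQ_smooth eps01 a_gtN1 (smooth_derive ey sphi) q1).
rewrite -(nrmZ c LDy); apply: eq_ler; apply: eq_ip => p _.
by rewrite derive_dirZ//; ring.
Qed.

Lemma normal_shift_le (x y1 y2 d M K : R) : x <= 2 * y1 + 2 * (2 * y2 + 2 * y2) ->
  y1 <= 4 * (M * (K * d)) -> y2 <= M * d -> x <= (8 * M * K + 8 * M) * d.
Proof. by move=> H1 H2 H3; apply: (le_trans H1); lra. Qed.

(** The difference of [u] is that of an approximant [phi] minus that of the error phi - u. The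
    former is small because the normal derivative of [phi] is, the latter because both of its terms
    are. Only upward shifts are used, which stay away from the boundary. *)
Lemma normal_shift u c : sol u -> (forall h, h.1.2 = 0 -> invariant h u) -> 0 < c ->
  {ae leb, forall p : ZT, 0 < p.1.2 -> diff (c *: ey) u p = 0}.
Proof.
move=> su inv c0.
have c2 : 0 < c ^+ 2 by rewrite exprn_gt0.
have a0 : -1 < 0 :> R by lra.
(* The slabs |z| < n + 1, |t| < (n + 1)^2, y > 1/(n + 1) exhaust the half-space. *)
have H n : {ae leb, forall p : ZT, 0 < p.1.2 -> slab n.+1%:R n.+1%:R^-1 p * diff (c *: ey) u p = 0}.
  set r : R := n.+1%:R; set k := r^-1.
  have r1 : 1 <= r by rewrite ler1n.
  have k0 : 0 < k by rewrite invr_gt0; lra.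
  pose q := 2 * (r + c + c ^+ 2).
  have q1 : 1 <= q by rewrite /q; lra.
  have [m m0 mrho] := rho_lb k0 q1.
  have Mi : 0 <= m^-1 by rewrite invr_ge0 ltW.
  have Lu : L2 (fun p => inQ q p * u p) by exact: sol_L2.
  have subc p : Q r p -> k < p.1.2 -> Q q (p + c *: ey) /\ k <= (p + c *: ey).1.2 <= q.
    move=> Qp kp; have := @slab_region r k c q p 1 k0 c0 r1 (erefl _).
    by rewrite scale1r lexx ler01; exact.
  have sub0 p : Q r p -> k < p.1.2 -> Q q (p + 0) /\ k <= (p + 0).1.2 <= q.
    move=> Qp kp; have := @slab_region r k c q p 0 k0 c0 r1 (erefl _).
    by rewrite scale0r lexx ler01; exact.
  have [Lc _] := slab_compare m0 mrho k0 subc su.1 Lu.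
  have [L0 _] := slab_compare m0 mrho k0 sub0 su.1 Lu.
  have LS : L20 (fun p => slab r k p * diff (c *: ey) u p).
    have := L2B Lc L0; rewrite (_ : (fun p => slab r k p * u (p + c *: ey) - slab r k p * u (p + 0)) =
      (fun p => slab r k p * diff (c *: ey) u p))//.
    by apply/funext => p; rewrite addr0 /diff; ring.
  apply: (nrm0_ae LS); apply/le_anti; rewrite nrm_ge0 andbT.
  apply: (@ler_addgt0M _ _ _ (8 * m^-1 * c ^+ 2 + 8 * m^-1)).
    by apply: addr_ge0; rewrite mulr_ge0 ?(ltW c2)// mulr_ge0.
  move=> d d0; rewrite add0r.
  have [phi [sphi A1 A2]] := normal_derivative_eq0 eps01 a_gtN1 su inv q1 d0.
  pose g p := phi p - u p.
  have mg : mfun g by apply: mfunB; [exact: mfun_smooth|exact: su.1].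
  have Lg : L2 (fun p => inQ q p * g p).
    have := L2B (L2_inQ_smooth eps01 a_gtN1 sphi q1) Lu.
    by congr L2; apply/funext => p; rewrite /g; ring.
  have Ag : nrm (fun p => inQ q p * g p) <= d.
    by apply: le_trans A1; apply: eq_ler; apply: eq_ip => p _; rewrite /g; ring.
  have [Lgc Hgc] := slab_compare m0 mrho k0 subc mg Lg.
  have [Lg0 Hg0] := slab_compare m0 mrho k0 sub0 mg Lg.
  have Lphi := L2_slab0_smooth k r1 (smooth_diff (c *: ey) sphi).
  have E : nrm0 (fun p => slab r k p * diff (c *: ey) u p) =
      nrm0 (fun p => slab r k p * diff (c *: ey) phi p -
        (slab r k p * g (p + c *: ey) - slab r k p * g (p + 0))).
    by apply: eq_ip => p _; rewrite /diff /g addr0; ring.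
  have B1 := nrmB_le Lphi (L2B Lgc Lg0).
  have B2 := nrmB_le Lgc Lg0.
  have B3 := slab_difference r1 k0 c0 (erefl q) m0 mrho sphi.
  have M1 x : x <= m^-1 * nrm (fun p => inQ q p * g p) -> x <= m^-1 * d.
    by move=> /le_trans; apply; apply: ler_wpM2l.
  apply: (@normal_shift_le _ (nrm0 (fun p => slab r k p * diff (c *: ey) phi p))
     (Num.max (nrm0 (fun p => slab r k p * g (p + c *: ey)))
              (nrm0 (fun p => slab r k p * g (p + 0))))).
  - rewrite E; apply: (le_trans B1); rewrite lerD2l; apply: ler_wpM2l; first exact: ler0n.
    apply: (le_trans B2); apply: lerD; apply: ler_wpM2l; try exact: ler0n.
      by rewrite le_max lexx.
    by rewrite le_max lexx orbT.
  - apply: (le_trans B3); apply: ler_wpM2l; first exact: ler0n.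
    by apply: ler_wpM2l => //; apply: ler_wpM2l; [exact: ltW|exact: A2].
  - by rewrite ge_max; apply/andP; split; exact: M1.
apply: (aeS (ae_forall H)) => p Hp p0.
pose X := sqnormz p.1 + `|p.2| + p.1.2^-1.
have y0 : 0 < p.1.2^-1 by rewrite invr_gt0.
have S0 := sqnormz_ge0 p.1; have T0 := normr_ge0 p.2.
have X0 : 0 <= X by rewrite /X; lra.
have Xs : sqnormz p.1 <= X by rewrite /X; lra.
have Xt : `|p.2| <= X by rewrite /X; lra.
have Xy : p.1.2^-1 <= X by rewrite /X; lra.
pose n := Num.truncn X.
have Xn : X < n.+1%:R by exact: truncnS_gt.
have n1 : 1 <= n.+1%:R :> R by rewrite ler1n.
have nn : n.+1%:R <= n.+1%:R ^+ 2 :> R by rewrite expr2 ler_peMr//; lra.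
have Qp : Q n.+1%:R p.
  split => /=.
    by rewrite /ball_z /=; apply: lt_le_trans nn; exact: le_lt_trans Xn.
  by rewrite /Itime/= in_itv/= -ltr_norml; apply: lt_le_trans nn; exact: le_lt_trans Xn.
have kp : n.+1%:R^-1 < p.1.2.
  rewrite invf_plt ?posrE//.
  exact: le_lt_trans Xn.
have := Hp n p0; rewrite /slab ((inQP _ _).2 Qp) indicE mem_set// !mul1r.
exact.
Qed.

End normal_invariance.

(** * From invariance to constancy *)

Lemma ae_xsection d1 d2 (T1 : measurableType d1) (T2 : measurableType d2)
    (R : realType) (m1 : {sigma_finite_measure set T1 -> \bar R})
    (m2 : {sigma_finite_measure set T2 -> \bar R}) (A : set (T1 * T2)) :
  measurable A -> (forall y, m1 (ysection A y) = 0)%E ->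
  {ae m1, forall x, m2 (xsection A x) = 0}%E.
Proof.
move=> mA A0.
have E := indic_fubini_tonelli m1 m2 mA.
have G0 : (\int[m2]_y (m1 \o ysection A) y = 0)%E.
  by apply: integral0_eq => y _ /=; exact: A0.
rewrite indic_fubini_tonelli_GE// G0 indic_fubini_tonelli_FE// in E.
have mF : measurable_fun setT (m2 \o xsection A) by exact: measurable_fun_xsection.
have : (\int[m1]_x `|(m2 \o xsection A) x| = 0)%E.
  by under eq_integral do rewrite gee0_abs ?measure_ge0//.
move/(ae_eq_integral_abs m1 measurableT mF).1.
by apply: filterS => x /= /(_ I).
Qed.

Section constancy.
Context {R : realType} {N : nat}.
Local Notation ZT := ('rV[R]_N * R * R)%type.
Local Notation mR := (measurableTypeR R).
Local Notation mZT := ('rV[mR]_N * mR * mR)%type.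
Local Notation leb := (@lebesgue_zt R N).
Implicit Types (u : ZT -> R) (P : ZT -> Prop) (p h v : ZT).

(** The box has measure 1, so a null set cannot cover it. Having the point in a fixed bounded set is
    what makes the growth bound uniform later. *)
Lemma ae_unit_box_ex P : {ae leb, forall p : ZT, P p} ->
  exists p, [/\ 0 < p.1.2, forall i, 0 <= comp i p.1 <= 1, 0 <= p.2 <= 1 & P p].
Proof.
move=> H; apply: contrapT => nex.
have [A [mA A0 HA]] : {ae leb, forall p : ZT, 0 < p.1.2 ->
    (forall i, 0 <= comp i p.1 <= 1) -> 0 <= p.2 <= 1 -> False}.
  by apply: (aeS H) => p Hp p0 p1 p2; apply: nex; exists p.
pose X : set 'rV[mR]_N := [set v | forall i, (`[0, 1]%classic : set R) (v ord0 i)].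
pose I : set mR := `]0, 1]%classic.
have mI : measurable I by exact: measurable_itv.
have mX : measurable X.
  rewrite (_ : X = \bigcap_(i in [set: 'I_N])
      ((fun v : 'rV[mR]_N => v ord0 i) @^-1` `[0, 1])).
    apply: fin_bigcap_measurable; first exact: finite_finset.
    move=> i _; rewrite -[X in measurable X]setTI.
    exact: (measurable_rV_coord i measurableT (measurable_itv _)).
  by apply/seteqP; split => v /= K i; [move=> _|]; exact: K.
have lI : lebesgue_measure I = 1%E.
  by apply: etrans (lebesgue_measure_itv _) _; rewrite /= lte_fin ltr01 -EFinB subr0.
have lX : lebesgue_rV N X = 1%E.
  have m01 (i : 'I_N) : measurable (`[0, 1]%classic : set R) by exact: measurable_itv.
  apply: etrans (lebesgue_rV_box m01) _; rewrite big1// => i _.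
  by apply: etrans (lebesgue_measure_itv _) _; rewrite /= lte_fin ltr01 -EFinB subr0.
have mXI : measurable (X `*` I) by exact: measurableX.
have lXI : lebesgue_z N (X `*` I) = 1%E.
  apply: etrans (product_measure1E (lebesgue_rV N) lebesgue_measure mX mI) _.
  by rewrite [X in (X * _)%E]lX [X in (_ * X)%E]lI mul1e.
have lB : leb ((X `*` I) `*` I) = 1%E.
  apply: etrans (product_measure1E (lebesgue_z N) lebesgue_measure mXI mI) _.
  by rewrite [X in (X * _)%E]lXI [X in (_ * X)%E]lI mul1e.
have : (leb ((X `*` I) `*` I) <= leb A)%E.
  apply: le_measure; rewrite ?inE//; first exact: measurableX.
  move=> p [[/= Xp]]; rewrite /I/= !in_itv/= => /andP[y0 y1] /andP[t0 t1].
  apply: HA => /= K; apply: K => //.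
    case=> [i|] /=; last by rewrite (ltW y0).
    by have := Xp i; rewrite /= in_itv.
  by rewrite (ltW t0).
by rewrite lB A0 lee_fin ler10.
Qed.

Lemma ae_half_space_ex P : {ae leb, forall p : ZT, P p} ->
  exists2 p, 0 < p.1.2 & P p.
Proof. by move=> /ae_unit_box_ex[p [p0 _ _ Pp]]; exists p. Qed.

(** The exceptional null set depends on [h]. Fubini on the set [A] of bad pairs (p, h) exchanges the
    roles: almost every [p] is good for almost every [h]. For one such [p0], the function is equal
    to u(p0) at almost every p0 + h of the half-space. *)
Lemma const_of_invariance u : mfun u ->
  (forall h, {ae leb, forall p : ZT, 0 < p.1.2 -> 0 < (p + h).1.2 -> u (p + h) = u p}) ->
  exists c, {ae leb, forall p : ZT, 0 < p.1.2 -> u p = c}.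
Proof.
move=> mu inv.
have madd : measurable_fun [set: mZT * mZT] (fun x : mZT * mZT => (x.1 : ZT) + x.2 : mZT).
  apply: measurable_fun_pair => /=; last first.
    apply: measurable_funD; first exact: (measurableT_comp measurable_snd measurable_fst).
    exact: (measurableT_comp measurable_snd measurable_snd).
  have f1 : measurable_fun [set: mZT * mZT] (fun x : mZT * mZT => x.1.1).
    exact: (measurableT_comp measurable_fst measurable_fst).
  have f2 : measurable_fun [set: mZT * mZT] (fun x : mZT * mZT => x.2.1).
    exact: (measurableT_comp measurable_fst measurable_snd).
  apply: measurable_fun_pair => /=; last first.
    apply: measurable_funD; first exact: (measurableT_comp measurable_snd f1).
    exact: (measurableT_comp measurable_snd f2).
  apply: measurable_fun_rVP => i.
  rewrite (_ : (fun _ => _) = fun x : mZT * mZT => (x.1.1.1 ord0 i + x.2.1.1 ord0 i : mR)).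
    apply: measurable_funD.
      apply: (measurableT_comp (measurable_rV_coord i)).
      exact: (measurableT_comp measurable_fst f1).
    apply: (measurableT_comp (measurable_rV_coord i)).
    exact: (measurableT_comp measurable_fst f2).
  by apply/funext => x; rewrite mxE.
have my : measurable_fun [set: mZT] (fun p : mZT => p.1.2 : mR) by exact: (measurable_comp None).
have m1 : measurable_fun [set: mZT * mZT] (fun x : mZT * mZT => x.1.1.2 : mR).
  exact: (measurableT_comp my measurable_fst).
have m2 : measurable_fun [set: mZT * mZT] (fun x : mZT * mZT => ((x.1 : ZT) + x.2).1.2 : mR).
  exact: (measurableT_comp my madd).
have m3 : measurable_fun [set: mZT * mZT] (fun x : mZT * mZT => u ((x.1 : ZT) + x.2) - u x.1 : mR).
  apply: measurable_funB; first exact: (measurableT_comp mu madd).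
  exact: (measurableT_comp mu measurable_fst).
pose A : set (mZT * mZT) :=
  ((fun x : mZT * mZT => x.1.1.2 : mR) @^-1` `]0, +oo[) `&`
  (((fun x : mZT * mZT => ((x.1 : ZT) + x.2).1.2 : mR) @^-1` `]0, +oo[) `&`
  ((fun x : mZT * mZT => u ((x.1 : ZT) + x.2) - u x.1 : mR) @^-1` (~` [set 0]))).
have mA : measurable A.
  apply: measurableI; first by rewrite -[X in measurable X]setTI; exact: m1.
  apply: measurableI; first by rewrite -[X in measurable X]setTI; exact: m2.
  rewrite -[X in measurable X]setTI; apply: m3 => //.
  by apply: measurableC; exact: measurable_set1.
have A0 h : leb (ysection A h) = 0%E.
  apply: measure_negligible; first exact: measurable_ysection.
  apply: negligibleS (inv h) => p; rewrite /ysection/= inE /A /= !in_itv/= !andbT.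
  by move=> [p0 [ph0 nu]] H; apply: nu; rewrite H// subrr.
have [p0 y0 Ap0] : exists2 p0, 0 < p0.1.2 & leb (xsection A p0) = 0%E.
  apply: ae_half_space_ex.
  exact: (ae_xsection leb mA A0).
exists (u p0).
have S : {ae leb, forall h : ZT, 0 < (p0 + h).1.2 -> u (p0 + h) = u p0}.
  exists (xsection A p0); split => //; first exact: measurable_xsection.
  move=> h /= /not_implyP[h0 nu]; rewrite /xsection/= inE /A /= !in_itv/= !andbT.
  split => //; split => // /eqP; rewrite subr_eq0 => /eqP; exact: nu.
apply: (aeS (ae_shift (- p0) S)) => q Hq q0.
by have := Hq; rewrite addrCA subrr addr0; exact.
Qed.

End constancy.

Section invariant_solutions.
Context {R : realType} {N : nat} (eps a : R).
Hypotheses (eps01 : 0 <= eps < 1) (a_gtN1 : -1 < a).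
Local Notation ZT := ('rV[R]_N * R * R)%type.
Local Notation leb := (@lebesgue_zt R N).
Local Notation sol := (@sol R N eps a).
Local Notation ey := (dir None : ZT).
Implicit Types (u : ZT -> R) (p h : ZT).

Lemma invariant_solution_const u : sol u ->
  (forall h, h.1.2 = 0 -> {ae leb, forall p : ZT, 0 < p.1.2 -> diff h u p = 0}) ->
  exists c, {ae leb, forall p : ZT, 0 < p.1.2 -> u p = c}.
Proof.
move=> su H.
have inv h : h.1.2 = 0 -> invariant h u.
  by move=> h0 s; apply: H; rewrite /= h0 scaler0.
apply: (const_of_invariance su.1) => h.
(* An upward shift is a normal shift followed by a tangential one, both staying in the half-space. A
   downward shift [h] is reduced to this by reading the statement for [- h] at p + h. *)
have up h' : 0 <= h'.1.2 ->
    {ae leb, forall p : ZT, 0 < p.1.2 -> 0 < (p + h').1.2 -> u (p + h') = u p}.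
  move=> h'0; set c := h'.1.2.
  have [c0|c0|c0] := ltgtP 0 c; last first.
  - apply: (aeS (H h' (esym c0))) => p Hp p0 _.
    by apply/eqP; rewrite -subr_eq0; apply/eqP; exact: Hp.
  - by move: h'0; rewrite leNgt c0.
  have N1 := normal_shift eps01 a_gtN1 su inv c0.
  have t0 : (h' - c *: ey).1.2 = 0.
    by have [E _] := ey_scale (N := N) c; rewrite -[LHS]/(h'.1.2 - (c *: ey).1.2) E subrr.
  have N2 := ae_shift (c *: ey) (H _ t0).
  apply: (aeS (aeI N1 N2)) => p [H1 H2] p0 _.
  have y0 : 0 < (p + c *: ey).1.2.
    have [E _] := ey_scale (N := N) c; rewrite -[X in 0 < X]/(p.1.2 + (c *: ey).1.2) E.
    exact: addr_gt0.
  have := H1 p0; have := H2 y0; rewrite /diff.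
  rewrite -addrA (addrC (c *: ey)) subrK => /eqP; rewrite subr_eq0 => /eqP -> /eqP.
  by rewrite subr_eq0 => /eqP.
have [h0|h0] := leP 0 h.1.2; first exact: up.
have hN : 0 <= (- h).1.2 by rewrite /= oppr_ge0 ltW.
apply: (aeS (ae_shift h (up _ hN))) => p Hp p0 ph0.
by have := Hp ph0; rewrite addrK => /(_ p0).
Qed.

End invariant_solutions.

(** * Entire solutions *)

Section entire_solutions.
Context {R : realType} {N : nat} (eps a : R).
Hypotheses (eps01 : 0 <= eps < 1) (a_gtN1 : -1 < a).
Local Notation ZT := ('rV[R]_N * R * R)%type.
Local Notation mR := (measurableTypeR R).
Local Notation mZT := ('rV[mR]_N * mR * mR)%type.
Local Notation leb := (@lebesgue_zt R N).
Local Notation w := (@wt R N eps a).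
Local Notation L2 := (@L2 R N eps a).
Local Notation ip := (@ip R N eps a).
Local Notation nrm := (@nrm R N eps a).
Local Notation sol := (@sol R N eps a).
Implicit Types (u U F G f phi : ZT -> R) (V : ZT -> 'rV[R]_N * R).
Implicit Types (p h v : ZT) (c r d : R).

(** An entire solution is measurable on the half-cylinders only and arbitrary for y <= 0; extension
    by 0 gives a function measurable on the whole space. *)
Definition half u p : R := if 0 < p.1.2 then u p else 0.

Lemma mfun_sum (I : Type) (s : seq I) (F : I -> ZT -> R) : (forall i, mfun (F i)) ->
  mfun (fun p => \sum_(i <- s) F i p).
Proof. by move=> mF; apply: measurable_sum => i; exact: mF. Qed.

Lemma mfun_sqr f : mfun f -> mfun (fun p => f p ^+ 2).
Proof. by move=> mf; under eq_fun do rewrite expr2; exact: mfunM. Qed.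

Lemma J_sum (I : Type) (s : seq I) (F : I -> ZT -> R) : (forall i, intgb (F i)) ->
  intgb (fun p => \sum_(i <- s) F i p) /\
  J (fun p => \sum_(i <- s) F i p) = \sum_(i <- s) J (F i).
Proof.
move=> iF; elim: s => [|i s [IH1 IH2]].
  have E : (fun p => \sum_(i <- [::]) F i p) = (fun _ : ZT => 0 * 0).
    by apply/funext => p; rewrite big_nil mul0r.
  have I0 : intgb (fun _ : ZT => 0 : R).
    by rewrite /intgb (_ : EFin \o _ = cst 0%E)//; exact: integrable0.
  by rewrite E big_nil; split; [exact: (intgbZ 0 I0)|rewrite (JZ 0 I0) mul0r].
have E : (fun p => \sum_(j <- i :: s) F j p) = (fun p => F i p + \sum_(j <- s) F j p).
  by apply/funext => p; rewrite big_cons.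
rewrite E big_cons; split; first exact: intgbD.
by rewrite (JD (iF i) IH1) IH2.
Qed.

Lemma QplusE r p : Qplus r p <-> Q r p /\ 0 < p.1.2.
Proof. by split => [[[]]|[[]]]. Qed.

Lemma measurable_Qplus r : measurable (Qplus r : set mZT).
Proof.
rewrite (_ : Qplus r = Q r `&` [set p | 0 < p.1.2]); last first.
  by apply/seteqP; split => p /QplusE.
by apply: measurableI; [exact: measurable_Q|exact: measurable_y_gt0].
Qed.

Lemma restrict_Qplus r f p : (f \_ (Qplus r)) p = inQ r p * half f p.
Proof.
rewrite patchE /half; case: ifPn => [|] /=; rewrite ?inE ?notin_setE.
  by move=> /QplusE[Qp ->]; rewrite ((inQP r p).2 Qp) mul1r.
move=> nQ; have [q1|->] := inQ_01 r p; last by rewrite mul0r.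
case: ifPn => // p0; last by rewrite mulr0.
by exfalso; apply/nQ/QplusE; split => //; exact/inQP.
Qed.

Lemma mfun_restrict_Qplus r f : measurable_fun (Qplus r : set mZT) (f : mZT -> mR) ->
  mfun (f \_ (Qplus r)).
Proof.
move=> mf; have mQ := measurable_Qplus r.
by apply/(measurable_restrict f mQ measurableT); rewrite setTI.
Qed.

Lemma mfun_half u :
  (forall n : nat, measurable_fun (Qplus n.+1%:R : set mZT) (u : mZT -> mR)) -> mfun (half u).
Proof.
move=> mu.
have mH : measurable ([set p | 0 < p.1.2] : set mZT) by exact: measurable_y_gt0.
have E : [set p : ZT | 0 < p.1.2] = \bigcup_n (Qplus n.+1%:R).
  apply/seteqP; split => p; last by move=> [n _ /QplusE[]].
  by move=> p0; have [n Qn] := Q_exhaust p; exists n => //; exact/QplusE.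
have -> : half u = u \_ [set p | 0 < p.1.2].
  by apply/funext => p; rewrite patchE /half mem_setE.
apply/(measurable_restrict u mH measurableT); rewrite setTI E.
apply/measurable_fun_bigcup; last by move=> n; exact: mu.
by move=> n; exact: measurable_Qplus.
Qed.

Lemma integral_Qplus r f :
  (\int[leb]_(p in Qplus r) (rho eps a p.1.2 * f p)%:E =
   \int[leb]_p (w p * (f \_ (Qplus r)) p)%:E)%E.
Proof.
rewrite integral_mkcond; apply: eq_integral => p _.
rewrite !patchE; case: ifPn => [|] /=; last by rewrite mulr0.
by rewrite inE => /QplusE[_ p0]; rewrite /wt p0.
Qed.

Lemma nrm_le_integral F X c : mfun F -> mfun X ->
  (forall p, w p * F p ^+ 2 <= X p) -> (\int[leb]_p (X p)%:E <= c%:E)%E ->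
  L2 F /\ nrm F <= c.
Proof.
move=> mF mX FX Xc.
have mw : mfun w by exact: mfun_wt.
have m2 : mfun (fun p => w p * F p ^+ 2).
  by apply: mfunM => //; exact: mfun_sqr.
have F0 p : 0 <= w p * F p ^+ 2 by rewrite mulr_ge0 ?wt_ge0// sqr_ge0.
have H : (\int[leb]_p (w p * F p ^+ 2)%:E <= c%:E)%E.
  apply: le_trans Xc; apply: ge0_le_integral => //.
  - by move=> p _; rewrite lee_fin.
  - exact: mfun_EFin.
  - exact: mfun_EFin.
  - by move=> p _; rewrite lee_fin.
have I : intgb (fun p => w p * F p ^+ 2).
  apply/integrableP; split; first exact: mfun_EFin.
  under eq_integral do rewrite /= ger0_norm//.
  by apply: le_lt_trans H _; rewrite ltry.
split; first by split.
by rewrite -lee_fin; apply: le_trans H; rewrite -EFin_J.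
Qed.

Lemma gradient_coord_measurable r V i : measurable_fun (Qplus r : set mZT) V ->
  measurable_fun (Qplus r : set mZT) (fun p => comp i (V p) : mR).
Proof.
move=> mV; case: i => [i|] /=; last exact: (measurableT_comp measurable_snd mV).
apply: (measurableT_comp (measurable_rV_coord i)).
exact: (measurableT_comp measurable_fst mV).
Qed.

Lemma normL2H1_le r u V c : 0 <= c ->
  (normL2H1 eps a r u V < c%:E)%E ->
  (\int[leb]_(p in Qplus r) (rho eps a p.1.2 * (u p ^+ 2 + sqnormz (V p)))%:E <= (c ^+ 2)%:E)%E.
Proof.
rewrite /normL2H1; set I := (\int[_]_(_ in _) _)%E => c0 H.
have I0 : (0 <= I)%E.
  apply: integral_ge0 => p _; rewrite lee_fin mulr_ge0 ?powR_ge0//.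
  by rewrite addr_ge0 ?sqr_ge0// sqnormz_ge0.
rewrite leNgt; apply/negP => K.
have c20 : (0 <= (c ^+ 2)%:E)%E by rewrite lee_fin sqr_ge0.
have h : 0 <= 2^-1 :> R by rewrite invr_ge0.
have := gt0_ler_poweR h _ _ (ltW K); rewrite !in_itv/= !leey !andbT => /(_ c20 I0).
rewrite leNgt => /negP; apply; apply: lt_le_trans H _.
by rewrite /= lee_fin powR12_sqrt ?sqr_ge0// sqrtr_sqr ger0_norm.
Qed.

(** Square integrability is not part of [L2H1]: it follows because the smooth approximants are
    square integrable on [Q r] and their distance to (u, V) is finite. *)
Lemma L2H1_approx r u V : 1 <= r -> L2H1 eps a r u V ->
  let U := u \_ (Qplus r) in
  let W i := (fun p => comp i (V p)) \_ (Qplus r) in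
  [/\ L2 U, forall i, L2 (W i) & approx eps a r U W].
Proof.
move=> r1 [mu mV [phi [sphi cphi]]] U W.
have mU : mfun U by exact: mfun_restrict_Qplus.
have mW i : mfun (W i) by apply: mfun_restrict_Qplus; exact: gradient_coord_measurable.
have key d : 0 < d -> exists k,
    (L2 (fun p => inQ r p * half (phi k) p - U p) /\
     nrm (fun p => inQ r p * half (phi k) p - U p) <= d) /\
    forall i, L2 (fun p => inQ r p * half (fun p => 'D_(dir i) (phi k) p) p - W i p) /\
     nrm (fun p => inQ r p * half (fun p => 'D_(dir i) (phi k) p) p - W i p) <= d.
  move=> d0; have s0 : 0 < Num.sqrt d by rewrite sqrtr_gt0.
  have [k Hk] : exists k, (normL2H1 eps a r (fun p => phi k p - u p)%R
      (fun p => gradz (phi k) p - V p)%R < (Num.sqrt d)%:E)%E.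
    have /cphi[k _ Hk] : nbhs 0%E [set x : \bar R | x < (Num.sqrt d)%:E]%E.
      by apply: open_nbhs_nbhs; split; [exact: open_ereal_lt_ereal|rewrite /= lte_fin].
    by exists k; apply: Hk => /=.
  exists k.
  pose F p := inQ r p * half (phi k) p - U p.
  pose G i p := inQ r p * half (fun p => 'D_(dir i) (phi k) p) p - W i p.
  have mF : mfun F.
    apply: mfunB => //; apply: mfunM; first exact: mfun_inQ.
    by apply: mfun_half => n; apply: (measurable_funS measurableT) => //; exact: mfun_smooth.
  have mG i : mfun (G i).
    apply: mfunB => //; apply: mfunM; first exact: mfun_inQ.
    by apply: mfun_half => n; apply: (measurable_funS measurableT) => //; exact: mfun_derive.
  pose X p := w p * (F p ^+ 2 + \sum_i G i p ^+ 2).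
  have mX : mfun X.
    apply: mfunM; first exact: mfun_wt.
    apply: mfunD; first exact: mfun_sqr.
    by apply: mfun_sum => i; exact: mfun_sqr.
  have := normL2H1_le (ltW s0) Hk; rewrite integral_Qplus (sqr_sqrtr (ltW d0)) => K.
  have {}K : (\int[leb]_p (X p)%:E <= d%:E)%E.
    apply: le_trans K; apply: eq_ler; apply: eq_integral => p _; congr (_ * _)%:E.
    rewrite /F /G /U /W; under eq_bigr do rewrite -restrict_Qplus.
    rewrite -restrict_Qplus !patchE; under eq_bigr do rewrite !patchE.
    case: ifPn => Qp.
      congr (_ + _); rewrite sqnormzE; apply: eq_bigr => i _.
      by rewrite compD compN comp_gradz.
    by rewrite subrr expr0n/= big1 ?addr0// => i _; rewrite subrr expr0n.
  have dom H : (forall p, H p ^+ 2 <= F p ^+ 2 + \sum_i G i p ^+ 2) ->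
      forall p, w p * H p ^+ 2 <= X p.
    by move=> HH p; rewrite ler_wpM2l ?wt_ge0.
  split; first apply: nrm_le_integral K => //.
    by apply: dom => p; rewrite lerDl sumr_ge0// => i _; exact: sqr_ge0.
  move=> i; apply: (nrm_le_integral (mG i) mX _ K).
  apply: (dom (G i)) => p; rewrite (bigD1 i)//= addrCA lerDl addr_ge0 ?sqr_ge0//.
  by rewrite sumr_ge0// => j _; exact: sqr_ge0.
have QH f : smooth f -> L2 (fun p => inQ r p * half f p).
  move=> sf; have Lf := L2_inQ_smooth eps01 a_gtN1 sf r1.
  apply: (L2_dom (c := 1) _ _ Lf).
    apply: mfunM; first exact: mfun_inQ.
    by apply: mfun_half => n; apply: (measurable_funS measurableT) => //; exact: mfun_smooth.
  by move=> p p0; rewrite /half p0 mul1r.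
(* Any finite distance would do for integrability; 1 is taken. *)
have [k [[LF _] LG]] := key 1 ltr01.
split.
- have := L2B (QH _ (sphi k)) LF; congr L2; apply/funext => p; ring.
- move=> i; have [LGi _] := LG i.
  have := L2B (QH _ (smooth_derive (dir i) (sphi k))) LGi.
  congr L2; apply/funext => p; ring.
move=> d d0; have [m [[_ HF] HG]] := key d d0; exists (phi m); split => //.
  by apply: le_trans HF; apply: eq_ler; apply: eq_ip => p p0; rewrite /half p0.
move=> i; have [_ HGi] := HG i.
by apply: le_trans HGi; apply: eq_ler; apply: eq_ip => p p0; rewrite /half p0.
Qed.

Lemma weak_formulation_weak r u V :
  let U := u \_ (Qplus r) in
  let W i := (fun p => comp i (V p)) \_ (Qplus r) in
  1 <= r -> L2 U -> (forall i, L2 (W i)) -> weak_formulation eps a r u V -> weak eps a r U W.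
Proof.
move=> U W r1 LU LW H psi A B spsi supp Ar Br.
have LD v : L2 (fun p => 'D_v psi p).
  apply: (supp_in_test_L2 eps01 a_gtN1 _ (supp_in_derive (v := v) supp)).
  exact: smooth_derive.
have := H _ (test_functionI spsi supp Ar Br).
have -> : (\int[leb]_(p in Qplus r) (rho eps a p.1.2 * u p * dt psi p)%:E =
    (ip U (fun p => 'D_et psi p))%:E)%E.
  under eq_integral do rewrite -mulrA.
  rewrite integral_Qplus EFin_J; last exact: L2_intgb.
  apply: eq_integral => p _; congr (_ * _)%:E; rewrite /U !patchE; case: ifP => // _.
  by rewrite mul0r.
have -> : (\int[leb]_(p in Qplus r) (rho eps a p.1.2 * dotz (V p) (gradz psi p))%:E =
    (\sum_i ip (W i) (fun p => 'D_(dir i) psi p))%:E)%E.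
  rewrite integral_Qplus.
  have iW i : intgb (fun p => w p * (W i p * 'D_(dir i) psi p)) by exact: L2_intgb.
  have [S1 S2] := J_sum (index_enum _) iW.
  apply: etrans (congr1 EFin S2); rewrite (EFin_J S1).
  apply: eq_integral => p _; congr EFin; rewrite -mulr_sumr; congr (_ * _).
  under [RHS]eq_bigr do rewrite /W patchE.
  rewrite patchE; case: ifP => _; last by rewrite big1// => i _; rewrite mul0r.
  by rewrite dotzE; apply: eq_bigr => i _; rewrite comp_gradz.
rewrite -EFinN -EFinD => -[/eqP]; rewrite addrC subr_eq0 => /eqP; exact: esym.
Qed.

Lemma sol_half u : entire_solution eps a u -> sol (half u).
Proof.
move=> H; split.
  apply: mfun_half => n; have n0 : (0 : R) < n.+1%:R by rewrite ltr0n.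
  by have [V [[mu _ _] _ _]] := H _ n0.
move=> r r1; have r0 : 0 < r by lra.
have [V [HV _ HW]] := H r r0.
exists (fun i => (fun p => comp i (V p)) \_ (Qplus r)).
have [LU LW aUW] := L2H1_approx r1 HV.
have -> : (fun p => inQ r p * half u p) = u \_ (Qplus r).
  by apply/funext => p; rewrite restrict_Qplus.
by split => //; exact: weak_formulation_weak.
Qed.

End entire_solutions.

(** Writing n s = m + r with 0 <= r <= 1 and [m] an integer, additivity gives n (f(s) - s f(1)) =
    f(r) - r f(1). This is at most 2 K for every [n], so the bracket is 0. *)
Lemma additive_bounded_linear (R : realType) (f : R -> R) (K : R) :
  (forall s t, f (s + t) = f s + f t) -> (forall s, `|s| <= 1 -> `|f s| <= K) ->
  forall s, f s = s * f 1.
Proof.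
move=> fD fK.
have f0 : f 0 = 0 by have := fD 0 0; rewrite addr0; lra.
have fM n s : f (n%:R * s) = n%:R * f s.
  elim: n => [|n IH]; first by rewrite !mul0r.
  by rewrite -addn1 natrD !mulrDl !mul1r fD IH.
have f1 : `|f 1| <= K by apply: fK; rewrite normr1.
have pos s : 0 <= s -> f s = s * f 1.
  move=> s0; apply/eqP; rewrite -subr_eq0; apply/negP => /negP ne0.
  have e0 : 0 < `|f s - s * f 1| by rewrite normr_gt0.
  pose n := (Num.truncn (2 * K / `|f s - s * f 1|)).+1.
  have nK : 2 * K < n%:R * `|f s - s * f 1|.
    by rewrite -ltr_pdivrMr// truncnS_gt.
  have ns0 : 0 <= n%:R * s by rewrite mulr_ge0.
  pose m := Num.truncn (n%:R * s); pose r := n%:R * s - m%:R.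
  have r0 : 0 <= r by rewrite subr_ge0 truncn_le.
  have r1 : r <= 1.
    by have := ltW (truncnS_gt (n%:R * s)); rewrite -/m -natr1 /r; lra.
  have E : n%:R * f s = m%:R * f 1 + f r.
    by rewrite -!fM -fD mulr1 /r addrC subrK.
  have E2 : n%:R * (f s - s * f 1) = f r - r * f 1 by rewrite mulrBr E /r; ring.
  have : n%:R * `|f s - s * f 1| <= 2 * K.
    rewrite -[n%:R]ger0_norm ?ler0n// -normrM E2.
    apply: (le_trans (ler_normB _ _)).
    have := fK r; rewrite ger0_norm// => /(_ r1).
    have : `|r * f 1| <= `|f 1| by rewrite normrM ger0_norm// ler_piMl.
    lra.
  lra.
move=> s; have [s0|s0] := leP 0 s; first exact: pos.
have := fD s (- s); rewrite subrr f0 (pos (- s)) ?oppr_ge0 ?ltW//; lra.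
Qed.

(** * Differences of solutions and linear solutions *)

Section assembly.
Context {R : realType} {N : nat} (eps a : R).
Hypotheses (eps01 : 0 <= eps < 1) (a_gtN1 : -1 < a).
Local Notation ZT := ('rV[R]_N * R * R)%type.
Local Notation L2 := (@L2 R N eps a).
Local Notation ip := (@ip R N eps a).
Local Notation nrm := (@nrm R N eps a).
Local Notation sol := (@sol R N eps a).
Implicit Types (u v F G f phi psi : ZT -> R) (b x : 'rV[R]_N).
Implicit Types (p : ZT) (c r : R).

Lemma solB u v : sol u -> sol v -> sol (fun p => u p - v p).
Proof.
move=> [mu su] [mv sv]; split; first exact: mfunB.
move=> r r1; have [V [LU LV aU wU]] := su r r1; have [W [LU' LW aW wW]] := sv r r1.
exists (fun i p => V i p - W i p).
have -> : (fun p => inQ r p * (u p - v p)) = fun p => inQ r p * u p - inQ r p * v p.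
  by apply/funext => p; rewrite mulrBr.
split.
- exact: L2B.
- by move=> i; exact: L2B.
- move=> d d0; have d4 : 0 < d / 4 by rewrite divr_gt0.
  have [phi [sphi A1 A2]] := aU _ d4; have [psi [spsi B1 B2]] := aW _ d4.
  have key F G F' G' : L2 (fun p => F p - F' p) -> L2 (fun p => G p - G' p) ->
      nrm (fun p => F p - F' p) <= d / 4 -> nrm (fun p => G p - G' p) <= d / 4 ->
      nrm (fun p => (F p - G p) - (F' p - G' p)) <= d.
    move=> L1 L2' n1 n2.
    have -> : (fun p => (F p - G p) - (F' p - G' p)) =
        fun p => (F p - F' p) - (G p - G' p) by apply/funext => p; ring.
    apply: (le_trans (nrmB_le L1 L2')); move: n1 n2.
    set X := nrm _; set Y := nrm _; lra.
  have LQ f : smooth f -> L2 (fun p => inQ r p * f p) by move=> sf; exact: L2_inQ_smooth.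
  exists (fun p => phi p - psi p); split; first exact: smoothB.
    have -> : (fun p => inQ r p * (phi p - psi p) - (inQ r p * u p - inQ r p * v p)) =
       fun p => (inQ r p * phi p - inQ r p * psi p) - (inQ r p * u p - inQ r p * v p).
      by apply/funext => p; rewrite mulrBr.
    by apply: key => //; apply: L2B => //; exact: LQ.
  move=> i.
  have -> : (fun p => inQ r p * 'D_(dir i) (fun p => phi p - psi p) p - (V i p - W i p)) =
     fun p => (inQ r p * 'D_(dir i) phi p - inQ r p * 'D_(dir i) psi p) - (V i p - W i p).
    by apply/funext => p; rewrite derive_smoothB// mulrBr.
  by apply: key => //; apply: L2B => //; apply: LQ; exact: smooth_derive.
move=> psi A B spsi supp Ar Br.
have LD w : L2 (fun p => 'D_w psi p).
  apply: (supp_in_test_L2 eps01 a_gtN1 _ (supp_in_derive (v := w) supp)).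
  exact: smooth_derive.
have W1 := wU _ _ _ spsi supp Ar Br; have W2 := wW _ _ _ spsi supp Ar Br.
rewrite (ipBl LU LU' (LD et)).
have E (x y z t : R) : x = y -> z = t -> x - z = y - t by move=> -> ->.
apply: etrans (E _ _ _ _ W1 W2) _.
by rewrite -sumrB; apply: eq_bigr => i _; rewrite (ipBl (LV i) (LW i) (LD (dir i))).
Qed.

(** Both sides of the weak formulation vanish by [orth_invariant]: the time term since b . x is
    invariant in time, the tangential terms since the constants b_i are invariant under tangential
    shifts. The normal component of the gradient is 0. *)
Lemma sol_linear b : sol (fun p => dotx b p.1.1).
Proof.
pose l p := dotx b p.1.1.
have sl : smooth l.
  by apply: smooth_sum => i; apply: smoothZ; exact: (smooth_comp_coord (Some i)).
have lE p : l p = \sum_i comp i (b, 0) * comp i p.1.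
  by rewrite -dotzE /dotz/= mul0r addr0.
have Dl i p : 'D_(dir i) l p = comp i (b, 0).
  have -> : l = fun p => \sum_i comp i (b, 0) * comp i p.1 by exact/funext.
  rewrite derive_smooth_sum; last by move=> j; apply: smoothZ; exact: smooth_comp_coord.
  rewrite (bigD1 i)//= big1 => [|j ji].
    by rewrite addr0 derive_smoothZ ?derive_comp_coord ?comp_dir ?eqxx ?mulr1//; exact: smooth_comp_coord.
  rewrite derive_smoothZ ?derive_comp_coord ?comp_dir ?(negbTE ji) ?mulr0//; exact: smooth_comp_coord.
have ml : mfun l by exact: mfun_smooth.
split => // r r1; exists (fun i p => inQ r p * comp i (b, 0)).
have L1 (c : R) r' : 1 <= r' -> L2 (fun p => inQ r' p * c).
  by move=> r'1; apply: L2_inQ_smooth => //; exact: smooth_cst.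
split.
- exact: L2_inQ_smooth.
- by move=> i; exact: L1.
- move=> d d0; exists l; split => //.
    have -> : (fun p => inQ r p * l p - inQ r p * l p) = fun p => 0 * (inQ r p * l p).
      by apply/funext => p; ring.
    by rewrite nrmZ ?expr0n ?mul0r ?ltW//; exact: L2_inQ_smooth.
  move=> i.
  have -> : (fun p => inQ r p * 'D_(dir i) l p - inQ r p * comp i (b, 0)) =
     fun p => 0 * (inQ r p * l p) by apply/funext => p; rewrite Dl; ring.
  by rewrite nrmZ ?expr0n ?mul0r ?ltW//; exact: L2_inQ_smooth.
move=> psi A B spsi supp Ar Br.
have e0 : (et : ZT).1.2 = 0 by [].
have inv : invariant et l.
  move=> s; apply: aeW => p _.
  by rewrite /diff /l et_z subrr.
have Ll r' : 1 <= r' -> L2 (fun p => inQ r' p * l p) by move=> r'1; exact: L2_inQ_smooth.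
have O1 := orth_invariant eps01 a_gtN1 ml Ll inv e0 spsi supp.
have E1 : ip (fun p => inQ r p * l p) (fun p => 'D_et psi p) = 0.
  by apply: etrans O1; exact: (ip_inQ _ _ ml (supp_in_derive (v := et) supp) Ar Br).
apply: (etrans E1); apply/esym; apply: big1 => -[i|] _ /=; last first.
  have -> : (fun p : ZT => inQ r p * (0 : R)) = fun p => 0 * (inQ r p * 1).
    by apply/funext => p; ring.
  rewrite ipZl ?mul0r//; first exact: L1.
  apply: (supp_in_test_L2 eps01 a_gtN1 _ (supp_in_derive (v := dir None) supp)).
  exact: smooth_derive.
have mc : mfun (fun _ : ZT => b ord0 i) by exact: mfun_cst.
have inv1 : invariant (dir (Some i)) (fun _ : ZT => b ord0 i).
  by move=> s; apply: aeW => p _; rewrite /diff subrr.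
have O2 := orth_invariant eps01 a_gtN1 mc (L1 _) inv1 (erefl : (dir (Some i) : ZT).1.2 = 0) spsi supp.
apply: etrans O2; exact: (ip_inQ _ _ mc (supp_in_derive (v := dir (Some i)) supp) Ar Br).
Qed.

End assembly.

(** * The affine form of the solution *)

Section liouville.
Context {R : realType} {N : nat} (eps a : R).
Hypotheses (eps01 : 0 <= eps < 1) (a_gtN1 : -1 < a).
Local Notation ZT := ('rV[R]_N * R * R)%type.
Local Notation leb := (@lebesgue_zt R N).
Local Notation sol := (@sol R N eps a).
Implicit Types (u : ZT -> R) (b x y : 'rV[R]_N).
Implicit Types (p h k : ZT) (c s : R).

Definition space x : ZT := ((x, 0), 0).

Lemma spaceD x y : space (x + y) = space x + space y.
Proof. by rewrite /space; congr (_, _, _); rewrite addr0. Qed.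

Lemma spaceZ s x : space (s *: x) = s *: space x.
Proof. by rewrite /space; congr (_, _, _); rewrite scaler0. Qed.

Lemma dotxD b x y : dotx b (x + y) = dotx b x + dotx b y.
Proof. by rewrite /dotx -big_split; apply: eq_bigr => i _; rewrite mxE mulrDr. Qed.

Lemma half_vectors h k :
  let m := 2^-1 *: (h + k) in let n := 2^-1 *: (h - k) in
  [/\ m + m = h + k, n + n = h - k & k + n = m].
Proof.
have E (z : ZT) : 2^-1 *: z + 2^-1 *: z = z.
  by rewrite -scalerDl (_ : 2^-1 + 2^-1 = 1 :> R) ?scale1r//; field.
move=> m n; split; [exact: E|exact: E|].
apply/esym/eqP; rewrite -subr_eq -scalerBr opprB addrC addrA subrK scalerDr.
by apply/eqP; exact: E.
Qed.

(** A tangential shift is a space shift followed by a time shift, and the latter does not change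
    [u]. *)
Lemma tangential_diff u h : (forall s, {ae leb, forall p : ZT, 0 < p.1.2 ->
    diff (s *: et) u p = 0}) -> h.1.2 = 0 ->
  {ae leb, forall p : ZT, 0 < p.1.2 -> diff h u p = diff (space h.1.1) u p}.
Proof.
move=> H h0; have E : h = space h.1.1 + h.2 *: et.
  case: h h0 => [[x y] t] /= ->; rewrite /space/=.
  congr (_, _, _) => /=; rewrite ?scaler0 ?addr0 ?add0r//.
  by rewrite -[RHS]/(t * 1) mulr1.
apply: (aeS (ae_shift (space h.1.1) (H h.2))) => p Hp p0.
have := Hp; rewrite /= addr0 => /(_ p0); rewrite /diff -addrA -E => /eqP.
by rewrite subr_eq0 => /eqP ->.
Qed.

Variables (u : ZT -> R) (gamma C : R).
Hypotheses (su : sol u) (C0 : 0 <= C).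
Hypothesis u_growth : {ae leb, forall p : ZT, bounded_growth gamma C u p}.

(** Polarization: with m = (x + y)/2 and n = (x - y)/2, the mixed difference at [p] is the second
    difference of step [m] at [p] minus that of step [n] at p + y. The middle terms cancel because p
    + y + n = p + m. *)
Lemma mixed_difference x y : 0 <= gamma < 2 ->
  {ae leb, forall p : ZT, 0 < p.1.2 -> diff (space y) (diff (space x) u) p = 0}.
Proof.
move=> g02; have [Em En Emn] := half_vectors (space x) (space y).
set m := _ *: _ in Em Emn; set n := _ *: _ in En Emn.
have mE : m.1.2 = 0 /\ m.2 = 0 by rewrite /m/= !(addr0, scaler0).
have nE : n.1.2 = 0 /\ n.2 = 0 by rewrite /n/= !(subr0, oppr0, addr0, scaler0).
have H1 := second_difference eps01 a_gtN1 g02 C0 su u_growth mE.1 mE.2.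
have H2 := second_difference eps01 a_gtN1 g02 C0 su u_growth nE.1 nE.2.
apply: (aeS (aeI H1 (ae_shift (space y) H2))) => p [K1 K2] p0.
have yp : 0 < (p + space y).1.2 by rewrite /= addr0.
have := K1 p0; have := K2 yp; rewrite /diff.
have -> : p + space y + n + n = p + space x by rewrite -!addrA En (addrC (space y)) subrK.
have -> : p + space y + n = p + m by rewrite -addrA Emn.
have -> : p + m + m = p + space y + space x by rewrite -!addrA Em (addrC (space y)).
lra.
Qed.

(** The difference is again a solution. Its time differences vanish with those of [u], and its space
    differences are mixed differences of [u]. *)
Lemma space_difference_const x : 0 <= gamma < 2 ->
  exists c, {ae leb, forall p : ZT, 0 < p.1.2 -> diff (space x) u p = c}.
Proof.
move=> g02.
have sd : sol (diff (space x) u) by exact: sol_diff.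
apply: (invariant_solution_const eps01 a_gtN1 sd) => h h0.
have T s : {ae leb, forall p : ZT, 0 < p.1.2 -> diff (s *: et) (diff (space x) u) p = 0}.
  have H := time_invariant eps01 a_gtN1 s g02 C0 su u_growth.
  apply: (aeS (aeI H (ae_shift (space x) H))) => p [K1 K2] p0.
  have yp : 0 < (p + space x).1.2 by rewrite /= addr0.
  have := K1 p0; have := K2 yp; rewrite /diff.
  have -> : p + space x + s *: et = p + s *: et + space x by rewrite addrAC.
  lra.
apply: (aeS (aeI (tangential_diff T h0) (mixed_difference x h.1.1 g02))) => p [K1 K2] p0.
by rewrite K1// K2.
Qed.

Lemma sol_const : 0 <= gamma < 1 ->
  exists c, {ae leb, forall p : ZT, 0 < p.1.2 -> u p = c}.
Proof.
move=> /andP[g0 g1].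
have g01 : 0 <= gamma < 1 by rewrite g0.
have g02 : 0 <= gamma < 2 by apply/andP; split; lra.
apply: (invariant_solution_const eps01 a_gtN1 su) => h h0.
have T s := time_invariant eps01 a_gtN1 s g02 C0 su u_growth.
have F := first_difference eps01 a_gtN1 g01 C0 su u_growth (erefl : (space h.1.1).1.2 = 0) (erefl : (space h.1.1).2 = 0).
apply: (aeS (aeI (tangential_diff T h0) F)) => p [K1 K2] p0.
by rewrite K1// K2.
Qed.

Lemma sol_affine : 0 <= gamma < 2 ->
  exists b c, {ae leb, forall p : ZT, 0 < p.1.2 -> u p = dotx b p.1.1 + c}.
Proof.
move=> g02; have [g0 g2] := andP g02.
have [g Hg] := choice (fun x => space_difference_const x g02).
have gD x y : g (x + y) = g x + g y.
  (* The three identities hold almost everywhere and are compared at one common point. *)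
  have [p p0 [[E1 E2] E3]] :=
    ae_half_space_ex (aeI (aeI (Hg (x + y)) (Hg x)) (ae_shift (space x) (Hg y))).
  have yp : 0 < (p + space x).1.2 by rewrite /= addr0.
  have := E1 p0; have := E2 p0; have := E3 yp; rewrite /diff spaceD addrA; lra.
(* The value g(s x) is a difference of two values of [u], at a point of the unit box and at its
   translate. For |s| <= 1 both points lie in one bounded region, where the growth bound is uniform;
   the first point may depend on [s]. *)
have g_bounded x : exists K, forall s, `|s| <= 1 -> `|g (s *: x)| <= K.
  pose D : R := #|{: option 'I_N}|%:R.
  (* [D] bounds |z|^2 on the unit box and the last 1 bounds |t|; the factors 2 are those of
     [sqnormzD_le]. *)
  pose M := 2 * D + 2 * sqnormz (x, 0) + 1.
  have D0 : 0 <= D by exact: ler0n.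
  have S0 := sqnormz_ge0 (x, 0).
  pose B := C * (1 + M `^ gamma) `^ 2^-1.
  exists (2 * B) => s s1.
  have [p [p0 p1 p2 [[G1 G2] E]]] :=
    ae_unit_box_ex (aeI (aeI u_growth (ae_shift (space (s *: x)) u_growth)) (Hg (s *: x))).
  have bnd q : bounded_growth gamma C u q -> 0 < q.1.2 -> sqnormz q.1 + `|q.2| <= M ->
      `|u q| <= B.
    move=> Gq q0 qM; apply: (le_trans (Gq q0)); apply: (ler_wpM2l C0).
    have X0 : 0 <= sqnormz q.1 + `|q.2| by rewrite addr_ge0 ?sqnormz_ge0.
    apply: ge0_ler_powR; rewrite ?nnegrE ?addr_ge0 ?powR_ge0 ?invr_ge0//.
    rewrite lerD2l; apply: ge0_ler_powR; rewrite ?nnegrE//; exact: le_trans qM.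
  have n1 : sqnormz p.1 <= D.
    rewrite sqnormzE /D -[X in _ <= X%:R](sum1_card) natr_sum; apply: ler_sum => i _.
    by have /andP[c0 c1] := p1 i; rewrite expr_le1.
  have n2 : `|p.2| <= 1 by have /andP[t0 t1] := p2; rewrite ger0_norm.
  have n3 : sqnormz (p + space (s *: x)).1 <= 2 * D + 2 * sqnormz (x, 0).
    apply: (le_trans (sqnormzD_le _ _)).
    have -> : sqnormz (space (s *: x)).1 = s ^+ 2 * sqnormz (x, 0).
      by rewrite spaceZ -sqnormzZ.
    have : s ^+ 2 * sqnormz (x, 0) <= sqnormz (x, 0).
      by rewrite ler_piMl// -[s ^+ 2]real_normK ?num_real// expr_le1.
    lra.
  have yp : 0 < (p + space (s *: x)).1.2 by rewrite /= addr0.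
  have B1 := bnd _ (G1) p0; have B2 := bnd _ (G2) yp.
  rewrite -(E p0) /diff; apply: (le_trans (ler_normB _ _)).
  have : `|u p| <= B by apply: B1; rewrite /M; lra.
  have : `|u (p + space (s *: x))| <= B by apply: B2; rewrite /= addr0 /M; lra.
  lra.
have gZ s x : g (s *: x) = s * g x.
  have [K HK] := g_bounded x.
  rewrite -[in RHS](scale1r x); apply: (additive_bounded_linear (f := fun s => g (s *: x)) _ HK).
  by move=> s' t; rewrite scalerDl gD.
pose b : 'rV[R]_N := \row_i g (delta_mx 0 i).
have gE x : g x = dotx b x.
  have g_0 : g 0 = 0 by rewrite -(scale0r 0) gZ mul0r.
  rewrite {1}[x]row_sum_delta (big_morph g gD g_0); apply: eq_bigr => i _.
  by rewrite gZ mulrC mxE.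
have sw : sol (fun p => u p - dotx b p.1.1) by apply: solB => //; exact: sol_linear.
have [h h0|c Hc] := invariant_solution_const eps01 a_gtN1 sw.
  have T s := time_invariant eps01 a_gtN1 s g02 C0 su u_growth.
  apply: (aeS (aeI (tangential_diff T h0) (Hg h.1.1))) => p [K1 K2] p0.
  have := K1 p0; rewrite (K2 p0) gE /diff => K.
  rewrite (dotxD b p.1.1 h.1.1 : dotx b (p + h).1.1 = _); lra.
exists b, c; apply: (aeS Hc) => p Hp p0; have := Hp p0; lra.
Qed.

End liouville.

Theorem theorem1p2 (R : realType) (N : nat) (a eps gamma : R)
    (u : 'rV[R]_N * R * R -> R) :
  (1 <= N)%N -> -1 < a -> 0 <= eps < 1 -> 0 <= gamma < 2 ->
  entire_solution eps a u ->
  (exists2 C : R, 0 < C &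
    {ae lebesgue_zt N, forall p : 'rV[R]_N * R * R,
       0 < p.1.2 ->
       `|u p| <= C * (1 + (sqnormz p.1 + `|p.2|) `^ gamma) `^ 2^-1}) ->
  (exists (b : 'rV[R]_N) (c : R),
    {ae lebesgue_zt N, forall p : 'rV[R]_N * R * R,
       0 < p.1.2 -> u p = dotx b p.1.1 + c}) /\
  (gamma < 1 ->
    exists c : R, {ae lebesgue_zt N, forall p : 'rV[R]_N * R * R,
       0 < p.1.2 -> u p = c}).
Proof.
move=> _ a1 e01 g02 eu [C C0 Hu].
have su := sol_half e01 a1 eu.
have uE p : 0 < p.1.2 -> half u p = u p by rewrite /half => ->.
have hu : {ae lebesgue_zt N, forall p : 'rV[R]_N * R * R, bounded_growth gamma C (half u) p}.
  by apply: (aeS Hu) => p Hp p0; rewrite uE//; exact: Hp.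
split.
  have [b [c H]] := sol_affine e01 a1 su (ltW C0) hu g02.
  by exists b, c; apply: (aeS H) => p Hp p0; rewrite -uE//; exact: Hp.
move=> g1; have g01 : 0 <= gamma < 1 by case/andP: g02 => -> _.
have [c H] := sol_const e01 a1 su (ltW C0) hu g01.
by exists c; apply: (aeS H) => p Hp p0; rewrite -uE//; exact: Hp.
Qed.
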